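(* There exists an absolute constant $C>0$ such that for every integer $N\ge1$, every isotropic log-concave random vector $X$ in $\mathbb{R}^N$, every integer $1\le\ell\le N$ and every real $t\ge C\log(eN/\ell)$, $$\mathbb{P}\big(X^*(\ell)\ge t\big)\le\exp\big(-\sigma_X^{-1}(C^{-1}t\sqrt\ell)\big).$$
   Context: A random vector in $\mathbb{R}^N$ is called isotropic log-concave if it is centered, its covariance matrix is the identity, and its distribution has a log-concave density with respect to Lebesgue measure. For $X=(X(1),\dots,X(N))$, $X^*(1)\ge\dots\ge X^*(N)$ denotes the non-increasing rearrangement of $|X(1)|,\dots,|X(N)|$. For $p\ge1$, $$\sigma_X(p)=\sup_{u\in S^{N-1}}(\mathbb{E}|\langle u,X\rangle|^p)^{1/p},$$ where $S^{N-1}$ is the Euclidean unit sphere; it is a nondecreasing function of $p$. Its inverse is $\sigma_X^{-1}(s)=\sup\{p\ge1:\sigma_X(p)\le s\}$, which may equal $+\infty$, with the convention $\exp(-\infty)=0$. *)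

(* Defs.v *)
From HB Require Import structures.
From mathcomp Require Import all_boot all_order all_algebra.
From mathcomp Require Import all_classical all_reals all_analysis.

Set Implicit Arguments.
Unset Strict Implicit.
Unset Printing Implicit Defensive.

Import Order.TTheory GRing.Theory Num.Theory.
Import numFieldNormedType.Exports.

Local Open Scope classical_set_scope.
Local Open Scope ring_scope.

(* R^N is the type of N-tuples because this is where the library puts the
   product sigma-algebra; measurableTypeR R is R with its Borel sets. *)
Notation Rn R N := (N.-tuple (measurableTypeR R)).

Lemma sigma_finite_prod d1 d2 (T1 : measurableType d1) (T2 : measurableType d2)
    (R : realType) (m1 : {sigma_finite_measure set T1 -> \bar R})
    (m2 : {sigma_finite_measure set T2 -> \bar R}) :
  sigma_finite [set: T1 * T2] (m1 \x m2)%E.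
Proof.
have /sigma_finiteP[F [TF ndF Foo]] := sigma_finiteT m1.
have /sigma_finiteP[G [TG ndG Goo]] := sigma_finiteT m2.
exists (fun n => F n `*` G n).
  rewrite -setXTT TF TG predeqE => -[x y]; split.
    move=> [/= [n _ Fnx] [k _ Gky]]; exists (maxn n k) => //; split.
    - by move: x Fnx; exact/subsetPset/ndF/leq_maxl.
    - by move: y Gky; exact/subsetPset/ndG/leq_maxr.
  by move=> [n _ []/= ? ?]; split; exists n.
move=> k; have [? ?] := Foo k; have [? ?] := Goo k.
split; first exact: measurableX.
by rewrite product_measure1E// lte_mul_pinfty// ge0_fin_numE.
Qed.

Section lebesgue_measure_Rn.
Context {R : realType}.
Local Open Scope ereal_scope.

Definition consRn (n : nat) (p : measurableTypeR R * Rn R n) : Rn R n.+1 :=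
  [tuple of p.1 :: p.2].

Lemma measurable_consRn n : measurable_fun [set: _] (@consRn n).
Proof. exact: measurable_cons. Qed.

HB.instance Definition _ n :=
  isMeasurableFun.Build _ _ _ _ (@consRn n) (@measurable_consRn n).

Definition unconsRn (n : nat) (x : Rn R n.+1) : measurableTypeR R * Rn R n :=
  (thead x, [tuple of behead x]).

Lemma measurable_unconsRn n : measurable_fun [set: _] (@unconsRn n).
Proof.
apply/measurable_fun_pairP; split; first exact: measurable_tnth.
exact: measurable_behead.
Qed.

Lemma consRnK n : cancel (@consRn n) (@unconsRn n).
Proof. by case=> x y; rewrite /unconsRn /consRn theadE; congr pair; exact/val_inj. Qed.

Section step.
Context (n : nat) (mu : {sigma_finite_measure set (Rn R n) -> \bar R}).

Definition lebesgueRn_step : set (Rn R n.+1) -> \bar R :=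
  pushforward (@lebesgue_measure R \x mu)
    (@consRn n : {mfun (measurableTypeR R * Rn R n)%type >-> Rn R n.+1}).

Let step0 : lebesgueRn_step set0 = 0.
Proof. exact: measure0. Qed.

Let step_ge0 A : 0 <= lebesgueRn_step A.
Proof. exact: measure_ge0. Qed.

Let step_sigma_additive : semi_sigma_additive lebesgueRn_step.
Proof. exact: measure_semi_sigma_additive. Qed.

HB.instance Definition _ := isMeasure.Build _ _ _ lebesgueRn_step
  step0 step_ge0 step_sigma_additive.

Lemma sigma_finite_lebesgueRn_step : sigma_finite setT lebesgueRn_step.
Proof.
have [F TF Foo] := sigma_finite_prod (@lebesgue_measure R) mu.
exists (fun k => @unconsRn n @^-1` F k).
  by rewrite -preimage_bigcup -TF preimage_setT.
move=> k; have [mF Fk] := Foo k; split.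
  by rewrite -[X in measurable X]setTI; exact: measurable_unconsRn.
rewrite /lebesgueRn_step /pushforward -comp_preimage.
by rewrite (_ : _ \o _ = id) ?preimage_id//; apply/funext => p /=; rewrite consRnK.
Qed.

HB.instance Definition _ := Measure_isSigmaFinite.Build _ _ _ lebesgueRn_step
  sigma_finite_lebesgueRn_step.

End step.

(* Lebesgue measure on R^0 is the unit mass at the empty tuple, and Lebesgue
   measure on R^(n+1) is the product of those on R and on R^n, transported
   along (x, y) |-> x :: y. *)
Fixpoint lebesgueRn (n : nat) : {sigma_finite_measure set (Rn R n) -> \bar R} :=
  match n with
  | 0 => \d_([tuple] : Rn R 0)
  | n.+1 => lebesgueRn_step (lebesgueRn n)
  end.

Lemma lebesgueRn_box n (A : 'I_n -> set (measurableTypeR R)) :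
  (forall i, measurable (A i)) ->
  lebesgueRn n [set x | forall i, A i (tnth x i)] =
  \prod_(i < n) lebesgue_measure (A i).
Proof.
elim: n A => [|n IHn] A mA.
  rewrite big_ord0 /= diracE mem_set//= => -[]//.
rewrite big_ord_recl -IHn; last by move=> i; exact: mA.
rewrite -product_measure1E//; last first.
  rewrite (_ : [set x | _] = \bigcap_(i in [set: 'I_n])
     ((fun x : Rn R n => tnth x i) @^-1` (A (lift ord0 i)))).
    apply: fin_bigcap_measurable => // i _.
    by rewrite -[X in measurable X]setTI; exact: measurable_tnth.
  by apply/seteqP; split => x /= Ax i; [move=> _|]; exact: Ax.
rewrite /= /lebesgueRn_step /pushforward; congr (_ _).
apply/seteqP; split => -[a x] /=.
  by move=> Ax; split; [exact: (Ax ord0)|move=> i; have := Ax (lift ord0 i); rewrite tnthS].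
move=> [Aa Ax] i; have [j ->|->] := unliftP ord0 i; last exact: Aa.
by rewrite tnthS; exact: Ax.
Qed.

End lebesgue_measure_Rn.

Section definitions.
Context {R : realType} {N : nat}.
Implicit Types (x y u : Rn R N) (f : Rn R N -> R).

Definition dotRn x y : R := \sum_(i < N) tnth x i * tnth y i.

Definition sphereRn : set (Rn R N) := [set u | dotRn u u = 1].

(* The power r `^ s satisfies 0 `^ 0 = 1, so the endpoints t = 0 and t = 1 of
   the inequality are trivial. *)
Definition log_concave f : Prop :=
  (forall x, 0 <= f x) /\
  forall x y (t : R), 0 <= t <= 1 ->
    f x `^ t * f y `^ (1 - t) <=
    f [tuple t * tnth x i + (1 - t) * tnth y i | i < N].

(* rearr x l is x^*(l), where l ranges over 1, ..., N. *)
Definition rearr x (l : nat) : R :=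
  nth 0 (sort (fun a b : R => b <= a) [seq `|a : R| | a <- x]) l.-1.

Context {d : measure_display} {T : measurableType d} {P : probability T R}.
Implicit Type X : {RV P >-> Rn R N}.
Local Open Scope ereal_scope.

Definition coordRV X (i : 'I_N) : T -> R := fun w => tnth (X w) i.

Definition has_log_concave_density X : Prop :=
  exists f : Rn R N -> R,
    [/\ measurable_fun [set: Rn R N] f, log_concave f &
     forall A : set (Rn R N), measurable A ->
       distribution P X A = \int[lebesgueRn N]_(x in A) (f x)%:E].

(* A covariance of the i-th coordinate with itself equal to 1 makes this
   coordinate square integrable, so every expectation here is genuine. *)
Definition isotropic_log_concave X : Prop :=
  [/\ forall i, 'E_P[coordRV X i] = 0,
      forall i j, covariance P (coordRV X i) (coordRV X j) = ((i == j)%:R)%:E &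
      has_log_concave_density X].

(* 'N[P]_p%:E[g] unfolds to the p-th root of the expectation of |g|^p. *)
Definition sigmaRV X (p : R) : \bar R :=
  ereal_sup [set 'N[P]_p%:E[(fun w => (dotRn u (X w))%:E)] | u in sphereRn].

Definition sigmaRV_inv X (s : R) : \bar R :=
  ereal_sup [set p%:E | p in [set p : R | (1 <= p)%R /\ sigmaRV X p <= s%:E]].

End definitions.

(* Main.v *)
(* By Prekopa-Leindler the law Q of X is log-concave as a measure, and this is
   all that is used of the density.

   Deviations (Paouris).  For a set J of m coordinates, suppose that |X_J| exceeds
   a sqrt(m) with probability at least e^-k, while E|X_J|^2 = m and every marginal
   <u, X> exceeds s with probability at most e^(-14 k).  Apply to X_J a random k x n
   matrix G with independent entries from a discretized truncated Gaussian; it lives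
   on a finite probability space whose weights satisfy Maurey's property (tau), by
   Prekopa-Leindler for step functions.  If a sqrt(m) is much larger than s, then
   property (tau) and the tail of the marginals yield one G for which the
   k-dimensional vector G X_J is typically of size sqrt(k m) and yet, in each of the
   2^k orthants, comes with probability e^(-O(k)) near the points all of whose
   coordinates are at least a sqrt(m)/100.  By convexity the log-concave mass
   function of G X_J on a suitable lattice is then at least e^(-O(k)) on a cube with
   more than e^(55 k) points, which is more than the total mass allows.

   Counting.  Let B be convex with Q(B) >= e^-v.  If the half-spaces {+-x_i >= t},
   i in J, take a proportion at least e^-u of B, then, by Borell's lemma inside B,
   each |x_i| exceeds t/(4u) on a quarter of B, so |X_J| is large with probability
   at least e^-v/8, and the deviation estimate with k of order v + p bounds #|J|.

   Order statistics.  If X^*(l) >= t then X lies in at least l of the half-spaces,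
   hence in at least l^r intersections of r of them.  Summing the probabilities of
   these intersections as a tree of depth r >= p, with the count at each node,
   gives l^r P(X^*(l) >= t) <= (l/e)^r for every p with sigma_X(p) <= t sqrt(l)/C. *)

Require Import Defs.
From HB Require Import structures.
From mathcomp Require Import all_boot all_order all_algebra.
From mathcomp Require Import all_classical all_reals all_analysis measurable_realfun.
From mathcomp Require Import ring lra zify.
Import Order.TTheory GRing.Theory Num.Theory.
Import numFieldNormedType.Exports.
Set Implicit Arguments.
Unset Strict Implicit.
Unset Printing Implicit Defensive.

Local Open Scope classical_set_scope.
Local Open Scope ring_scope.

(** * The Prekopa-Leindler inequality *)

(** What shapes the proof is that B varies: along the tree Q(B) drops to e^-v with v growing, so
    deviations are needed at every level e^-k with a loss only linear in k. Borell's lemma provides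
    this, stretching the tail e^(-2 p) at e^2 sigma_X(p) to e^(-14 k) at 28 k / p times that scale.
    The count is then quadratic in 1 + v / p. A child of proportion e^-u may occur about e^(u/2)
    times, and a further e^(u/4) pays for the growth of v, so the sum over u still converges.

    The exponents of the deviation estimate form a budget. A prescribed orthant is reached at cost
    e^(-10 k) by G (1000 <= e^10) and e^-k by X, which makes 11; 14 leaves room for a union bound
    over the k rows. Sets of matrices at squared distance 64 k have masses with product at most e^(1
    - 16 k) by property (tau), enough against e^(-11 k) and the number of orthants.

    The grid replaces Gaussian integrals by finite sums. Its mesh is 1 / (k n): rounding loses a
    factor e^(1/(k n)) per entry, hence a factor e in all. On the side of X, masses of l1 balls
    around lattice points take the place of a density of G X_J. *)

(** The real bounds u and v may be negative, so that even x = 0 has strict lower bounds; an infinite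
    x or y is refuted with -1 for the other variable. *)
Lemma lee_wDl_lt (R : realType) (x y z : \bar R) (a : R) : 0 < a < 1 ->
  (0 <= x)%E -> (0 <= y)%E ->
  (forall u v : R, (u%:E < x)%E -> (v%:E < y)%E -> ((a * u + (1 - a) * v)%:E <= z)%E) ->
  (a%:E * x + (1 - a)%:E * y <= z)%E.
Proof.
move=> /andP[a0 a1] x0 y0 h; have b0 : 0 < 1 - a by rewrite subr_gt0.
have m1 (t : \bar R) : (0 <= t)%E -> ((-1)%:E < t)%E.
  by apply: lt_le_trans; rewrite lte_fin ltrN10.
case: z h => [r| |] h; last 2 first.
- by rewrite leey.
- by have := h (-1) (-1) (m1 _ x0) (m1 _ y0).
case: x x0 h => [x| |]// x0 h; last first.
  have := h ((r + 1 + (1 - a)) / a) (-1) (ltry _) (m1 _ y0).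
  rewrite lee_fin mulrC divfK ?gt_eqF//; move=> ?; exfalso; move: a1; lra.
case: y y0 h => [y| |]// y0 h; last first.
  have := h (-1) ((r + 1 + a) / (1 - a)) (m1 _ x0) (ltry _).
  by rewrite lee_fin [X in _ + X]mulrC divfK ?gt_eqF//; move=> ?; exfalso; move: a1; lra.
rewrite -!EFinM -EFinD lee_fin; apply/ler_addgt0Pr => e e0.
have := h (x - e) (y - e); rewrite !lte_fin lee_fin !ltrBlDr !ltrDl => /(_ e0 e0).
move: e0; clear; lra.
Qed.

(** * The Brunn-Minkowski inequality on the line *)

Section brunn_minkowski.
Context {R : realType}.
Local Notation mu := (@lebesgue_measure R).
Implicit Types (A B D : set (measurableTypeR R)) (a b c u : R).

Lemma measurable_affine_preimage A a c : measurable A ->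
  measurable ((fun x : measurableTypeR R => a * x + c) @^-1` A).
Proof.
move=> mA; rewrite -[X in measurable X]setTI.
suff : measurable_fun [set: measurableTypeR R]
    (fun x : measurableTypeR R => a * x + c : measurableTypeR R) by exact.
by apply: measurable_funD => //; apply: measurable_funM.
Qed.

Lemma lebesgue_measure_affine A a c : 0 < a -> measurable A ->
  mu A = (a%:E * mu ((fun x => (a * x + c)%R) @^-1` A))%E.
Proof.
move=> a0 mA.
have mf : measurable_fun [set: measurableTypeR R]
    (fun x : measurableTypeR R => a * x + c : measurableTypeR R).
  by apply: measurable_funD => //; apply: measurable_realfun.measurable_funM.
pose m0 : measure (measurableTypeR R) R :=
  measure_function_pushforward__canonical__measure_function_Measure mu mf.
pose m : measure (measurableTypeR R) R := mscale (NngNum (ltW a0)) m0.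
rewrite (@lebesgue_measure_unique R m)//.
move=> _ [[x y]] _ <-.
rewrite /m /= /mscale /m0/= /pushforward.
rewrite [X in (_ = _ * mu X)%E](_ : _ = `](x - c) / a, (y - c) / a]%classic); last first.
  apply/seteqP; split => z /=;
    by rewrite !in_itv/= ltr_pdivrMr// ler_pdivlMr// ltrBlDr lerBrDr mulrC.
rewrite !lebesgue_measure_itv/= !lte_fin ltr_pM2r ?invr_gt0// ltrD2r.
case: ifPn => xy; last by rewrite mule0.
by rewrite -!EFinB -EFinM; congr EFin; field; rewrite gt_eqF.
Qed.

(** In [brunn_minkowski1] the set should be cut at its maximum. Failing one, it is cut at one of its
    own points, so close to the supremum that continuity from below keeps the mass above [u]. *)
Lemma measure_ltitv_near_sup A u : measurable A -> A !=set0 ->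
  (u%:E < mu A)%E -> exists2 a, A a & (u%:E < mu (A `&` `]-oo, a]))%E.
Proof.
move=> mA A0 uA.
have [[M [AM leM]]|nomax] := pselect (exists M, A M /\ forall x, A x -> x <= M).
  exists M => //; rewrite (_ : _ `&` _ = A)//.
  by apply/seteqP; split => x /=; [case|move=> Ax; split=> //; rewrite in_itv/= leM].
have next x : A x -> exists2 y, A y & x < y.
  move=> Ax; apply: contrapT => nex; apply: nomax; exists x; split=> // y Ay.
  by rewrite leNgt; apply/negP => xy; apply: nex; exists y.
(* Thresholds increasing to the supremum: [sup A - 1 / (n + 1)], or [n] when A is unbounded above.
   Each stays below some point of A. *)
have [r [rnd rlt rge]] : exists r : nat -> R, [/\ {homo r : n m / (n <= m)%N >-> n <= m},
    (forall n, exists2 y, A y & r n < y) & forall x, A x -> exists n, x <= r n].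
  have [ubA|nubA] := pselect (has_ubound A).
    exists (fun n => sup A - n.+1%:R^-1); split.
    - by move=> n m nm; rewrite lerD2l lerN2 lef_pV2 ?posrE// ler_nat ltnS.
    - move=> n; have n0 : 0 < n.+1%:R^-1 :> R by rewrite invr_gt0.
      by have [y Ay ny] := sup_adherent n0 (conj A0 ubA); exists y.
    - move=> x Ax; have [y Ay xy] := next _ Ax.
      have xs : x < sup A by apply: (lt_le_trans xy); exact: ub_le_sup.
      have s0 : 0 < sup A - x by rewrite subr_gt0.
      have /ltr_add_invr[k kP] : x < sup A by [].
      by exists k; rewrite lerBrDr ltW.
  exists (fun n => n%:R); split.
  - by move=> n m; rewrite ler_nat.
  - move=> n; apply: contrapT => nex; apply: nubA; exists n%:R => x Ax.
    by rewrite leNgt; apply/negP => nx; apply: nex; exists x.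
  - by move=> x Ax; exists (Num.truncn x).+1; apply/ltW/truncnS_gt.
have cv : (mu (A `&` `]-oo, r n]) @[n --> \oo] --> mu A)%E.
  rewrite [X in _ --> mu X](_ : A = \bigcup_n (A `&` `]-oo, r n])); last first.
    apply/seteqP; split => [x Ax|x [n _ []]//].
    by have [n xn] := rge _ Ax; exists n => //; split=> //=; rewrite in_itv.
  apply: nondecreasing_cvg_mu.
  - by move=> n; apply: measurableI => //; exact: measurable_itv.
  - by apply: bigcup_measurable => n _; apply: measurableI => //; exact: measurable_itv.
  - move=> n m nm; apply/subsetPset => x [Ax /=]; rewrite !in_itv/= => xn; split=> //=.
    by rewrite (le_trans xn)// rnd.
have [n un] : exists n, (u%:E < mu (A `&` `]-oo, r n]))%E.
  apply: contrapT => nex.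
  suff : (mu A <= u%:E)%E by rewrite leNgt uA.
  apply: (cvge_to_le cv).
  by near=> n; rewrite leNgt; apply/negP => h; apply: nex; exists n.
have [y Ay ry] := rlt n; exists y => //; apply: (lt_le_trans un).
apply: le_measure; rewrite ?inE.
- by apply: measurableI => //; exact: measurable_itv.
- by apply: measurableI => //; exact: measurable_itv.
- by move=> x [Ax /=]; rewrite !in_itv/= => xr; split=> //=; rewrite (le_trans xr)// ltW.
Unshelve. all: by end_near.
Qed.

(** By reflection. The cut point is dropped, which costs a null set, so that the two pieces in
    [brunn_minkowski1] are disjoint. *)
Lemma measure_gtitv_near_inf A u : measurable A -> A !=set0 ->
  (u%:E < mu A)%E -> exists2 a, A a & (u%:E < mu (A `&` `]a, +oo[))%E.
Proof.
move=> mA [x0 Ax0] uA.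
have mN : measurable_fun [set: measurableTypeR R] (-%R : _ -> measurableTypeR R).
  exact: measurable_funN.
have mNA B : measurable B -> measurable ((-%R : _ -> measurableTypeR R) @^-1` B).
  by move=> mB; rewrite -[X in measurable X]setTI; exact: mN.
have [|||a Aa] := @measure_ltitv_near_sup ((-%R : _ -> measurableTypeR R) @^-1` A) u.
- exact: mNA.
- by exists (- x0) => /=; rewrite opprK.
- by move: (lebesgue_measureN mA); rewrite /pushforward => ->.
move=> ua; exists (- a) => //; apply: (lt_le_trans ua).
have mAa : measurable (A `&` `[- a, +oo[) by apply: measurableI => //; exact: measurable_itv.
have mAa' : measurable (A `&` `]- a, +oo[) by apply: measurableI => //; exact: measurable_itv.
rewrite (_ : _ `&` _ = (-%R : _ -> measurableTypeR R) @^-1` (A `&` `[- a, +oo[)); last first.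
  apply/seteqP; split => x [? /=]; rewrite !in_itv/= ?andbT => ?; split=> //=;
    rewrite ?in_itv/= ?andbT.
    by rewrite lerN2.
  by rewrite -lerN2.
have := lebesgue_measureN mAa; rewrite /pushforward => ->.
set I := A `&` `]- a, +oo[ in mAa' *.
rewrite -[leRHS]adde0 -(lebesgue_measure_set1 (- a)).
apply: (@le_trans _ _ (mu (I `|` [set - a]))).
  apply: le_measure; rewrite ?inE//; first exact: measurableU.
  move=> x [Ax /=]; rewrite !in_itv/= andbT le_eqVlt => /orP[/eqP <-|h]; first by right.
  by left; split=> //=; rewrite ?in_itv/= ?andbT.
by rewrite measureU2.
Qed.

(** For x in A and y in B put c = a x + (1 - a) y. The part of A up to x, scaled by a and shifted by
    (1 - a) y, lies in D up to c; the part of B beyond y, scaled by 1 - a and shifted by a x, lies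
    in D beyond c. So the lengths add, and the cuts lose arbitrarily little. *)
Lemma brunn_minkowski1 A B D a : 0 < a < 1 ->
  measurable A -> measurable B -> measurable D -> A !=set0 -> B !=set0 ->
  (forall x y, A x -> B y -> D (a * x + (1 - a) * y)) ->
  (a%:E * mu A + (1 - a)%:E * mu B <= mu D)%E.
Proof.
move=> /andP[a0 a1] mA mB mD A0 B0 ABD.
have a1' : 0 < 1 - a by rewrite subr_gt0.
have step x y : A x -> B y ->
    (a%:E * mu (A `&` `]-oo, x]) + (1 - a)%:E * mu (B `&` `]y, +oo[) <= mu D)%E.
  move=> Ax By; set c := a * x + (1 - a) * y.
  have mD1 : measurable (D `&` `]-oo, c]) by apply: measurableI => //; exact: measurable_itv.
  have mD2 : measurable (D `&` `]c, +oo[) by apply: measurableI => //; exact: measurable_itv.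
  have -> : mu D = (mu (D `&` `]-oo, c]) + mu (D `&` `]c, +oo[))%E.
    rewrite -measureU//; last first.
      apply/seteqP; split => z //= -[[_ ] + [_]].
      by rewrite !in_itv/= andbT => zc /(le_lt_trans zc); rewrite ltxx.
    congr (mu _); apply/seteqP; split => [z Dz|z [] []//].
    by have [zc|zc] := leP z c; [left|right]; split=> //=; rewrite in_itv/= ?zc.
  apply: leeD.
    rewrite (lebesgue_measure_affine ((1 - a) * y) a0 mD1).
    apply: lee_wpmul2l; first by rewrite lee_fin ltW.
    apply: le_measure; rewrite ?inE.
    - by apply: measurableI => //; exact: measurable_itv.
    - exact: measurable_affine_preimage.
    move=> z [Az /=]; rewrite !in_itv/= => zx; split => /=; first exact: ABD.
    by rewrite /c lerD2r ler_pM2l.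
  rewrite (lebesgue_measure_affine (a * x) a1' mD2).
  apply: lee_wpmul2l; first by rewrite lee_fin ltW.
  apply: le_measure; rewrite ?inE.
  - by apply: measurableI => //; exact: measurable_itv.
  - exact: measurable_affine_preimage.
  move=> z [Bz /=]; rewrite !in_itv/= !andbT => yz; split => /=.
    by rewrite addrC; exact: ABD.
  by rewrite ?andbT /c [ltLHS]addrC ltrD2r ltr_pM2l.
apply: lee_wDl_lt => //; first exact/andP.
move=> u v uA vB.
have [x Ax ux] := measure_ltitv_near_sup mA A0 uA.
have [y By vy] := measure_gtitv_near_inf mB B0 vB.
apply: le_trans (step x y Ax By); rewrite EFinD !EFinM.
by apply: leeD; apply: lee_wpmul2l; rewrite ?lee_fin ltW.
Qed.
End brunn_minkowski.

(** * Prekopa-Leindler on the line, level set by level set *)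

Section prekopa_leindler1.
Context {R : realType}.
Local Notation mu := (@lebesgue_measure R).
Implicit Types (F G H : measurableTypeR R -> \bar R) (a s : R).

(* x^a y^(1-a) <= z, phrased with real lower bounds of x and y so that
   no product 0 * +oo has to be given a meaning. *)
Definition wgm_le a (x y z : \bar R) : Prop :=
  forall u v : R, 0 < u -> 0 < v -> (u%:E < x)%E -> (v%:E < y)%E ->
  ((u `^ a * v `^ (1 - a))%:E <= z)%E.

Lemma wgm_am a (u v : R) : 0 < a < 1 -> 0 < u -> 0 < v ->
  u `^ a * v `^ (1 - a) <= a * u + (1 - a) * v.
Proof.
move=> /andP[a0 a1] u0 v0; have b0 : 0 < 1 - a by rewrite subr_gt0.
have e1 : (u `^ a) `^ a^-1 = u by rewrite -powRrM mulfV ?gt_eqF// powRr1// ltW.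
have e2 : (v `^ (1 - a)) `^ (1 - a)^-1 = v by rewrite -powRrM mulfV ?gt_eqF// powRr1// ltW.
have := @conjugate_powR R (u `^ a) (v `^ (1 - a)) a^-1 (1 - a)^-1.
rewrite e1 e2 !powR_ge0 !invr_gt0 !invrK a0 b0 [a * u]mulrC [(1 - a) * v]mulrC.
by apply => //; rewrite addrC subrK.
Qed.

Lemma measure_itv_lt (y : \bar R) : (0 <= y)%E ->
  mu [set s | 0 < s /\ (s%:E < y)%E] = y.
Proof.
case: y => [r| |]// r0.
  rewrite (_ : [set _ | _] = `]0, r[%classic); last first.
    by apply/seteqP; split => s /=; rewrite in_itv/= lte_fin; [move=> [-> ->]|move=> /andP].
  rewrite lebesgue_measure_itv/= lte_fin; case: ltP => h; first by rewrite sube0.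
  by congr EFin; apply/eqP; rewrite eq_le h andbT -lee_fin.
rewrite (_ : [set _ | _] = `]0, +oo[%classic); last first.
  by apply/seteqP; split => s /=; rewrite in_itv/= andbT ltry; [case|].
by rewrite lebesgue_measure_itv/= ltry.
Qed.

Lemma measure_itv_le (y : \bar R) : (0 <= y)%E ->
  mu [set s | 0 < s /\ (s%:E <= y)%E] = y.
Proof.
case: y => [r| |]// r0.
  rewrite (_ : [set _ | _] = `]0, r]%classic); last first.
    by apply/seteqP; split => s /=; rewrite in_itv/= lee_fin; [move=> [-> ->]|move=> /andP].
  rewrite lebesgue_measure_itv/= lte_fin; case: ltP => h; first by rewrite sube0.
  by congr EFin; apply/eqP; rewrite eq_le h andbT -lee_fin.
rewrite (_ : [set _ | _] = `]0, +oo[%classic); last first.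
  by apply/seteqP; split => s /=; rewrite in_itv/= andbT leey; [case|].
by rewrite lebesgue_measure_itv/= ltry.
Qed.

Lemma measurable_cake_lt F : measurable_fun setT F ->
  measurable [set p : measurableTypeR R * measurableTypeR R | 0 < p.2 /\ (p.2%:E < F p.1)%E].
Proof.
move=> mF.
rewrite (_ : [set _ | _] = (setT `&`
      [set p : measurableTypeR R * measurableTypeR R | (cst 0%E p < p.2%:E)%E])
    `&` (setT `&` [set p : measurableTypeR R * measurableTypeR R | (p.2%:E < F p.1)%E])).
  have m2 : measurable_fun setT (fun p : measurableTypeR R * measurableTypeR R => p.2%:E).
    by apply/measurable_EFinP; exact: measurable_snd.
  apply: measurableI; apply: measurable_lte => //.
  by apply: measurableT_comp => //; exact: measurable_fst.
by apply/seteqP; split => p /=; rewrite lte_fin => -[? ?]//; tauto.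
Qed.

Lemma measurable_cake_le F : measurable_fun setT F ->
  measurable [set p : measurableTypeR R * measurableTypeR R | 0 < p.2 /\ (p.2%:E <= F p.1)%E].
Proof.
move=> mF.
rewrite (_ : [set _ | _] = (setT `&`
      [set p : measurableTypeR R * measurableTypeR R | (cst 0%E p < p.2%:E)%E])
    `&` (setT `&` [set p : measurableTypeR R * measurableTypeR R | (p.2%:E <= F p.1)%E])).
  have m2 : measurable_fun setT (fun p : measurableTypeR R * measurableTypeR R => p.2%:E).
    by apply/measurable_EFinP; exact: measurable_snd.
  apply: measurableI; first exact: measurable_lte.
  apply: measurable_lee => //.
  by apply: measurableT_comp => //; exact: measurable_fst.
by apply/seteqP; split => p /=; rewrite lte_fin => -[? ?]//; tauto.
Qed.

Lemma integral_section (E : set (measurableTypeR R * measurableTypeR R)) : measurable E ->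
  (\int[mu]_x mu (xsection E x) = \int[mu]_s mu (ysection E s))%E.
Proof.
move=> mE; have := indic_fubini_tonelli mu mu mE.
by rewrite indic_fubini_tonelli_FE// indic_fubini_tonelli_GE.
Qed.

(** Strict level sets are for F and G, non-strict ones for H: strict lower bounds of F and G only
    yield a non-strict one for H. *)
Lemma layer_cake_lt F : measurable_fun setT F -> (forall x, 0 <= F x)%E ->
  (\int[mu]_x F x = \int[mu]_s mu [set x | (0 < s)%R /\ (s%:E < F x)])%E.
Proof.
move=> mF F0; have := integral_section (measurable_cake_lt mF).
rewrite (_ : (fun x => mu (xsection _ x)) = F); last first.
  apply/funext => x; rewrite -[RHS](measure_itv_lt (F0 x)); congr (mu _).
  by apply/seteqP; split => s /=; rewrite /xsection/= inE.
move=> ->; apply: eq_integral => s _; congr (mu _).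
by apply/seteqP; split => x /=; rewrite /ysection/= inE.
Qed.

Lemma layer_cake_le F : measurable_fun setT F -> (forall x, 0 <= F x)%E ->
  (\int[mu]_x F x = \int[mu]_s mu [set x | (0 < s)%R /\ (s%:E <= F x)])%E.
Proof.
move=> mF F0; have := integral_section (measurable_cake_le mF).
rewrite (_ : (fun x => mu (xsection _ x)) = F); last first.
  apply/funext => x; rewrite -[RHS](measure_itv_le (F0 x)); congr (mu _).
  by apply/seteqP; split => s /=; rewrite /xsection/= inE.
move=> ->; apply: eq_integral => s _; congr (mu _).
by apply/seteqP; split => x /=; rewrite /ysection/= inE.
Qed.

Lemma measurable_layer_lt F : measurable_fun setT F ->
  measurable_fun setT (fun s : measurableTypeR R => mu [set x | 0 < s /\ (s%:E < F x)%E]).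
Proof.
move=> mF; have := measurable_fun_ysection mu (measurable_cake_lt mF).
congr measurable_fun; apply/funext => s /=; congr (mu _).
by apply/seteqP; split => x /=; rewrite /ysection/= inE.
Qed.

Lemma measurable_layer_le F : measurable_fun setT F ->
  measurable_fun setT (fun s : measurableTypeR R => mu [set x | 0 < s /\ (s%:E <= F x)%E]).
Proof.
move=> mF; have := measurable_fun_ysection mu (measurable_cake_le mF).
congr measurable_fun; apply/funext => s /=; congr (mu _).
by apply/seteqP; split => x /=; rewrite /ysection/= inE.
Qed.

(** Since both suprema are 1, the sets {F > s} and {G > s} are nonempty for the same levels s, and
    [brunn_minkowski1] applies at each of them. Without the normalization one set could be empty and
    the other not. *)
Lemma prekopa_leindler1_normalized F G H a : 0 < a < 1 ->
  measurable_fun setT F -> measurable_fun setT G -> measurable_fun setT H ->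
  (forall x, 0 <= F x)%E -> (forall x, 0 <= G x)%E -> (forall x, 0 <= H x)%E ->
  (forall x, F x <= 1)%E -> (forall x, G x <= 1)%E ->
  (forall s, s < 1 -> exists x, (s%:E < F x)%E) ->
  (forall s, s < 1 -> exists x, (s%:E < G x)%E) ->
  (forall s x y, 0 < s -> (s%:E < F x)%E -> (s%:E < G y)%E ->
    (s%:E <= H (a * x + (1 - a) * y)%R)%E) ->
  (a%:E * \int[mu]_x F x + (1 - a)%:E * \int[mu]_x G x <= \int[mu]_x H x)%E.
Proof.
move=> a01 mF mG mH F0 G0 H0 F1 G1 sF sG FGH.
have /andP[a0 a1] := a01; have b0 : 0 < 1 - a by rewrite subr_gt0.
rewrite (layer_cake_lt mF F0) (layer_cake_lt mG G0) (layer_cake_le mH H0).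
rewrite -!ge0_integralZl//; first last.
- by rewrite lee_fin ltW.
- exact: measurable_layer_lt.
- by rewrite lee_fin ltW.
- exact: measurable_layer_lt.
rewrite -ge0_integralD//; first last.
- by apply: measurable_funeM; exact: measurable_layer_lt.
- by move=> s _; rewrite mule_ge0// lee_fin ltW.
- by apply: measurable_funeM; exact: measurable_layer_lt.
- by move=> s _; rewrite mule_ge0// lee_fin ltW.
apply: ge0_le_integral => //.
- by move=> s _; rewrite adde_ge0// mule_ge0// lee_fin ltW.
- by apply: emeasurable_funD; apply: measurable_funeM; exact: measurable_layer_lt.
- exact: measurable_layer_le.
have sec (K : measurableTypeR R -> \bar R) s : measurable_fun setT K ->
    measurable [set x | 0 < s /\ (s%:E < K x)%E].
  move=> mK; have := measurable_ysection s (measurable_cake_lt mK).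
  by congr measurable; apply/seteqP; split => x /=; rewrite /ysection/= inE.
have sec' (K : measurableTypeR R -> \bar R) s : measurable_fun setT K ->
    measurable [set x | 0 < s /\ (s%:E <= K x)%E].
  move=> mK; have := measurable_ysection s (measurable_cake_le mK).
  by congr measurable; apply/seteqP; split => x /=; rewrite /ysection/= inE.
move=> s _.
have [s0|/negP] := pselect (0 < s); last first.
  rewrite -leNgt => s0.
  have e0 (E : set (measurableTypeR R)) : E `<=` [set x | 0 < s] -> mu E = 0%E.
    by move=> Es; rewrite (_ : E = set0) ?measure0//;
      apply/seteqP; split => x // /Es /=; rewrite ltNge s0.
  by rewrite [X in (_ * X + _)%E]e0 ?[X in (_ + _ * X)%E]e0 ?mule0 ?adde0//; move=> x [].
have [s1|s1] := ltP s 1; last first.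
  rewrite [X in mu X](_ : _ = set0); last first.
    apply/seteqP; split => x //= -[_]; rewrite ltNge; apply/negP/negPn.
    by rewrite (le_trans (F1 x))// lee_fin.
  rewrite [X in (_ + _ * mu X)%E](_ : _ = set0); last first.
    apply/seteqP; split => x //= -[_]; rewrite ltNge; apply/negP/negPn.
    by rewrite (le_trans (G1 x))// lee_fin.
  by rewrite measure0 !mule0 adde0.
apply: brunn_minkowski1 => //; [exact: sec|exact: sec|exact: sec'| | |].
- by have [x Fx] := sF _ s1; exists x.
- by have [x Gx] := sG _ s1; exists x.
- by move=> x y [_ Fx] [_ Gy]; split=> //; exact: FGH.
Qed.

End prekopa_leindler1.

(** * Prekopa-Leindler in every dimension *)

Section prekopa_leindler.
Context {R : realType}.
Local Notation mu := (@lebesgue_measure R).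
Implicit Types (F G H : measurableTypeR R -> \bar R) (a s : R).

Lemma lt_integral_truncation d (T : measurableType d) (m : {measure set T -> \bar R})
    (F : T -> \bar R) (u : R) :
  measurable_fun setT F -> (forall x, 0 <= F x)%E -> (u%:E < \int[m]_x F x)%E ->
  exists n : nat, (u%:E < \int[m]_x mine (F x) n%:R%:E)%E.
Proof.
move=> mF F0 uF.
have mFn n : measurable_fun setT (fun x => mine (F x) n%:R%:E).
  exact: measurable_mine.
have Fn0 n x : (0 <= mine (F x) n%:R%:E)%E by rewrite le_min F0 lee_fin /=.
have ndF x : nondecreasing_seq (fun n => mine (F x) n%:R%:E).
  move=> n k nk; rewrite le_min ge_min lexx/= ge_min lee_fin ler_nat nk.
  by rewrite orbT.
have := @cvg_monotone_convergence _ T R m setT measurableT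
  (fun n x => mine (F x) n%:R%:E) mFn (fun n x _ => Fn0 n x) (fun x _ => ndF x).
rewrite (_ : (fun x => limn _) = F); last first.
  apply/funext => x; apply/cvg_lim => //.
  case: (F x) (F0 x) => [r| |]// r0.
    apply: cvg_near_cst; exists (Num.truncn r).+1 => // n /= rn.
    apply/min_idPl; rewrite lee_fin ltW// (lt_le_trans (truncnS_gt _))//.
    by rewrite ler_nat.
  rewrite (_ : (fun n => _) = (fun n => n%:R%:E)); last first.
    by apply/funext => n; apply/min_idPr; rewrite leey.
  exact/cvgenyP.
move=> cv; apply: contrapT => nex.
suff : (\int[m]_x F x <= u%:E)%E by rewrite leNgt uF.
apply: (cvge_to_le cv); near=> n; rewrite leNgt; apply/negP => h.
by apply: nex; exists n.
Unshelve. all: by end_near.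
Qed.

(** Truncation makes the supremum b finite and division by b makes it 1; the strict bound on the
    integral leaves room for what truncation loses. *)
Lemma normalized_truncation F (u : R) :
  measurable_fun setT F -> (forall x, 0 <= F x)%E -> 0 < u ->
  (u%:E < \int[mu]_x F x)%E ->
  exists (b : R) (F' : measurableTypeR R -> \bar R),
    [/\ 0 < b, measurable_fun setT F' /\ (forall x, 0 <= F' x <= 1)%E,
      forall s, s < 1 -> exists x, (s%:E < F' x)%E,
      forall s x, (s%:E < F' x)%E -> ((b * s)%:E < F x)%E &
      ((u / b)%:E < \int[mu]_x F' x)%E].
Proof.
move=> mF F0 u0 /(lt_integral_truncation mF F0)[n un].
pose g x := mine (F x) n%:R%:E.
have mg : measurable_fun setT g by exact: measurable_mine.
have g0 x : (0 <= g x)%E by rewrite le_min F0 lee_fin /=.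
have gfin x : g x = (fine (g x))%:E.
  rewrite fineK// ge0_fin_numE//.
  by apply: (@le_lt_trans _ _ n%:R%:E); rewrite ?ltry// ge_min lexx orbT.
pose V := range (fine \o g).
have V0 : V !=set0 by exists (fine (g 0)); exists 0.
have Vub : has_ubound V.
  exists n%:R => _ [x _ <-] /=.
  by rewrite -lee_fin -gfin ge_min lexx orbT.
pose b := sup V.
have gb x : fine (g x) <= b by apply: ub_le_sup => //; exists x.
have b0 : 0 < b.
  rewrite ltNge; apply/negP => b0.
  suff : (\int[mu]_x g x <= 0)%E.
    by apply/negP; rewrite -ltNge (lt_trans _ un)// lte_fin.
  rewrite (eq_integral (cst 0%E)) ?integral0// => x _.
  apply/eqP; rewrite eq_le g0 andbT gfin lee_fin.
  exact: le_trans (gb x) b0.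
exists b, (fun x => (b^-1)%:E * g x)%E; split => //.
- split; first exact: measurable_funeM.
  move=> x; rewrite mule_ge0//; last by rewrite lee_fin invr_ge0 ltW.
  by rewrite /= gfin -EFinM lee_fin mulrC ler_pdivrMr// mul1r.
- move=> s s1; have d0 : 0 < b * (1 - s) by rewrite mulr_gt0// subr_gt0.
  have [_ [x _ <-] /= h] := sup_adherent d0 (conj V0 Vub).
  exists x; rewrite gfin -EFinM lte_fin mulrC ltr_pdivlMr//.
  by apply: le_lt_trans h; rewrite -/b; lra.
- move=> s x; rewrite gfin -EFinM lte_fin mulrC ltr_pdivlMr// mulrC.
  by rewrite -lte_fin -gfin lt_min => /andP[].
- rewrite ge0_integralZl//; last by rewrite lee_fin invr_ge0 ltW.
  by rewrite mulrC EFinM lte_pmul2l// ?lte_fin ?invr_gt0.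
Qed.

(** The normalized inequality bounds an arithmetic mean, which dominates the geometric one by
    [wgm_am]; the two suprema return through the factor K = b^a c^(1-a). *)
Lemma prekopa_leindler1 F G H a : 0 < a < 1 ->
  measurable_fun setT F -> measurable_fun setT G -> measurable_fun setT H ->
  (forall x, 0 <= F x)%E -> (forall x, 0 <= G x)%E -> (forall x, 0 <= H x)%E ->
  (forall x y, wgm_le a (F x) (G y) (H (a * x + (1 - a) * y))) ->
  wgm_le a (\int[mu]_x F x)%E (\int[mu]_x G x)%E (\int[mu]_x H x)%E.
Proof.
move=> a01 mF mG mH F0 G0 H0 FGH u v u0 v0 uF vG.
have [b [F' [b0 [mF' F'01] sF' F'F uF']]] := normalized_truncation mF F0 u0 uF.
have [c [G' [c0 [mG' G'01] sG' G'G vG']]] := normalized_truncation mG G0 v0 vG.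
have /andP[a0 a1] := a01; have a1' : 0 < 1 - a by rewrite subr_gt0.
pose K := b `^ a * c `^ (1 - a).
have K0 : 0 < K by rewrite mulr_gt0// powR_gt0.
have scale s t : 0 < s -> 0 < t -> (b * s) `^ a * (c * t) `^ (1 - a) = K * (s `^ a * t `^ (1 - a)).
  by move=> s0 t0; rewrite !powRM ?ltW// /K; ring.
have := @prekopa_leindler1_normalized R F' G' (fun x => (K^-1)%:E * H x)%E a a01 mF' mG'.
have mH' : measurable_fun setT (fun x => (K^-1)%:E * H x)%E by exact: measurable_funeM.
have Ki0 : (0 <= (K^-1)%:E)%E by rewrite lee_fin invr_ge0 ltW.
have am : ((u / b) `^ a * (v / c) `^ (1 - a) <= a * (u / b) + (1 - a) * (v / c)).
  by apply: wgm_am => //; rewrite divr_gt0.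
move=> /(_ mH' (fun x => proj1 (andP (F'01 x))) (fun x => proj1 (andP (G'01 x)))
  (fun x => mule_ge0 Ki0 (H0 x)) (fun x => proj2 (andP (F'01 x)))
  (fun x => proj2 (andP (G'01 x))) sF' sG') h.
have {h} : (a%:E * \int[mu]_x F' x + (1 - a)%:E * \int[mu]_x G' x <=
    \int[mu]_x ((K^-1)%:E * H x))%E.
  apply: h => s x y s0 /F'F sx /G'G sy.
  have := FGH _ _ _ _ (mulr_gt0 b0 s0) (mulr_gt0 c0 s0) sx sy.
  have -> : (b * s) `^ a * (c * s) `^ (1 - a) = K * s.
    rewrite scale// -powRD; last by apply/implyP; rewrite (gt_eqF s0).
    by rewrite addrC subrK powRr1// (ltW s0).
  by rewrite muleC lee_pdivlMr// -EFinM mulrC.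
rewrite ge0_integralZl// => h.
have -> : u `^ a * v `^ (1 - a) = K * ((u / b) `^ a * (v / c) `^ (1 - a)).
  rewrite -scale ?divr_gt0//; congr (_ `^ _ * _ `^ _); rewrite mulrCA divff ?mulr1 ?gt_eqF//.
rewrite mulrC EFinM -lee_pdivlMr// muleC; apply: le_trans h.
apply: (@le_trans _ _ ((a * (u / b) + (1 - a) * (v / c))%:E)); first by rewrite lee_fin.
rewrite EFinD !EFinM; apply: leeD; apply: lee_wpmul2l; rewrite ?lee_fin ?ltW//.
Qed.

Lemma integral_lebesgueRnS n (f : Rn R n.+1 -> \bar R) :
  measurable_fun setT f -> (forall x, 0 <= f x)%E ->
  (\int[lebesgueRn n.+1]_x f x =
   \int[mu]_r \int[lebesgueRn n]_x f (consRn (r, x)))%E.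
Proof.
move=> mf f0.
have mc : measurable_fun setT (f \o @consRn R n).
  exact: measurableT_comp mf (@measurable_consRn R n).
have := @ge0_integral_pushforward _ _ _ _ R (@consRn R n) (@measurable_consRn R n)
  (mu \x lebesgueRn n)%E setT f measurableT mf (fun y _ => f0 y).
rewrite preimage_setT => ->.
by rewrite fubini_tonelli1// => x; exact: f0.
Qed.

Lemma measurable_integral_lebesgueRn n (f : Rn R n.+1 -> \bar R) :
  measurable_fun setT f -> (forall x, 0 <= f x)%E ->
  measurable_fun setT (fun r => \int[lebesgueRn n]_x f (consRn (r, x)))%E.
Proof.
move=> mf f0.
have mc : measurable_fun setT (f \o @consRn R n).
  exact: measurableT_comp mf (@measurable_consRn R n).
exact: (@measurable_fun_fubini_tonelli_F _ _ _ _ R (lebesgueRn n) (f \o @consRn R n) mc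
  (fun x => f0 _)).
Qed.

Definition combRn n (a : R) (x y : Rn R n) : Rn R n :=
  [tuple a * tnth x i + (1 - a) * tnth y i | i < n].

Lemma combRn_cons n a (r s : R) (x y : Rn R n) :
  combRn a (consRn (r, x)) (consRn (s, y)) =
  consRn (a * r + (1 - a) * s, combRn a x y).
Proof.
apply: eq_from_tnth => i; rewrite tnth_mktuple.
case: (unliftP ord0 i) => [j ->|->]; last by rewrite !tnth0.
by rewrite /= !tnthS tnth_mktuple.
Qed.

(** Induction on the dimension: for fixed first coordinates the sections satisfy the hypothesis,
    hence their integrals satisfy the one-dimensional hypothesis. This works because [wgm_le]
    phrases hypothesis and conclusion alike. *)
Lemma prekopa_leindler n (f g h : Rn R n -> \bar R) a : 0 < a < 1 ->
  measurable_fun setT f -> measurable_fun setT g -> measurable_fun setT h ->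
  (forall x, 0 <= f x)%E -> (forall x, 0 <= g x)%E -> (forall x, 0 <= h x)%E ->
  (forall x y, wgm_le a (f x) (g y) (h (combRn a x y))) ->
  wgm_le a (\int[lebesgueRn n]_x f x)%E (\int[lebesgueRn n]_x g x)%E
    (\int[lebesgueRn n]_x h x)%E.
Proof.
move=> a01; elim: n f g h => [|n IHn] f g h mf mg mh f0 g0 h0 fgh.
  rewrite !integral_dirac// !diracT !mul1e.
  by have := fgh [tuple] [tuple]; rewrite [combRn _ _ _]tuple0.
rewrite !integral_lebesgueRnS//.
have mc r (k : Rn R n.+1 -> \bar R) : measurable_fun setT k ->
    measurable_fun setT (fun x => k (consRn (r, x))).
  move=> mk; apply: (measurableT_comp mk).
  by apply: (measurableT_comp (@measurable_consRn R n)); exact: measurable_pair1.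
apply: prekopa_leindler1 => //; try exact: measurable_integral_lebesgueRn;
  try by move=> r; apply: integral_ge0.
move=> r s; apply: IHn => //; try exact: mc.
by move=> x y; rewrite -combRn_cons; exact: fgh.
Qed.

End prekopa_leindler.

(** * Log-concave measures *)

Section log_concave_measure.
Context {R : realType} {n : nat}.
Implicit Types (Q : probability (Rn R n) R) (A B D : set (Rn R n)).

Definition pr Q A : R := fine (Q A).

Lemma prE Q A : measurable A -> (pr Q A)%:E = Q A.
Proof. by move=> mA; rewrite fineK// fin_num_measure. Qed.

Lemma pr_ge0 Q A : 0 <= pr Q A.
Proof. by rewrite fine_ge0. Qed.

Lemma pr_le1 Q A : measurable A -> pr Q A <= 1.
Proof. by move=> mA; rewrite -lee_fin prE// probability_le1. Qed.

Lemma prT Q : pr Q setT = 1.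
Proof. by rewrite /pr probability_setT. Qed.

Lemma le_pr Q A B : measurable A -> measurable B -> A `<=` B -> pr Q A <= pr Q B.
Proof. by move=> mA mB AB; rewrite -lee_fin !prE// le_measure ?inE. Qed.

(** Obtained by integrating the pointwise inequality. Union bounds, double counting and the exchange
    of Q with the average over a finite random matrix are all instances. *)
Lemma pr_sum_le Q (I J : finType) (c : I -> R) (d : J -> R)
    (A : I -> set (Rn R n)) (B : J -> set (Rn R n)) :
  (forall i, 0 <= c i) -> (forall j, 0 <= d j) ->
  (forall i, measurable (A i)) -> (forall j, measurable (B j)) ->
  (forall x, \sum_i c i * \1_(A i) x <= \sum_j d j * \1_(B j) x) ->
  \sum_i c i * pr Q (A i) <= \sum_j d j * pr Q (B j).
Proof.
move=> c0 d0 mA mB AB.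
have key (K : finType) (e : K -> R) (E : K -> set (Rn R n)) :
    (forall k, 0 <= e k) -> (forall k, measurable (E k)) ->
    (\int[Q]_x (\sum_k e k * \1_(E k) x)%:E = (\sum_k e k * pr Q (E k))%:E)%E.
  move=> e0 mE.
  under eq_integral do rewrite -sumEFin.
  rewrite ge0_integral_sum//.
  - rewrite -sumEFin; apply: eq_bigr => k _.
    under eq_integral do rewrite EFinM.
    rewrite ge0_integralZl//; first by rewrite integral_indic// setIT EFinM prE.
    + by apply/measurable_EFinP; exact: measurable_indic.
    + by rewrite lee_fin.
  - move=> k; apply/measurable_EFinP; apply: measurable_funM => //.
  - by move=> k x _; rewrite lee_fin mulr_ge0.
rewrite -lee_fin -!key//; apply: ge0_le_integral => //.
- by move=> x _; rewrite lee_fin sumr_ge0// => i _; rewrite mulr_ge0.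
- apply/measurable_EFinP; apply: measurable_sum => i; apply: measurable_funM => //.
- apply/measurable_EFinP; apply: measurable_sum => i; apply: measurable_funM => //.
- by move=> x _; rewrite lee_fin.
Qed.

Definition lc_measure Q := forall (a : R) A B D, 0 < a < 1 ->
  measurable A -> measurable B -> measurable D ->
  (forall x y, A x -> B y -> D (combRn a x y)) ->
  pr Q A `^ a * pr Q B `^ (1 - a) <= pr Q D.

(** Prekopa-Leindler for the functions f 1_A, f 1_B and f 1_D. *)
Lemma density_lc_measure Q (f : Rn R n -> R) :
  measurable_fun setT f -> log_concave f ->
  (forall A, measurable A -> Q A = \int[lebesgueRn n]_(x in A) (f x)%:E)%E ->
  lc_measure Q.
Proof.
move=> mf [f0 lcf] Qf a A B D a01 mA mB mD ABD.
have /andP[a0 a1] := a01; have b0 : 0 < 1 - a by rewrite subr_gt0.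
pose g (E : set (Rn R n)) x := (f x * \1_E x)%:E.
have mg E : measurable E -> measurable_fun setT (g E).
  by move=> mE; apply/measurable_EFinP; apply: measurable_funM.
have g0 E x : (0 <= g E x)%E by rewrite lee_fin mulr_ge0.
have QE E : measurable E -> Q E = (\int[lebesgueRn n]_x g E x)%E.
  move=> mE; rewrite Qf// integral_mkcond; apply: eq_integral => x _.
  by rewrite /g patchE indicE; case: ifPn => _; rewrite ?mulr1 ?mulr0.
have gE E x (u : R) : 0 < u -> (u%:E < g E x)%E -> E x /\ u < f x.
  move=> u0; rewrite /g lte_fin indicE; case: (boolP (x \in E)) => [|_].
    by rewrite inE mulr1.
  by rewrite mulr0 => /(lt_trans u0); rewrite ltxx.
have := @prekopa_leindler R n (g A) (g B) (g D) a a01 (mg _ mA) (mg _ mB) (mg _ mD)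
  (g0 A) (g0 B) (g0 D).
rewrite -!QE// -!prE// => /(_ _)/wrap[].
  move=> x y u v u0 v0 /(gE _ _ _ u0)[Ax ux] /(gE _ _ _ v0)[By vy].
  rewrite lee_fin indicE mem_set ?mulr1; last exact: ABD.
  apply: (le_trans _ (lcf x y a _)); last by rewrite !ltW.
  by apply: ler_pM; rewrite ?powR_ge0//; apply: ge0_ler_powR; rewrite ?nnegrE ?f0 ?ltW.
move=> h; have [A0|A0] := eqVneq (pr Q A) 0.
  by rewrite A0 powR0 ?gt_eqF// mul0r pr_ge0.
have [B0|B0] := eqVneq (pr Q B) 0.
  by rewrite B0 powR0 ?gt_eqF// mulr0 pr_ge0.
have Ap : 0 < pr Q A by rewrite lt_neqAle eq_sym A0 pr_ge0.
have Bp : 0 < pr Q B by rewrite lt_neqAle eq_sym B0 pr_ge0.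
set K := _ * _; have K0 : 0 <= K by rewrite mulr_ge0 ?powR_ge0.
apply/ler_addgt0Pr => e e0.
(* The strict lower bounds (1 - t) Q(A) and (1 - t) Q(B) give K - t K <= Q(D), and this t makes t K
   <= e. *)
pose t := e / (e + K + 1).
have eK : 0 < e + K + 1 by lra.
have t0 : 0 < t by rewrite divr_gt0.
have t1 : t < 1 by rewrite ltr_pdivrMr//; lra.
have s0 : 0 < 1 - t by lra.
have := h ((1 - t) * pr Q A) ((1 - t) * pr Q B).
rewrite !mulr_gt0// !lte_fin !gtr_pMl// => /(_ isT isT).
have -> : 1 - t < 1 by lra.
move=> /(_ isT isT); have s0' := ltW s0.
rewrite lee_fin (powRM _ s0' (ltW Ap)) (powRM _ s0' (ltW Bp)) mulrACA -/K -powRD; last first.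
  by rewrite (gt_eqF s0) implybT.
rewrite [a + _]addrC subrK powRr1// mulrBl mul1r lerBlDr => /le_trans; apply.
rewrite lerD2l /t mulrAC ler_pdivrMr// ler_pM2l//; lra.
Qed.

End log_concave_measure.

(** * Property (tau) for a Gaussian weight on a grid *)

Section discrete_prekopa_leindler.
Context {R : realType} {m : nat}.
Local Notation mu := (@lebesgue_measure R).
Implicit Types (phi psi h : 'I_m -> R).

Definition unit_itv (i : nat) : set (measurableTypeR R) := `[i%:R, i%:R + 1[.

Definition step_fun phi (x : measurableTypeR R) : \bar R :=
  (\sum_i phi i * \1_(unit_itv i) x)%:E.

Lemma unit_itv_inj (i j : nat) x : unit_itv i x -> unit_itv j x -> i = j.
Proof.
rewrite /unit_itv /= !in_itv/= => /andP[i1 i2] /andP[j1 j2].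
have := le_lt_trans i1 j2; have := le_lt_trans j1 i2.
rewrite !natr1 !ltr_nat !ltnS => ? ?.
by apply/eqP; rewrite eqn_leq; apply/andP.
Qed.

Lemma step_funE phi (i : 'I_m) x : unit_itv i x -> step_fun phi x = (phi i)%:E.
Proof.
move=> ix; rewrite /step_fun (bigD1 i)//= indicE mem_set// mulr1 big1 ?addr0// => j ji.
rewrite indicE memNset ?mulr0// => jx; move/eqP: ji; apply.
by apply/val_inj; exact: unit_itv_inj jx ix.
Qed.

Lemma step_fun_gt phi x (u : R) : 0 < u -> (u%:E < step_fun phi x)%E ->
  exists2 i : 'I_m, unit_itv i x & u < phi i.
Proof.
move=> u0 ux; have [[i ix]|nx] := pselect (exists i : 'I_m, unit_itv i x).
  by exists i => //; move: ux; rewrite (step_funE _ ix) lte_fin.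
move: ux; rewrite /step_fun big1 ?lte_fin; first by move/(lt_trans u0); rewrite ltxx.
by move=> i _; rewrite indicE memNset ?mulr0// => ix; apply: nx; exists i.
Qed.

Lemma measurable_step_fun phi : measurable_fun setT (step_fun phi).
Proof.
apply/measurable_EFinP; apply: measurable_sum => i; apply: measurable_funM => //.
by apply: measurable_indic; exact: measurable_itv.
Qed.

Lemma step_fun_ge0 phi x : (forall i, 0 <= phi i) -> (0 <= step_fun phi x)%E.
Proof. by move=> phi0; rewrite lee_fin sumr_ge0// => i _; rewrite mulr_ge0. Qed.

Lemma integral_step_fun phi : (forall i, 0 <= phi i) ->
  (\int[mu]_x step_fun phi x = (\sum_i phi i)%:E)%E.
Proof.
move=> phi0; rewrite /step_fun; under eq_integral do rewrite -sumEFin.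
rewrite ge0_integral_sum//.
- rewrite -sumEFin; apply: eq_bigr => k _.
  under eq_integral do rewrite EFinM.
  rewrite ge0_integralZl//.
  + rewrite integral_indic//; last exact: measurable_itv.
    rewrite setIT [X in (_ * X)%E](_ : _ = 1%E); first by rewrite mule1.
    apply: (etrans (lebesgue_measure_itv `[k%:R, k%:R + 1[)).
    by rewrite /= lte_fin ltrDl ltr01 -EFinB addrAC subrr add0r.
  + by apply/measurable_EFinP; apply: measurable_indic; exact: measurable_itv.
  + by rewrite lee_fin.
- move=> k; apply/measurable_EFinP; apply: measurable_funM => //.
  by apply: measurable_indic; exact: measurable_itv.
- by move=> k x _; rewrite lee_fin mulr_ge0.
Qed.

Lemma unit_itv_mid (i j : nat) (x y : R) : unit_itv i x -> unit_itv j y ->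
  exists2 c : nat, unit_itv c (2^-1 * x + (1 - 2^-1) * y) &
    (c.*2 <= (i + j).+1)%N /\ (i + j <= c.*2.+1)%N.
Proof.
rewrite /unit_itv/= !in_itv/= => /andP[ix1 ix2] /andP[jy1 jy2].
set z := _ + _; have zE : 2 * z = x + y by rewrite /z; lra.
have z0 : 0 <= z by have := ler0n R i; have := ler0n R j; lra.
have /andP[cz zc] := truncn_itv z0.
exists (Num.truncn z); first by rewrite in_itv/= cz natr1.
move: zc; rewrite -natr1 => zc; split; rewrite -ltnS -(ltr_nat R) -muln2 -!natr1 natrM natrD; lra.
Qed.

(** Sums are integrals of step functions on unit cells. The midpoint of points of the cells i and j
    can fall into any cell c with |2 c - (i + j)| <= 1, whence the hypothesis for all of these c. *)
Lemma discrete_prekopa_leindler phi psi h :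
  (forall i, 0 <= phi i) -> (forall i, 0 <= psi i) -> (forall i, 0 <= h i) ->
  (forall i j c : 'I_m, (c.*2 <= (i + j).+1)%N -> (i + j <= c.*2.+1)%N ->
    phi i * psi j <= h c ^+ 2) ->
  (\sum_i phi i) * (\sum_i psi i) <= (\sum_i h i) ^+ 2.
Proof.
move=> phi0 psi0 h0 H.
have half : 0 < (2^-1 : R) < 1 by apply/andP; split; lra.
have halfE : 1 - 2^-1 = 2^-1 :> R by lra.
have sqrtM (u v w : R) : 0 <= u -> 0 <= v -> 0 <= w ->
    (u `^ 2^-1 * v `^ (1 - 2^-1) <= w) = (u * v <= w ^+ 2).
  move=> u0 v0 w0; rewrite halfE -powRM// powR12_sqrt ?mulr_ge0//.
  by rewrite -[in RHS](@ler_sqrt _ (u * v)) ?exprn_ge0// sqrtr_sqr ger0_norm.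
have := @prekopa_leindler1 R (step_fun phi) (step_fun psi) (step_fun h) _ half
  (measurable_step_fun phi) (measurable_step_fun psi) (measurable_step_fun h)
  (fun x => step_fun_ge0 x phi0) (fun x => step_fun_ge0 x psi0)
  (fun x => step_fun_ge0 x h0).
rewrite !integral_step_fun// => /(_ _)/wrap[].
  move=> x y u v u0 v0 /(step_fun_gt u0)[i ix ui] /(step_fun_gt v0)[j jy vj].
  have [c cz [c1 c2]] := unit_itv_mid ix jy.
  have cm : (c < m)%N by have := ltn_ord i; have := ltn_ord j; lia.
  rewrite (@step_funE h (Ordinal cm))//.
  rewrite lee_fin sqrtM ?(ltW u0) ?(ltW v0)//.
  apply: le_trans (H i j (Ordinal cm) c1 c2).
  by apply: ler_pM; rewrite ?ltW.
move=> PL; set S := \sum_i phi i; set T := \sum_i psi i; set K := \sum_i h i.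
have S0 : 0 <= S by apply: sumr_ge0.
have T0 : 0 <= T by apply: sumr_ge0.
have K0 : 0 <= K by apply: sumr_ge0.
have [->|Sn] := eqVneq S 0; first by rewrite mul0r exprn_ge0.
have [->|Tn] := eqVneq T 0; first by rewrite mulr0 exprn_ge0.
have Sp : 0 < S by rewrite lt_neqAle eq_sym Sn.
have Tp : 0 < T by rewrite lt_neqAle eq_sym Tn.
rewrite leNgt; apply/negP => KST.
have ST : 0 < S * T by rewrite mulr_gt0.
pose r := K ^+ 2 / (S * T).
have r0 : 0 <= r by rewrite divr_ge0 ?exprn_ge0// ltW.
have r1 : r < 1 by rewrite ltr_pdivrMr// mul1r.
(* Here t < 1 and t^2 - r = ((1 - r) / 2)^2 > 0, so the strict lower bounds t S and t T already
   refute K^2 < S T. *)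
pose t := (r + 1) / 2.
have t0 : 0 < t by rewrite /t; lra.
have t1 : t < 1 by rewrite /t; lra.
have tS : ((t * S)%:E < S%:E)%E by rewrite lte_fin gtr_pMl.
have tT : ((t * T)%:E < T%:E)%E by rewrite lte_fin gtr_pMl.
have := PL _ _ (mulr_gt0 t0 Sp) (mulr_gt0 t0 Tp) tS tT.
rewrite lee_fin sqrtM//; [|by rewrite mulr_ge0 // ltW|by rewrite mulr_ge0 // ltW].
apply/negP; rewrite -ltNge.
have -> : K ^+ 2 = r * (S * T) by rewrite /r divfK// gt_eqF.
have -> : t * S * (t * T) = t ^+ 2 * (S * T) by ring.
rewrite ltr_pM2r// /t -subr_gt0.
have -> : ((r + 1) / 2) ^+ 2 - r = ((1 - r) / 2) ^+ 2 by field.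
by rewrite exprn_gt0// divr_gt0// subr_gt0.
Qed.
End discrete_prekopa_leindler.

(** * Product weights and tensorization of property (tau) *)

Section finite_product.
Context {R : realType} {T : finType}.
Implicit Types (w : T -> R) (c : T -> T -> R).

Definition fcons n (a : T) (g : {ffun 'I_n -> T}) : {ffun 'I_n.+1 -> T} :=
  [ffun i => if unlift ord0 i is Some j then g j else a].

Lemma fcons0 n a (g : {ffun 'I_n -> T}) : fcons a g ord0 = a.
Proof. by rewrite ffunE unlift_none. Qed.

Lemma fconsS n a (g : {ffun 'I_n -> T}) j : fcons a g (lift ord0 j) = g j.
Proof. by rewrite ffunE liftK. Qed.

Lemma sum_ffunS n (F : {ffun 'I_n.+1 -> T} -> R) :
  \sum_f F f = \sum_a \sum_g F (fcons a g).
Proof.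
rewrite pair_bigA /= (reindex (fun p : T * {ffun 'I_n -> T} => fcons p.1 p.2)) //=.
exists (fun f => (f ord0, [ffun j => f (lift ord0 j)])) => [[a g] _|f _] /=.
  by rewrite fcons0; congr pair; apply/ffunP => j; rewrite ffunE fconsS.
apply/ffunP => i; case: (unliftP ord0 i) => [j ->|->]; last by rewrite fcons0.
by rewrite fconsS ffunE.
Qed.

Definition pweight w n (g : {ffun 'I_n -> T}) : R := \prod_i w (g i).

Lemma pweight_fcons w n a (g : {ffun 'I_n -> T}) :
  pweight w (fcons a g) = w a * pweight w g.
Proof.
rewrite /pweight big_ord_recl fcons0; congr (_ * _).
by apply: eq_bigr => j _; rewrite fconsS.
Qed.

Lemma pweight_ge0 w n (g : {ffun 'I_n -> T}) : (forall a, 0 <= w a) -> 0 <= pweight w g.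
Proof. by move=> w0; apply: prodr_ge0. Qed.

Lemma sum_pweight w n : \sum_a w a = 1 -> \sum_(g : {ffun 'I_n -> T}) pweight w g = 1.
Proof.
move=> w1; rewrite /pweight -(bigA_distr_bigA (fun (_ : 'I_n) a => w a)).
by rewrite big1.
Qed.

Lemma sum_pweight_prod w n (F : 'I_n -> T -> R) :
  \sum_(g : {ffun 'I_n -> T}) pweight w g * \prod_i F i (g i) = \prod_i \sum_a w a * F i a.
Proof.
rewrite (bigA_distr_bigA (fun i a => w a * F i a)); apply: eq_bigr => g _.
by rewrite -big_split.
Qed.

Lemma sum_pweight_marginal w n (F : T -> R) (j : 'I_n) : \sum_a w a = 1 ->
  \sum_(g : {ffun 'I_n -> T}) pweight w g * F (g j) = \sum_a w a * F a.
Proof.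
move=> w1; have := sum_pweight_prod w (fun i a => if i == j then F a else 1).
rewrite (bigD1 j)//= eqxx [X in _ * X]big1 ?mulr1; last first.
  by move=> i /negPf ->; under eq_bigr do rewrite mulr1.
move=> <-; apply: eq_bigr => g _; congr (_ * _).
by rewrite (bigD1 j)//= eqxx big1 ?mulr1// => i /negPf ->.
Qed.

(* Maurey's property (tau) for the cost c, up to the factor K; usually g = exp(-h)
   and f is the exponential of the infimal convolution of h and c. *)
Definition tau_le w c (K : R) := forall f g : T -> R,
  (forall x, 0 <= f x) -> (forall x, 0 <= g x) ->
  (forall x y, f x * g y <= expR (c x y)) ->
  (\sum_x w x * f x) * (\sum_x w x * g x) <= K.

Lemma tau_le_scale w c K s (f g : T -> R) : 0 < s -> tau_le w c K ->
  (forall x, 0 <= f x) -> (forall x, 0 <= g x) ->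
  (forall x y, f x * g y <= s * expR (c x y)) ->
  (\sum_x w x * f x) * (\sum_x w x * g x) <= s * K.
Proof.
move=> s0 tK f0 g0 fg.
have := tK (fun x => s^-1 * f x) g; rewrite mulrC => /(_ _ g0 _)/wrap[].
- by move=> x; rewrite mulr_ge0// invr_ge0 ltW.
- by move=> x y; rewrite -mulrA ler_pdivrMl.
under [X in _ * X]eq_bigr do rewrite mulrCA.
by rewrite -mulr_sumr mulrCA ler_pdivrMl// mulrC.
Qed.

(** Maurey's tensorization. Once the first coordinates are fixed at a and b, their cost exp(c a b)
    is a constant factor for the remaining coordinates; the induction therefore carries a factor s,
    and the partial sums satisfy the one-dimensional hypothesis. *)
Lemma tau_le_pweight w c K n : 0 < K -> (forall a, 0 <= w a) -> tau_le w c K ->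
  forall f g : {ffun 'I_n -> T} -> R,
  (forall x, 0 <= f x) -> (forall x, 0 <= g x) ->
  (forall x y, f x * g y <= expR (\sum_i c (x i) (y i))) ->
  (\sum_x pweight w x * f x) * (\sum_x pweight w x * g x) <= K ^+ n.
Proof.
move=> K0 w0 tK; suff H (f g : {ffun 'I_n -> T} -> R) (s : R) : 0 < s ->
  (forall x, 0 <= f x) -> (forall x, 0 <= g x) ->
  (forall x y, f x * g y <= s * expR (\sum_i c (x i) (y i))) ->
  (\sum_(x : {ffun 'I_n -> T}) pweight w x * f x) *
  (\sum_(x : {ffun 'I_n -> T}) pweight w x * g x) <= s * K ^+ n.
  by move=> f g f0 g0 fg; have := H f g 1 ltr01 f0 g0; rewrite mul1r; apply => x y; rewrite mul1r.
elim: n f g s => [|n IHn] f g s s0 f0 g0 fg.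
  have x0 : {ffun 'I_0 -> T} by apply: finfun => -[].
  have one (F : {ffun 'I_0 -> T} -> R) : \sum_x pweight w x * F x = F x0.
    have all0 (y : {ffun 'I_0 -> T}) : y = x0 by apply/ffunP => -[].
    rewrite (bigD1 x0)//= big1 => [|y]; last by rewrite (all0 y) eqxx.
    by rewrite /pweight big_ord0 mul1r addr0.
  by rewrite !one expr0; apply: le_trans (fg x0 x0) _; rewrite big_ord0 expR0.
have split_sum (F : {ffun 'I_n.+1 -> T} -> R) :
    \sum_x pweight w x * F x = \sum_a w a * \sum_x pweight w x * F (fcons a x).
  rewrite sum_ffunS; apply: eq_bigr => a _; rewrite mulr_sumr.
  by apply: eq_bigr => x _; rewrite pweight_fcons mulrA.
rewrite !split_sum exprSr mulrA.
apply: (tau_le_scale (c := c)) => //; first by rewrite mulr_gt0// exprn_gt0.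
- by move=> a; apply: sumr_ge0 => x _; rewrite mulr_ge0// pweight_ge0.
- by move=> a; apply: sumr_ge0 => x _; rewrite mulr_ge0// pweight_ge0.
move=> a b; rewrite mulrAC; apply: IHn => //; first by rewrite mulr_gt0// expR_gt0.
move=> x y; apply: (le_trans (fg _ _)).
rewrite -mulrA -expRD big_ord_recl !fcons0.
rewrite le_eqVlt; apply/orP; left; apply/eqP; congr (_ * expR (_ + _)).
by apply: eq_bigr => i _; rewrite !fconsS.
Qed.

End finite_product.

(** * The truncated Gaussian weight on a grid *)

Section grid_gaussian.
Context {R : realType} (r : nat).
Hypothesis r0 : (0 < r)%N.
Local Notation I := 'I_(r.*2.+1).

(** The cut-off at 1 keeps the rounding error in [tau_grid] linear in the mesh and makes bounds on
    the moments elementary. *)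
Definition gpt (i : I) : R := (i%:R - r%:R) / r%:R.
Definition gdens (i : I) : R := expR (- (gpt i ^+ 2) / 2).
Definition gmass : R := \sum_i gdens i.
Definition gw (i : I) : R := gdens i / gmass.

Let rp : 0 < r%:R :> R. Proof. by rewrite ltr0n. Qed.

Lemma gpt_le1 i : `|gpt i| <= 1.
Proof.
rewrite /gpt normrM normfV (ger0_norm (ltW rp)) ler_pdivrMr// mul1r ler_norml.
rewrite lerBrDr addrC subrr ler0n/= lerBlDr -natrD ler_nat addnn.
by rewrite -ltnS ltn_ord.
Qed.

Lemma gmass_gt0 : 0 < gmass.
Proof.
rewrite /gmass (bigD1 ord0)//= ltr_wpDr ?expR_gt0//.
by apply: sumr_ge0 => i _; exact: expR_ge0.
Qed.

Lemma gw_ge0 i : 0 <= gw i.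
Proof. by rewrite divr_ge0 ?expR_ge0// ltW// gmass_gt0. Qed.

Lemma gw_sum : \sum_i gw i = 1.
Proof. by rewrite -mulr_suml divff// gt_eqF// gmass_gt0. Qed.

(** For points x, y with midpoint q, x^2 / 2 + y^2 / 2 - (x - y)^2 / 4 = q^2, so without rounding
    the two densities times the cost factor would give the squared density at q. A grid point z with
    |2 z - 2 q| <= 1 / r has z^2 - q^2 = (z - q) (z + q) <= 1 / r, which is the loss in the
    constant. *)
Lemma tau_grid : tau_le gw (fun i j => (gpt i - gpt j) ^+ 2 / 4) (expR r%:R^-1).
Proof.
move=> f g f0 g0 fg.
pose phi i := gdens i * f i; pose psi i := gdens i * g i.
have := @discrete_prekopa_leindler R r.*2.+1 phi psi (fun i => expR (r%:R^-1 / 2) * gdens i).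
have d0 i : 0 <= gdens i by exact: expR_ge0.
move=> /(_ _ _ _ _)/wrap[].
- by move=> i; rewrite mulr_ge0.
- by move=> i; rewrite mulr_ge0.
- by move=> i; rewrite mulr_ge0// expR_ge0.
- move=> i j c c1 c2; rewrite /phi /psi mulrACA.
  apply: (@le_trans _ _ (gdens i * gdens j * expR ((gpt i - gpt j) ^+ 2 / 4))).
    by rewrite ler_wpM2l ?mulr_ge0.
  rewrite /gdens -!expRD [leRHS]expr2 -!expRD ler_expR.
  set x := gpt i; set y := gpt j; set z := gpt c.
  have : `|2 * z - (x + y)| <= r%:R^-1.
    rewrite /z /x /y /gpt -mulrDl mulrA -mulrBl normrM normfV (ger0_norm (ltW rp)).
    rewrite ler_pdivrMr// mulVf ?gt_eqF//.
    have -> : 2 * (c%:R - r%:R) - (i%:R - r%:R + (j%:R - r%:R)) = c.*2%:R - (i + j)%:R :> R.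
      by rewrite -(mul2n c) natrM natrD; ring.
    have h1 : c.*2%:R <= (i + j)%:R + 1 :> R by rewrite natr1 ler_nat.
    have h2 : (i + j)%:R <= c.*2%:R + 1 :> R by rewrite natr1 ler_nat.
    by rewrite ler_norml; apply/andP; split; lra.
  have := gpt_le1 i; have := gpt_le1 j; have := gpt_le1 c.
  rewrite -/x -/y -/z !ler_norml => /andP[z1 z2] /andP[y1 y2] /andP[x1 x2] /andP[m1 m2].
  have k0 : 0 < r%:R^-1 :> R by rewrite invr_gt0.
  move: k0 m1 m2 z1 z2 x1 x2 y1 y2; set k := r%:R^-1; clear; nra.
rewrite -mulr_sumr -/gmass => PL.
rewrite /gw.
have e (h : I -> R) : \sum_x gdens x / gmass * h x = (\sum_x gdens x * h x) / gmass.
  by rewrite mulr_suml; apply: eq_bigr => x _; rewrite mulrAC.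
rewrite !e mulrACA -invfM ler_pdivrMr ?mulr_gt0 ?gmass_gt0//.
apply: le_trans PL _; rewrite exprMn -expRM_natl; rewrite le_eqVlt; apply/orP; left.
by apply/eqP; rewrite expr2; congr (expR _ * _); field; rewrite gt_eqF.
Qed.

End grid_gaussian.

(** * Moments and a one-sided small-ball estimate *)

Section grid_moments.
Context {R : realType} (r : nat).
Hypothesis r0 : (0 < r)%N.
Local Notation I := 'I_(r.*2.+1).
Local Notation gpt := (@gpt R r).
Local Notation gw := (@gw R r).
Local Notation gdens := (@gdens R r).

Let rp : 0 < r%:R :> R. Proof. by rewrite ltr0n. Qed.

Lemma gpt_rev i : gpt (rev_ord i) = - gpt i.
Proof.
rewrite /gpt -mulNr opprB /=; congr (_ / _).
rewrite subSS natrB; last by rewrite -ltnS ltn_ord.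
have e : r.*2%:R = r%:R + r%:R :> R by rewrite -natrD addnn.
by rewrite e; ring.
Qed.

Lemma gw_rev i : gw (rev_ord i) = gw i.
Proof. by rewrite /gw /gdens gpt_rev sqrrN. Qed.

Lemma gw_wsum c : \sum_i gw i * c = c.
Proof. by rewrite -[RHS]mul1r -(gw_sum r) mulr_suml. Qed.

Lemma gmean : \sum_i gw i * gpt i = 0.
Proof.
have : \sum_i gw i * gpt i = - \sum_i gw i * gpt i.
  rewrite {1}(reindex_inj rev_ord_inj)/= -sumrN.
  by apply: eq_bigr => i _; rewrite gw_rev gpt_rev mulrN.
by move=> ?; lra.
Qed.

Lemma sum_sqr_ord m (c : R) : \sum_(i < m) (i%:R - c) ^+ 2 =
  m%:R * (m%:R - 1) * (2 * m%:R - 1) / 6 - c * m%:R * (m%:R - 1) + m%:R * c ^+ 2.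
Proof.
elim: m => [|m IHm]; first by rewrite big_ord0; ring.
by rewrite big_ord_recr/= IHm -natr1; field.
Qed.

Definition gvar : R := \sum_i gw i * gpt i ^+ 2.

Lemma gvar_le1 : gvar <= 1.
Proof.
rewrite -(gw_sum r); apply: ler_sum => i _.
by rewrite ler_piMr ?gw_ge0// -real_normK ?num_real// exprn_ile1// gpt_le1.
Qed.

(** The density lies between 1/2 and 1, so the variance is at least half that of the uniform weight,
    which is at least 1/3. *)
Lemma gvar_ge : 6^-1 <= gvar.
Proof.
have d1 i : 2^-1 <= gdens i <= 1.
  have x1 := @gpt_le1 R r r0 i.
  have x2 : gpt i ^+ 2 <= 1 by rewrite -real_normK ?num_real// exprn_ile1.
  apply/andP; split.
    apply: le_trans (expR_ge1Dx _); lra.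
  rewrite -expR0 ler_expR; have := sqr_ge0 (gpt i); lra.
have M0 : 0 < @gmass R r by exact: gmass_gt0.
have M1 : @gmass R r <= r.*2.+1%:R.
  rewrite -[leRHS](_ : \sum_(i : I) 1 = _); last by rewrite sumr_const card_ord.
  by apply: ler_sum => i _; have /andP[] := d1 i.
have s : \sum_(i : I) gpt i ^+ 2 = (r.*2.+1%:R * (r%:R + 1)) / (3 * r%:R).
  rewrite /gpt; under eq_bigr do rewrite expr_div_n.
  by rewrite -mulr_suml sum_sqr_ord -natr1 -mul2n natrM; field; rewrite gt_eqF.
have : 2^-1 * (\sum_(i : I) gpt i ^+ 2) <= gvar * @gmass R r.
  rewrite /gvar mulr_suml mulr_sumr; apply: ler_sum => i _.
  rewrite /gw mulrAC divfK ?gt_eqF//.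
  by rewrite ler_wpM2r ?sqr_ge0//; have /andP[] := d1 i.
have v0 : 0 <= gvar by apply: sumr_ge0 => i _; rewrite mulr_ge0 ?gw_ge0// sqr_ge0.
move=> h; have := le_trans h (ler_wpM2l v0 M1).
rewrite s; set M := r.*2.+1%:R; have Mp : 0 < M by rewrite /M ltr0n.
have -> : 2^-1 * (M * (r%:R + 1) / (3 * r%:R)) = (6^-1 + 6^-1 * r%:R^-1) * M.
  by field; rewrite gt_eqF.
rewrite ler_pM2r//; apply: le_trans; rewrite lerDl mulr_ge0// invr_ge0// ltW//.
Qed.

Definition rowS n (g : {ffun 'I_n -> I}) (u : 'I_n -> R) : R := \sum_i gpt (g i) * u i.

Definition Egrid n (F : {ffun 'I_n -> I} -> R) : R := \sum_g pweight gw g * F g.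

Lemma EgridS n (F : {ffun 'I_n.+1 -> I} -> R) :
  Egrid F = \sum_a gw a * Egrid (fun g => F (fcons a g)).
Proof.
rewrite /Egrid sum_ffunS; apply: eq_bigr => a _; rewrite mulr_sumr.
by apply: eq_bigr => x _; rewrite pweight_fcons mulrA.
Qed.

Lemma EgridD n (F G : {ffun 'I_n -> I} -> R) :
  Egrid (fun g => F g + G g) = Egrid F + Egrid G.
Proof. by rewrite /Egrid -big_split; apply: eq_bigr => g _; rewrite mulrDr. Qed.

Lemma EgridZ n c (F : {ffun 'I_n -> I} -> R) : Egrid (fun g => c * F g) = c * Egrid F.
Proof. by rewrite /Egrid mulr_sumr; apply: eq_bigr => g _; rewrite mulrCA. Qed.

Lemma Egrid_cst n c : Egrid (fun _ : {ffun 'I_n -> I} => c) = c.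
Proof. by rewrite /Egrid -mulr_suml sum_pweight ?mul1r// gw_sum. Qed.

Lemma le_Egrid n (F G : {ffun 'I_n -> I} -> R) : (forall g, F g <= G g) ->
  Egrid F <= Egrid G.
Proof.
move=> FG; apply: ler_sum => g _; rewrite ler_wpM2l//.
by apply: pweight_ge0 => i; exact: gw_ge0.
Qed.

Lemma Egrid0 (F : {ffun 'I_0 -> I} -> R) : exists g, Egrid F = F g.
Proof.
have x0 : {ffun 'I_0 -> I} by apply: finfun => -[].
exists x0; have all0 (y : {ffun 'I_0 -> I}) : y = x0 by apply/ffunP => -[].
rewrite /Egrid (bigD1 x0)//= big1 => [|y]; last by rewrite (all0 y) eqxx.
by rewrite /pweight big_ord0 mul1r addr0.
Qed.

Lemma rowS_fcons n a (g : {ffun 'I_n -> I}) u :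
  rowS (fcons a g) u = gpt a * u ord0 + rowS g (u \o lift ord0).
Proof.
rewrite /rowS big_ord_recl fcons0; congr (_ + _).
by apply: eq_bigr => i _; rewrite fconsS.
Qed.

Lemma rowS_mean n u : Egrid (fun g : {ffun 'I_n -> I} => rowS g u) = 0.
Proof.
elim: n u => [|n IHn] u; first by have [g ->] := Egrid0 (fun g => rowS g u); rewrite /rowS big_ord0.
rewrite EgridS; under eq_bigr => a _.
  rewrite (_ : Egrid _ = gpt a * u ord0); last first.
    transitivity (Egrid (fun g : {ffun 'I_n -> I} => gpt a * u ord0 + rowS g (u \o lift ord0))).
      by congr Egrid; apply/funext => g; rewrite rowS_fcons.
    by rewrite EgridD Egrid_cst IHn addr0.
  rewrite mulrA; over.
by rewrite -mulr_suml gmean mul0r.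
Qed.

Lemma rowS_var n u : Egrid (fun g : {ffun 'I_n -> I} => rowS g u ^+ 2) = gvar * \sum_i u i ^+ 2.
Proof.
elim: n u => [|n IHn] u.
  by have [g ->] := Egrid0 (fun g => rowS g u ^+ 2); rewrite /rowS !big_ord0; ring.
rewrite EgridS; pose u' := u \o lift ord0.
under eq_bigr => a _.
  rewrite (_ : Egrid _ = gpt a ^+ 2 * u ord0 ^+ 2 + gvar * \sum_i u' i ^+ 2); last first.
    transitivity (Egrid (fun g : {ffun 'I_n -> I} =>
        (gpt a ^+ 2 * u ord0 ^+ 2 + (2 * gpt a * u ord0) * rowS g u') + rowS g u' ^+ 2)).
      by congr Egrid; apply/funext => g; rewrite rowS_fcons; ring.
    by rewrite !EgridD Egrid_cst EgridZ rowS_mean mulr0 addr0 IHn.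
  rewrite mulrDr mulrA; over.
by rewrite big_split/= gw_wsum -mulr_suml [in RHS]big_ord_recl mulrDr.
Qed.

(** Splitting off one coordinate, its third power meets the mean of the remaining sum and its first
    power has mean 0, so both odd terms vanish. The remaining cross term is at most 6 x^2 U, the one
    in 3 (x^2 + U)^2. *)
Lemma rowS_fourth n u :
  Egrid (fun g : {ffun 'I_n -> I} => rowS g u ^+ 4) <= 3 * (\sum_i u i ^+ 2) ^+ 2.
Proof.
elim: n u => [|n IHn] u.
  by have [g ->] := Egrid0 (fun g => rowS g u ^+ 4); rewrite /rowS !big_ord0; lra.
rewrite EgridS; pose u' := u \o lift ord0.
pose U := \sum_i u' i ^+ 2.
pose E3 := Egrid (fun g : {ffun 'I_n -> I} => rowS g u' ^+ 3).
have U0 : 0 <= U by apply: sumr_ge0 => i _; exact: sqr_ge0.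
apply: (@le_trans _ _ (\sum_a (gw a * (u ord0 ^+ 4 + 3 * U ^+ 2) +
    ((6 * u ord0 ^+ 2 * (gvar * U)) * (gw a * gpt a ^+ 2) + (4 * u ord0 * E3) * (gw a * gpt a))))).
  apply: ler_sum => a _.
  have -> : Egrid (fun g : {ffun 'I_n -> I} => rowS (fcons a g) u ^+ 4) =
      gpt a ^+ 4 * u ord0 ^+ 4 + 6 * (gpt a ^+ 2 * u ord0 ^+ 2) * (gvar * U) +
      4 * (gpt a * u ord0) * E3 + Egrid (fun g : {ffun 'I_n -> I} => rowS g u' ^+ 4).
    transitivity (Egrid (fun g : {ffun 'I_n -> I} =>
      (((gpt a ^+ 4 * u ord0 ^+ 4 + (4 * (gpt a * u ord0) ^+ 3) * rowS g u') +
      (6 * (gpt a ^+ 2 * u ord0 ^+ 2)) * rowS g u' ^+ 2) + (4 * (gpt a * u ord0)) * rowS g u' ^+ 3)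
      + rowS g u' ^+ 4)).
      by congr Egrid; apply/funext => g; rewrite rowS_fcons -/u'; ring.
    by rewrite !EgridD Egrid_cst !EgridZ rowS_mean mulr0 addr0 rowS_var.
  have h4 : gpt a ^+ 4 * u ord0 ^+ 4 <= u ord0 ^+ 4.
    rewrite ler_piMl ?exprn_even_ge0//.
    have x2 : gpt a ^+ 2 <= 1 by rewrite -real_normK ?num_real// exprn_ile1// gpt_le1.
    by rewrite (exprM _ 2 2) exprn_ile1// sqr_ge0.
  have -> : gw a * (u ord0 ^+ 4 + 3 * U ^+ 2) +
    ((6 * u ord0 ^+ 2 * (gvar * U)) * (gw a * gpt a ^+ 2) + (4 * u ord0 * E3) * (gw a * gpt a))
    = gw a * (u ord0 ^+ 4 + 3 * U ^+ 2 + 6 * (gpt a ^+ 2 * u ord0 ^+ 2) * (gvar * U) +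
      4 * (gpt a * u ord0) * E3) by ring.
  by rewrite ler_wpM2l ?gw_ge0//; have := IHn u'; rewrite -/U; move: h4; clear; lra.
rewrite !big_split/= gw_wsum -!mulr_sumr gmean -/gvar [in leRHS]big_ord_recl.
have v1 := gvar_le1; have v6 := gvar_ge; set x := u ord0.
have v2 : gvar * gvar <= 1 by rewrite -[leRHS]mulr1; apply: ler_pM => //; lra.
have : 6 * x ^+ 2 * (gvar * U) * gvar <= 6 * x ^+ 2 * U.
  have -> : 6 * x ^+ 2 * (gvar * U) * gvar = (6 * x ^+ 2 * U) * (gvar * gvar) by ring.
  by rewrite ler_piMr// mulr_ge0// mulr_ge0 ?sqr_ge0.
have -> : (x ^+ 2 + \sum_(i < n) u (lift ord0 i) ^+ 2) = x ^+ 2 + U by [].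
have := sqr_ge0 (x ^+ 2).
set q := 6 * x ^+ 2 * _ * _.
have -> : x ^+ 4 = (x ^+ 2) ^+ 2 by ring.
move: (x ^+ 2) => y; clear; nra.
Qed.

(* Averaged over a centred s with E s ^ 2 >= 1/6 and E s ^ 4 <= 3, the left-hand
   side is at least 1/24. *)
Lemma small_ball_poly (s : R) :
  3 * s + s ^+ 2 - s ^+ 4 / 36 - 24^-1 <= 40 * (100^-1 <= s)%R%:R.
Proof.
have [s1|s1] := leP 100^-1 s.
  have -> : s ^+ 4 = (s ^+ 2) ^+ 2 by ring.
  (* These squares give s^4 / 36 >= 9 s^2 / 8 - 12 and s^2 / 8 >= 3 s - 18, so the left-hand side
     stays below 30. *)
  have := sqr_ge0 (s - 12); have := sqr_ge0 (s ^+ 2 / 6 - 27 / 8).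
  by rewrite mulr1 !sqrrB; lra.
rewrite mulr0; have [s0|s0] := leP s 0; last first.
  have : 0 <= s ^+ 4 by rewrite exprn_even_ge0.
  have : s ^+ 2 <= s * 100^-1 by rewrite expr2 ler_pM2l// ltW.
  by move: s1; lra.
have [t t0 ->] : exists2 t, 0 <= t & s = - t by exists (- s); rewrite ?opprK// oppr_ge0.
(* For t >= 0 the cubic t^3 - 36 t + 108 is smallest at sqrt 12, which is close to 7/2. *)
have h : 0 <= (t - 7 / 2) ^+ 2 * (t + 7) by rewrite mulr_ge0 ?sqr_ge0//; lra.
have h2 : 0 <= t * (t ^+ 3 - 36 * t + 108).
  have e : t ^+ 3 - 36 * t + 108 = (t - 7 / 2) ^+ 2 * (t + 7) + 3 / 4 * t + 89 / 4 by field.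
  by rewrite mulr_ge0//; rewrite e; lra.
have -> : 3 * - t + (- t) ^+ 2 - (- t) ^+ 4 / 36 - 24^-1 =
    - (t * (t ^+ 3 - 36 * t + 108)) / 36 - 24^-1 by field.
lra.
Qed.

(** 1/24 divided by 40 exceeds 1/1000. The linear term of the polynomial, of mean 0, is what makes
    the bound one-sided, as prescribed orthants require. *)
Lemma row_small_ball n (u : 'I_n -> R) : \sum_i u i ^+ 2 = 1 ->
  1000^-1 <= Egrid (fun g => (100^-1 <= rowS g u)%R%:R).
Proof.
move=> u1; have v6 := gvar_ge.
have := rowS_fourth u; have := rowS_var u; have := rowS_mean u.
rewrite u1 => e1 e2 e4.
have : Egrid (fun g => 3 * rowS g u + rowS g u ^+ 2 + (- 36^-1) * rowS g u ^+ 4 + (- 24^-1)) <=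
   Egrid (fun g => 40 * (100^-1 <= rowS g u)%R%:R).
  apply: le_Egrid => g; apply: le_trans (small_ball_poly _).
  by rewrite le_eqVlt; apply/orP; left; apply/eqP; field.
rewrite !EgridD Egrid_cst !EgridZ e1 e2; lra.
Qed.

End grid_moments.

(** * Log-concave measures and lattices *)

Section linear_functional.
Context {R : realType} {n : nat}.
Implicit Types (Q : probability (Rn R n) R) (u : 'I_n -> R) (x y : Rn R n).

Definition lin u x : R := \sum_i u i * tnth x i.

Lemma measurable_coord (i : 'I_n) : measurable_fun setT (fun x : Rn R n => tnth x i : R).
Proof. exact: measurable_tnth. Qed.

Lemma measurable_lin u : measurable_fun setT (lin u).
Proof.
apply: measurable_sum => i; apply: measurable_funM => //.
exact: measurable_coord.
Qed.

Lemma lin_comb u (a : R) x y : lin u (combRn a x y) = a * lin u x + (1 - a) * lin u y.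
Proof.
rewrite /lin !mulr_sumr -big_split/=; apply: eq_bigr => i _.
by rewrite tnth_mktuple; ring.
Qed.

Lemma linB u v x : lin (fun i => u i - v i) x = lin u x - lin v x.
Proof. by rewrite /lin -sumrB; apply: eq_bigr => i _; rewrite mulrBl. Qed.

Lemma linZ (c : R) u x : lin (fun i => c * u i) x = c * lin u x.
Proof. by rewrite /lin mulr_sumr; apply: eq_bigr => i _; rewrite mulrA. Qed.

Lemma measurable_ge_fun (f : Rn R n -> R) (c : R) : measurable_fun setT f ->
  measurable [set x | c <= f x].
Proof.
move=> mf; rewrite -[X in measurable X]setTI.
by apply: (measurable_fun_le measurableT (f := cst c)) => //.
Qed.

Lemma measurable_le_fun (f : Rn R n -> R) (c : R) : measurable_fun setT f ->
  measurable [set x | f x <= c].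
Proof.
move=> mf; rewrite -[X in measurable X]setTI.
by apply: (measurable_fun_le measurableT (g := cst c)) => //.
Qed.

Lemma prC Q (A : set (Rn R n)) : measurable A -> pr Q (~` A) = 1 - pr Q A.
Proof.
move=> mA; apply: EFin_inj; rewrite prE; last exact: measurableC.
by rewrite probability_setC// EFinB prE.
Qed.

(* Borell's lemma: with a = 2 / (r + 1), if |<u, x>| >= r s and |<u, y>| < s then
   |<u, a x + (1 - a) y>| >= s. *)
Lemma tail_growth Q u (s p r : R) : lc_measure Q -> 0 < s -> 2 <= p -> 1 <= r ->
  pr Q [set x | s <= `|lin u x|] <= expR (- p) ->
  pr Q [set x | r * s <= `|lin u x|] <= expR (- (p * r / 4)).
Proof.
move=> lcQ s0 p2 r1 hs.
have [->|rn] := eqVneq r 1.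
  by rewrite mul1r; apply: (le_trans hs); rewrite ler_expR; lra.
have {}r1 : 1 < r by rewrite lt_neqAle eq_sym rn.
have mabs : measurable_fun setT (fun x => `|lin u x|).
  by apply: measurableT_comp => //; exact: measurable_lin.
pose A := [set x | r * s <= `|lin u x|].
pose D := [set x | s <= `|lin u x|].
have mA : measurable A by exact: measurable_ge_fun.
have mD : measurable D by exact: measurable_ge_fun.
pose a := 2 / (r + 1).
have r0 : 0 < r + 1 by lra.
have a01 : 0 < a < 1.
  by rewrite divr_gt0//= ltr_pdivrMr// mul1r; lra.
have /andP[a0 a1] := a01.
have := lcQ a A (~` D) D a01 mA (measurableC mD) mD.
move=> /(_ _)/wrap[].
  move=> x y; rewrite /A /D /= => rx /negP; rewrite -ltNge lin_comb => ys.
  have : `|a * lin u x + (1 - a) * lin u y| >= a * `|lin u x| - (1 - a) * `|lin u y|.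
    apply: le_trans (lerB_normD _ _).
    rewrite (normrM a) (normrM (1 - a)) (gtr0_norm a0).
    by rewrite (@gtr0_norm _ (1 - a)) ?subr_gt0.
  apply: le_trans.
  have h1 : a * (r * s) <= a * `|lin u x| by rewrite ler_pM2l.
  have h2 : (1 - a) * `|lin u y| <= (1 - a) * s by apply: ler_wpM2l; rewrite ?subr_ge0 ltW.
  have e : a * (r * s) - (1 - a) * s = s by rewrite /a; field; rewrite gt_eqF.
  by move: h1 h2 e; clear; lra.
rewrite prC// => lc.
(* The bound 1/2 is weakened to an exponential so that the final comparison is one of exponents. *)
have e1 : expR (-1) <= 1 - pr Q D.
  have : expR (- p) <= expR (-1) by rewrite ler_expR; lra.
  have : expR (-1) <= 2^-1 :> R.
    rewrite expRN lef_pV2 ?posrE ?expR_gt0//.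
    by have := expR_ge1Dx (1 : R); lra.
  by move: hs; rewrite -/D; lra.
have {lc} lc : pr Q A `^ a * expR (-1) `^ (1 - a) <= expR (- p).
  apply: le_trans (le_trans lc hs); rewrite ler_wpM2l ?powR_ge0//.
  apply: ge0_ler_powR; rewrite ?nnegrE ?expR_ge0 ?subr_ge0 ?(ltW a1)//.
  exact: pr_le1.
rewrite -/A leNgt; apply/negP => hA.
suff : expR (- p) < pr Q A `^ a * expR (-1) `^ (1 - a) by rewrite ltNge lc.
have : expR (- (p * r / 4)) `^ a < pr Q A `^ a.
  by apply: gt0_ltr_powR => //; rewrite nnegrE ?expR_ge0 ?pr_ge0.
rewrite -!expRM -(ltr_pM2r (expR_gt0 (-1 * (1 - a)))) => h.
apply: le_lt_trans h; rewrite -expRD ler_expR.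
have -> : - (p * r / 4) * a + -1 * (1 - a) =
    - p + ((p * r) + (p - 2) * 2 + 2 + (4 - 2 * r)) / (2 * (r + 1)).
  by rewrite /a; field; rewrite gt_eqF.
rewrite lerDl divr_ge0//; last by lra.
have : 2 * r <= p * r by rewrite ler_pM2r//; lra.
lra.
Qed.

End linear_functional.

(** * Lattice points near a point, and convex hulls meeting all orthants *)

Section lattice_counting.
Context {R : realType}.

Lemma expR1_ge2 : 2 <= expR 1 :> R.
Proof. by have := expR_ge1Dx (1 : R); lra. Qed.

(** Each term is at most e times the integral of exp(-|x|) over the unit interval to the right of
    its point. The whole integral is 2, and 2 e <= e^2. *)
Lemma sum_expR_dist m (y : R) : \sum_(i < m) expR (- `|i%:R - y|) <= expR 2.
Proof.
have [E E1] : {E : R | expR 1 = E} by exists (expR 1).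
have E2 : 2 <= E by rewrite -E1 expR1_ge2.
have EE : expR 2 = E * E :> R by rewrite -E1 -expRD; congr expR; lra.
(* [psi] is the integral of exp(-|x|) from -oo to x. *)
pose psi (x : R) := if x <= 0 then expR x else 2 - expR (- x).
have psi2 x : psi x <= 2.
  rewrite /psi; case: (leP x 0) => x0; last by have := expR_ge0 (- x); lra.
  by have : expR x <= expR 0 by [rewrite ler_expR]; rewrite expR0; lra.
suff : \sum_(i < m) expR (- `|i%:R - y|) <= E * psi (m%:R - y).
  move=> /le_trans; apply; rewrite EE ler_pM2l; last by lra.
  exact: le_trans (psi2 _) E2.
elim: m => [|m IHm].
  rewrite big_ord0 mulr_ge0//; first lra.
  rewrite /psi; case: (leP (0%:R - y) 0) => x0; first exact: expR_ge0.
  have : expR (- (0%:R - y)) <= expR 0 by rewrite ler_expR; lra.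
  by rewrite expR0; lra.
rewrite big_ord_recr/=; set x := m%:R - y.
have -> : m.+1%:R - y = x + 1 by rewrite /x -natr1; ring.
apply: (le_trans (lerD IHm (lexx _))); rewrite -/x /psi.
move: x => x.
have [x1|x1] := leP (x + 1) 0.
  have x0 : x <= 0 by lra.
  rewrite x0 ler0_norm// opprK expRD E1.
  have : 0 <= expR x * ((E - 2) * (E + 1) + 1).
    by rewrite mulr_ge0 ?expR_ge0// addr_ge0// mulr_ge0; lra.
  lra.
have [x0|x0] := leP x 0.
  rewrite ler0_norm// opprK.
  have -> : expR (- (x + 1)) = (expR x)^-1 * E^-1.
    by rewrite opprD expRD !expRN E1.
  have t1 : expR x <= 1 by rewrite -expR0 ler_expR.
  have tE : E^-1 <= expR x by rewrite -E1 -expRN ler_expR -subr_ge0 opprK ltW.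
  have t0 : 0 < expR x by exact: expR_gt0.
  move: t0 t1 tE; set t := expR x => t0 t1 tE.
  have e0 : 0 < E by lra.
  have q : 1 <= t * E by rewrite -ler_pdivrMr// mul1r.
  have -> : E * (2 - t^-1 * E^-1) = 2 * E - t^-1 by field; rewrite !gt_eqF.
  suff : ((E + 1) * t) * t + 1 <= 2 * E * t.
    move=> hh; rewrite -(ler_pM2r t0) mulrBl mulVf ?gt_eqF//; lra.
  have : 0 <= (1 - t) * (t * E - 1) by rewrite mulr_ge0// subr_ge0.
  by nra.
have -> : expR (- (x + 1)) = expR (- x) * E^-1 by rewrite opprD expRD [X in _ * X]expRN E1.
rewrite gtr0_norm//; have := expR_ge0 (- x); set t := expR (- x) => t0.
have -> : E * (2 - t * E^-1) = 2 * E - t by field; lra.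
by move: E2; clear -t0; nra.
Qed.

(** Exponential Markov inequality: the indicator is at most e^(K k) times the product of the
    exp(-|z_j - y_j|), whose sum over z factorizes. *)
Lemma lattice_count k m K (y : 'I_k -> R) :
  \sum_(z : {ffun 'I_k -> 'I_m}) (\sum_j `|(z j)%:R - y j| <= K * k%:R)%R%:R
    <= expR (K + 2) ^+ k.
Proof.
apply: (@le_trans _ _ (\sum_(z : {ffun 'I_k -> 'I_m})
    (expR (K * k%:R) * \prod_j expR (- `|(z j)%:R - y j|)))).
  apply: ler_sum => z _; case: (leP (\sum_j _) _) => h; last first.
    by rewrite mulr_ge0 ?expR_ge0// prodr_ge0// => j _; exact: expR_ge0.
  rewrite -expR_sum -expRD sumrN -[X in X <= _]expR0 ler_expR subr_ge0; exact: h.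
rewrite -mulr_sumr -(bigA_distr_bigA (fun j (i : 'I_m) => expR (- `|i%:R - y j|))).
rewrite expRD exprMn expRM_natr; apply: ler_wpM2l; first by rewrite exprn_ge0 ?expR_ge0.
rewrite -[k in leRHS]card_ord -prodr_const.
by apply: ler_prod => j _; rewrite sum_expR_dist andbT sumr_ge0// => i _; exact: expR_ge0.
Qed.

Definition sg (b : bool) : R := if b then 1 else -1.

(** Coordinates are corrected one at a time. Two points that agree with w before i and lie beyond A
    on opposite sides at i have between them a point with the right coordinate i; its later
    coordinates keep their signs and sizes by convexity. *)
Lemma orthant_hull k (A : R) (L : ('I_k -> R) -> Prop) : 0 <= A ->
  (forall a y z, 0 <= a <= 1 -> L y -> L z -> L (fun j => a * y j + (1 - a) * z j)) ->
  (forall s : 'I_k -> bool, exists2 z, L z & forall j, A <= sg (s j) * z j) ->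
  forall w, (forall j, `|w j| <= A) -> L w.
Proof.
move=> A0 Lconv Lorth w wA.
suff H (i : nat) : (i <= k)%N -> forall s : 'I_k -> bool, exists2 z, L z &
    forall j : 'I_k, ((j < i)%N -> z j = w j) /\ ((i <= j)%N -> A <= sg (s j) * z j).
  have [z Lz zw] := H k (leqnn k) (fun _ => true).
  by rewrite (_ : w = z)//; apply/funext => j; have [->] := zw j.
elim: i => [_ s|i IHi ik s].
  by have [z Lz zA] := Lorth s; exists z => // j; split.
pose s1 b (j : 'I_k) := if j == i :> nat then b else s j.
have [zp Lp zpP] := IHi (ltnW ik) (s1 true).
have [zm Lm zmP] := IHi (ltnW ik) (s1 false).
pose j0 := Ordinal ik.
have p0 : A <= zp j0 by have [_ /(_ (leqnn _))] := zpP j0; rewrite /s1 eqxx /sg mul1r.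
have m0 : A <= - zm j0 by have [_ /(_ (leqnn _))] := zmP j0; rewrite /s1 eqxx /sg mulN1r.
have := wA j0; rewrite ler_norml => /andP[w1 w2].
have [a a01 aE] : exists2 a, 0 <= a <= 1 & w j0 = a * zp j0 + (1 - a) * zm j0.
  (* Equality forces A = 0, and then all three coordinates vanish. *)
  have [e|ne] := eqVneq (zp j0) (zm j0).
    by exists 0; rewrite ?lexx ?ler01//; rewrite mul0r subr0 mul1r add0r; lra.
  have d0 : 0 < zp j0 - zm j0 by rewrite lt_neqAle eq_sym subr_eq0 ne/=; lra.
  exists ((w j0 - zm j0) / (zp j0 - zm j0)).
    by apply/andP; split; [apply: divr_ge0; lra|rewrite ler_pdivrMr//; lra].
  by field; rewrite gt_eqF.
exists (fun j => a * zp j + (1 - a) * zm j); first exact: Lconv.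
move=> j; split.
  rewrite ltnS leq_eqVlt => /orP[/eqP ji|ji].
    by rewrite (_ : j = j0); [rewrite -aE|exact/val_inj].
  by have [->//] := zpP j; have [->//] := zmP j => _ _; ring.
move=> ij; have ji : (j == i :> nat) = false by rewrite gtn_eqF.
have [_ /(_ (ltnW ij))] := zpP j; have [_ /(_ (ltnW ij))] := zmP j.
rewrite /s1 ji => h1 h2; have /andP[a0 a1] := a01.
have -> : sg (s j) * (a * zp j + (1 - a) * zm j) =
  a * (sg (s j) * zp j) + (1 - a) * (sg (s j) * zm j) by ring.
have := ler_wpM2l a0 h2; have : (1 - a) * A <= (1 - a) * (sg (s j) * zm j).
  by rewrite ler_wpM2l// subr_ge0.
by lra.
Qed.

End lattice_counting.

(** * A log-concave image cannot spread over a large lattice cube *)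

Section lattice_spread.
Context {R : realType} {n : nat}.
Variable Q : probability (Rn R n) R.
Implicit Types (A B : set (Rn R n)).

Lemma pr_setU_le A B : measurable A -> measurable B -> pr Q (A `|` B) <= pr Q A + pr Q B.
Proof.
move=> mA mB; rewrite -lee_fin EFinD !prE//; last exact: measurableU.
exact: measureU2.
Qed.

(** Tightness; it lets the sums over lattice points run over a finite box. *)
Lemma pr_bounded (f : Rn R n -> R) (e : R) : measurable_fun setT f -> 0 < e ->
  exists B : nat, pr Q (~` [set x | f x <= B%:R]) <= e.
Proof.
move=> mf e0; pose E (b : nat) := [set x | f x <= b%:R].
have mE b : measurable (E b) by exact: measurable_le_fun.
have cv : (Q (E b) @[b --> \oo] --> Q setT)%E.
  rewrite (_ : setT = \bigcup_b E b); last first.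
    apply/seteqP; split=> // x _; exists (Num.truncn (f x)).+1 => //.
    by rewrite /E/= ltW// truncnS_gt.
  apply: nondecreasing_cvg_mu => //; first exact: bigcup_measurable.
  by move=> a b ab; apply/subsetPset => x; rewrite /E/= => /le_trans; apply; rewrite ler_nat.
apply: contrapT => nex.
suff : (Q setT <= (1 - e)%:E)%E.
  by rewrite probability_setT lee_fin; apply/negP; rewrite -ltNge; lra.
apply: (cvge_to_le cv); near=> b; rewrite -prE// lee_fin.
rewrite leNgt; apply/negP => h; apply: nex; exists b.
by rewrite prC -/(E b)// lerBlDr addrC -lerBlDr ltW.
Unshelve. all: by end_near.
Qed.

Variables (k : nat) (y : 'I_k -> 'I_n -> R).
Hypotheses (lcQ : lc_measure Q) (k0 : (0 < k)%N).

(** The l1 ball of radius 3 k, that is 3 per coordinate. Its mass [F z] acts as a smoothed density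
    of the image at z, log-concave in z because the norm is convex. *)
Let G (z : 'I_k -> R) := [set x | \sum_j `|z j - lin (y j) x| <= 3 * k%:R].

Let mdist (z : 'I_k -> R) : measurable_fun setT (fun x => \sum_j `|z j - lin (y j) x|).
Proof.
apply: measurable_sum => j; apply: measurableT_comp => //.
by apply: measurable_funB => //; exact: measurable_lin.
Qed.

Let mG z : measurable (G z). Proof. exact: measurable_le_fun. Qed.

Let F z := pr Q (G z).

Let F_lc a z z' : 0 < a < 1 ->
  F z `^ a * F z' `^ (1 - a) <= F (fun j => a * z j + (1 - a) * z' j).
Proof.
move=> /andP[a0 a1]; apply: lcQ => //; first exact/andP.
move=> x x'; rewrite /G/= => h h'.
apply: (@le_trans _ _ (a * \sum_j `|z j - lin (y j) x| + (1 - a) * \sum_j `|z' j - lin (y j) x'|)).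
  rewrite !mulr_sumr -big_split/=; apply: ler_sum => j _; rewrite lin_comb.
  have -> : a * z j + (1 - a) * z' j - (a * lin (y j) x + (1 - a) * lin (y j) x') =
     a * (z j - lin (y j) x) + (1 - a) * (z' j - lin (y j) x') by ring.
  apply: (le_trans (ler_normD _ _)).
  by rewrite (normrM a) (normrM (1 - a)) (gtr0_norm a0) (@gtr0_norm _ (1 - a)) ?subr_gt0.
have b0 : 0 <= 1 - a by rewrite subr_ge0 ltW.
have := ler_wpM2l (ltW a0) h; have := ler_wpM2l b0 h'; lra.
Qed.

(** By [lattice_count] a point x lies in at most exp(K + 2)^k of the sets. *)
Lemma sum_lattice_pr m (K : R) (y' : Rn R n -> 'I_k -> R)
    (E : {ffun 'I_k -> 'I_m} -> set (Rn R n)) :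
  (forall z, measurable (E z)) ->
  (forall z x, E z x -> \sum_j `|(z j)%:R - y' x j| <= K * k%:R) ->
  \sum_z pr Q (E z) <= expR (K + 2) ^+ k.
Proof.
move=> mE EK.
have us (g : unit -> R) : \sum_u g u = g tt by rewrite (bigD1 tt)//= big1 ?addr0// => -[].
have := @pr_sum_le R n Q {ffun 'I_k -> 'I_m} unit (fun=> 1) (fun=> expR (K + 2) ^+ k) E
  (fun=> setT).
rewrite us prT mulr1.
under eq_bigr do rewrite mul1r.
apply => // x.
rewrite us indicT /= mulr1.
apply: le_trans (lattice_count m K (y' x)).
apply: ler_sum => z _; rewrite mul1r indicE.
case: (boolP (x \in E z)) => [|_]; last by rewrite ler0n.
by rewrite inE => /EK ->.
Qed.

(** The target is s times an integer just above the larger of A and s v. The shift by B + A + 1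
    encodes signed integers as ordinals. *)
Lemma round_orthant (A B : nat) (s : bool) (v : R) : `|v| <= B%:R ->
  exists2 i : 'I_((B + A).+1.*2.+1), A%:R <= @sg R s * (i%:R - (B + A).+1%:R) &
    `|i%:R - (B + A).+1%:R - v| <= Num.max (A%:R - @sg R s * v) 0 + 1.
Proof.
move=> vB; pose w := Num.max A%:R (@sg R s * v).
have w0 : 0 <= w by rewrite le_max ler0n.
have wBA : w <= (B + A)%:R.
  rewrite ge_max ler_nat leq_addl/= natrD; apply: (@le_trans _ _ `|v|).
    by rewrite /sg; case: (s); rewrite ?mul1r ?mulN1r ?ler_norm// -normrN ler_norm.
  by apply: le_trans vB _; rewrite lerDl.
have /andP[t1 t2] := truncn_itv w0.
set q := Num.truncn w in t1 t2.
have qB : (q <= B + A)%N by rewrite -(ler_nat R); exact: le_trans t1 wBA.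
pose i := if s then ((B + A).+1 + q.+1)%N else ((B + A).+1 - q.+1)%N.
have iM : (i < (B + A).+1.*2.+1)%N by rewrite /i; case: (s); move: qB; lia.
have iE : i%:R - (B + A).+1%:R = @sg R s * q.+1%:R.
  rewrite /i /sg; case: (s); first by rewrite natrD mul1r; ring.
  by rewrite natrB ?ltnS// mulN1r; ring.
exists (Ordinal iM); rewrite /= iE.
  have -> : @sg R s * (@sg R s * q.+1%:R) = q.+1%:R by rewrite /sg; case: (s); ring.
  by apply: (le_trans _ (ltW t2)); rewrite le_max lexx.
have -> : `|@sg R s * q.+1%:R - v| = `|q.+1%:R - @sg R s * v|.
  rewrite /sg; case: (s); first by rewrite !mul1r.
  by rewrite -normrN; congr `|_|; ring.
have -> : Num.max (A%:R - @sg R s * v) 0 = w - @sg R s * v.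
  by rewrite /w -[in LHS](subrr (@sg R s * v)) -addr_maxl.
have vw : @sg R s * v <= w by rewrite le_max lexx orbT.
rewrite ger0_norm; last by rewrite subr_ge0; exact: le_trans vw (ltW t2).
by move: t1; rewrite -natr1; lra.
Qed.

(* If, in every orthant, the vector Y = (lin (y j)) is with probability at
   least exp(-11 k) far from the origin at scale A while it is of order 1 with
   probability 1/2, then by convexity the level set L of F contains all lattice
   points of the cube [-A, A]^k, which is too much mass if A is large. *)
Lemma lattice_spread (A : nat) :
  2^-1 <= pr Q [set x | \sum_j `|lin (y j) x| <= 3 * k%:R] ->
  (forall s : 'I_k -> bool, expR (- 11) ^+ k / 4 <=
    pr Q [set x | \sum_j Num.max (A%:R - @sg R (s j) * lin (y j) x) 0 <= k%:R]) ->
  A.*2.+1%:R <= expR 55 :> R.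
Proof.
move=> F0 Fs; pose e (c : R) := expR c ^+ k.
have e0 c : 0 < e c by rewrite exprn_gt0 ?expR_gt0.
have eM c c' : e c * e c' = e (c + c') by rewrite /e expRD exprMn.
have ele c c' : c <= c' -> e c <= e c'.
  by move=> cc; rewrite /e lerXn2r ?nnegrE ?expR_ge0// ler_expR.
have F00 : 2^-1 <= F (fun=> 0).
  rewrite /F (_ : G _ = [set x | \sum_j `|lin (y j) x| <= 3 * k%:R])//.
  by apply/funext => x; rewrite /G/=; under eq_bigr do rewrite sub0r normrN.
have half : 0 < (2^-1 : R) < 1 by lra.
pose L z := e (- 50) <= F z.
have Lconv a z z' : 0 <= a <= 1 -> L z -> L z' -> L (fun j => a * z j + (1 - a) * z' j).
  move=> /andP[]; rewrite le_eqVlt => /orP[/eqP <- _ _ Lz'|a0].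
    by rewrite (_ : (fun _ => _) = z')//; apply/funext => j; ring.
  rewrite le_eqVlt => /orP[/eqP -> Lz _|a1 Lz Lz'].
    by rewrite (_ : (fun _ => _) = z)//; apply/funext => j; ring.
  apply: (le_trans _ (F_lc _ _ _)); last exact/andP.
  have b0 : 0 < 1 - a by rewrite subr_gt0.
  have -> : e (- 50) = e (- 50) `^ a * e (- 50) `^ (1 - a).
    rewrite -powRD; last by rewrite (gt_eqF (e0 _)) implybT.
    by rewrite [a + _]addrC subrK powRr1// ltW.
  by apply: ler_pM; rewrite ?powR_ge0//; apply: ge0_ler_powR;
    rewrite ?nnegrE ?pr_ge0 ?(ltW a0) ?(ltW b0) ?(ltW (e0 _)).
(* Otherwise all lattice points z of the orthant beyond A have F z < e^(-50 k). Log-concavity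
   between z and 0, with F 0 >= 1/2, then gives F z <= 2 e^(-25 k) F(z/2). The sum of the F(z/2) is
   at most e^(8 k), so the neighbourhood of the orthant would have mass at most 2 e^(-17 k), up to
   the tail outside [EB]: too little against e^(-11 k) / 4. *)
have Lorth (s : 'I_k -> bool) : exists2 z, L z & forall j, A%:R <= @sg R (s j) * z j.
  apply: contrapT => nex.
  pose near := [set x | \sum_j Num.max (A%:R - @sg R (s j) * lin (y j) x) 0 <= k%:R].
  have mnear : measurable near.
    apply: measurable_le_fun; apply: measurable_sum => j; apply: measurable_maxr => //.
    by apply: measurable_funB => //; apply: measurable_funM => //; exact: measurable_lin.
  have m8 : 0 < e (- 11) / 8 by rewrite divr_gt0.
  have mabs : measurable_fun setT (fun x => \sum_j `|lin (y j) x|).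
    apply: measurable_sum => j; apply: measurableT_comp => //; exact: measurable_lin.
  have [B BE] := pr_bounded mabs m8.
  pose EB := [set x | \sum_j `|lin (y j) x| <= B%:R].
  have mEB : measurable EB by exact: measurable_le_fun.
  pose M := (B + A).+1.
  pose zc (z : {ffun 'I_k -> 'I_(M.*2.+1)}) j : R := (z j)%:R - M%:R.
  pose dz z : R := [forall j, A%:R <= @sg R (s j) * zc z j]%:R.
  have h1 : pr Q (near `&` EB) <= \sum_z dz z * F (zc z).
    have us (g : unit -> R) : \sum_u g u = g tt by rewrite (bigD1 tt)//= big1 ?addr0// => -[].
    have := @pr_sum_le R n Q unit _ (fun=> 1) dz (fun=> near `&` EB) (fun z => G (zc z)).
    rewrite us mul1r; apply => //.
      by move=> _; exact: measurableI.
    move=> x; rewrite us mul1r indicE; case: (boolP (x \in _)) => [|_]; last first.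
      by apply: sumr_ge0 => z _; rewrite mulr_ge0// ler0n.
    rewrite inE => -[nx Bx].
    have Bj j : `|lin (y j) x| <= B%:R.
      apply: le_trans Bx; rewrite (bigD1 j)//= lerDl.
      by apply: sumr_ge0.
    have [z zP] : exists z : {ffun 'I_k -> 'I_(M.*2.+1)}, forall j,
        A%:R <= @sg R (s j) * zc z j /\
        `|zc z j - lin (y j) x| <= Num.max (A%:R - @sg R (s j) * lin (y j) x) 0 + 1.
      have ex j : exists i : 'I_(M.*2.+1), A%:R <= @sg R (s j) * (i%:R - M%:R) /\
          `|i%:R - M%:R - lin (y j) x| <= Num.max (A%:R - @sg R (s j) * lin (y j) x) 0 + 1.
        by have [i ? ?] := round_orthant A (s j) (Bj j); exists i.
      have /choice[f fP] := ex.
      by exists [ffun j => f j] => j; rewrite /zc ffunE.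
    rewrite (bigD1 z)//= -[leLHS]addr0; apply: lerD; last first.
      by apply: sumr_ge0 => z' _; rewrite mulr_ge0// ler0n.
    rewrite /dz; have -> : [forall j, A%:R <= @sg R (s j) * zc z j].
      by apply/forallP => j; have [] := zP j.
    rewrite mul1r indicE mem_set// /G/=.
    apply: (@le_trans _ _ (\sum_j (Num.max (A%:R - @sg R (s j) * lin (y j) x) 0 + 1))).
      by apply: ler_sum => j _; have [] := zP j.
    rewrite big_split/= sumr_const card_ord; move: nx; rewrite /near/=.
    by have := ler0n R k; lra.
  have h2 z : dz z * F (zc z) <= 2 * e (- 25) * F (fun j => 2^-1 * zc z j).
    rewrite /dz; case: (boolP [forall j, _]) => [/forallP zs|_]; last first.
      by rewrite mul0r !mulr_ge0 ?pr_ge0// ltW.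
    rewrite mul1r.
    have nL : F (zc z) < e (- 50).
      by rewrite ltNge; apply/negP => Lz; apply: nex; exists (zc z).
    have := F_lc (zc z) (fun=> 0) half.
    rewrite (_ : (fun _ => _ + _) = (fun j => 2^-1 * zc z j)); last first.
      by apply/funext => j; rewrite mulr0 addr0.
    have -> : 1 - 2^-1 = 2^-1 :> R by lra.
    rewrite !powR12_sqrt ?pr_ge0// => h.
    set f := F (zc z) in nL h *; have f0 : 0 <= f by exact: pr_ge0.
    have q0 : 2^-1 <= Num.sqrt (F (fun=> 0)).
      apply: le_trans F00 _.
      rewrite -[leLHS]sqr_sqrtr ?pr_ge0// expr2 ler_piMr ?sqrtr_ge0//.
      by rewrite -sqrtr1 ler_wsqrtr// pr_le1.
    have s1 : Num.sqrt f <= e (- 25).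
      have -> : e (- 25) = Num.sqrt (e (- 50)).
        have -> : e (- 50) = e (- 25) ^+ 2 by rewrite expr2 eM; congr e; lra.
        by rewrite sqrtr_sqr ger0_norm// ltW.
      by rewrite ler_wsqrtr// ltW.
    rewrite -(sqr_sqrtr f0) expr2.
    have s0 : 0 <= Num.sqrt f by exact: sqrtr_ge0.
    have s2 : Num.sqrt f <= 2 * F (fun j => 2^-1 * zc z j).
      have := ler_wpM2l s0 q0; lra.
    rewrite mulrAC; rewrite [2 * _ * _]mulrC.
    by rewrite [leLHS]mulrC; apply: ler_pM.
  (* A distance 3 k from z/2 to the image is a distance 6 k from z to twice the image, hence 8 = 6 +
     2. *)
  have h3 : \sum_z F (fun j => 2^-1 * zc z j) <= e 8.
    have -> : e 8 = expR (6 + 2) ^+ k by rewrite /e; congr (expR _ ^+ _); lra.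
    apply: (@sum_lattice_pr _ 6 (fun x j => M%:R + 2 * lin (y j) x)).
      by move=> z; exact: mG.
    move=> z x; rewrite /G/= => h.
    have -> : \sum_j `|(z j)%:R - (M%:R + 2 * lin (y j) x)| =
        2 * \sum_j `|2^-1 * zc z j - lin (y j) x|.
      rewrite mulr_sumr; apply: eq_bigr => j _.
      have -> : (z j)%:R - (M%:R + 2 * lin (y j) x) = 2 * (2^-1 * zc z j - lin (y j) x).
        by rewrite /zc; field.
      by rewrite normrM ger0_norm.
    by lra.
  have h4 : pr Q (near `&` EB) <= 2 * e (- 17).
    apply: (le_trans h1); apply: (@le_trans _ _ (\sum_z 2 * e (- 25) * F (fun j => 2^-1 * zc z j))).
      by apply: ler_sum => z _; exact: h2.
    rewrite -mulr_sumr -mulrA ler_pM2l//.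
    have -> : e (- 17) = e (- 25) * e 8 by rewrite eM; congr e; lra.
    by rewrite ler_pM2l.
  have h5 : e (- 11) / 8 <= pr Q (near `&` EB).
    have h : pr Q near <= pr Q (near `&` EB) + pr Q (~` EB).
      apply: (le_trans _ (pr_setU_le _ _)); last 2 first.
      - exact: measurableI.
      - exact: measurableC.
      apply: le_pr => //.
        by apply: measurableU; [exact: measurableI|exact: measurableC].
      by move=> x nx; have [Ex|nEx] := pselect (EB x); [left|right].
    by have := Fs s; rewrite -/near -/(e _); move: h BE; rewrite -/EB; lra.
  have h6 : e (- 6) <= 64^-1.
    apply: (@le_trans _ _ (expR (- 6))).
      rewrite /e -[leRHS]expr1 ler_wiXn2l ?expR_ge0//.
    have -> : expR (- 6) = expR (- 2) ^+ 3 :> R by rewrite -expRM_natl; congr expR; lra.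
    have -> : 64^-1 = 4^-1 ^+ 3 :> R by lra.
    rewrite lerXn2r ?nnegrE ?expR_ge0//.
    have -> : expR (- 2) = expR (- 1) ^+ 2 :> R by rewrite -expRM_natl; congr expR; lra.
    have -> : 4^-1 = 2^-1 ^+ 2 :> R by lra.
    rewrite lerXn2r ?nnegrE ?expR_ge0// expRN lef_pV2 ?posrE ?expR_gt0//.
    exact: expR1_ge2.
  have h7 : e (- 17) = e (- 11) * e (- 6) by rewrite eM; congr e; lra.
  have := e0 (- 11); have : e (- 11) * e (- 6) <= e (- 11) * 64^-1 by rewrite ler_pM2l.
  by move: h4 h5; rewrite h7; lra.
have hull := orthant_hull (ler0n R A) Lconv Lorth.
pose zc (z : {ffun 'I_k -> 'I_(A.*2.+1)}) j : R := (z j)%:R - A%:R.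
have Lz z : L (zc z).
  apply: hull => j; rewrite /zc ler_norml lerBrDr addrC subrr ler0n/= lerBlDr -natrD ler_nat addnn.
  by rewrite -ltnS ltn_ord.
have h1 : \sum_z F (zc z) <= e 5.
  have -> : e 5 = expR (3 + 2) ^+ k by rewrite /e; congr (expR _ ^+ _); lra.
  apply: (@sum_lattice_pr _ 3 (fun x j => A%:R + lin (y j) x)).
    by move=> z; exact: mG.
  move=> z x; rewrite /G/=; congr (_ <= _); apply: eq_bigr => j _; congr `|_|.
  by rewrite /zc; ring.
(* Every lattice point of the cube carries e^(-50 k), and the total is at most e^(5 k); this is
   where 55 comes from. *)
have h2 : A.*2.+1%:R ^+ k * e (- 50) <= e 5.
  apply: le_trans h1.
  apply: (@le_trans _ _ (\sum_(z : {ffun 'I_k -> 'I_(A.*2.+1)}) e (- 50))).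
    by rewrite sumr_const card_ffun !card_ord -[leRHS]mulr_natl natrX.
  by apply: ler_sum => z _; exact: Lz.
have : A.*2.+1%:R ^+ k <= expR 55 ^+ k :> R.
  rewrite -/(e 55) -(ler_pM2r (e0 (- 50))) eM.
  by have -> : 55 - 50 = 5 :> R by lra.
by rewrite ler_pXn2r// ?nnegrE ?expR_ge0 ?ler0n.
Qed.

End lattice_spread.

(** * Deviations of coordinate projections *)

Section probability_bounds.
Context {R : realType} {n : nat}.
Variable Q : probability (Rn R n) R.
Implicit Types (A B : set (Rn R n)).

Lemma measurable_forall (I : finType) (E : I -> set (Rn R n)) :
  (forall i, measurable (E i)) -> measurable [set x | forall i, E i x].
Proof.
move=> mE; rewrite (_ : [set x | _] = \bigcap_(i in [set: I]) E i).
  by apply: fin_bigcap_measurable => //; exact: finite_finset.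
by apply/seteqP; split => x /= h i; [move=> _|]; exact: h.
Qed.

Lemma measurable_exists (I : finType) (E : I -> set (Rn R n)) :
  (forall i, measurable (E i)) -> measurable [set x | exists i, E i x].
Proof.
move=> mE; rewrite (_ : [set x | _] = \bigcup_(i in [set: I]) E i).
  by apply: fin_bigcup_measurable => //; exact: finite_finset.
by apply/seteqP; split => x /=; [move=> [i]; exists i|move=> [i _]; exists i].
Qed.

Lemma pr_cover (I : finType) A B (E : I -> set (Rn R n)) :
  measurable A -> measurable B -> (forall i, measurable (E i)) ->
  (forall x, A x -> B x \/ exists i, E i x) ->
  pr Q A <= pr Q B + \sum_i pr Q (E i).
Proof.
move=> mA mB mE AB.
have mU := measurable_exists mE.
have us (g : unit -> R) : \sum_u g u = g tt by rewrite (bigD1 tt)//= big1 ?addr0// => -[].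
apply: (@le_trans _ _ (pr Q (B `|` [set x | exists i, E i x]))).
  by apply: le_pr => //; exact: measurableU.
apply: (le_trans (pr_setU_le _ _ _)) => //; rewrite lerD2l.
have := @pr_sum_le R n Q unit I (fun=> 1) (fun=> 1) (fun=> [set x | exists i, E i x]) E.
have e1 : \sum_i 1 * pr Q (E i) = \sum_i pr Q (E i).
  by apply: eq_bigr => i _; rewrite mul1r.
rewrite us mul1r e1.
apply => // x; rewrite us mul1r indicE; case: (boolP (x \in _)) => [|_]; last first.
  by apply: sumr_ge0 => i _; rewrite mulr_ge0.
rewrite inE => -[i Ei]; rewrite (bigD1 i)//= indicE mem_set// mulr1 lerDl.
by apply: sumr_ge0 => j _; rewrite mulr_ge0.
Qed.

End probability_bounds.

(** * The random matrix with independent grid-Gaussian entries *)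

Section random_matrix.
Context {R : realType} (n k : nat).
Hypotheses (n0 : (0 < n)%N) (k0 : (0 < k)%N).
(** With k n entries, each losing a factor e^(1/r) in property (tau), this choice makes the total
    loss exactly e. *)
Let r := (k * n)%N.
Let r0 : (0 < r)%N. Proof. by rewrite muln_gt0 k0. Qed.

Definition rmat := {ffun 'I_k -> {ffun 'I_n -> 'I_((k * n).*2.+1)}}.

Definition rmass (g : rmat) : R := pweight (@pweight R _ (@gw R r) n) g.

Definition entry (g : rmat) j i : R := @gpt R _ (g j i).

Lemma rmass_ge0 g : 0 <= rmass g.
Proof. by apply: pweight_ge0 => x; apply: pweight_ge0 => i; exact: gw_ge0. Qed.

Lemma sum_rmass : \sum_g rmass g = 1.
Proof. by apply: sum_pweight; apply: sum_pweight; exact: gw_sum. Qed.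

(** Property (tau) for the indicator of S and e^(d/4) times the indicator of B. *)
Lemma rmass_concentration (S B : pred rmat) (d : R) :
  (forall g g', S g -> B g' -> d <= \sum_j \sum_i (entry g j i - entry g' j i) ^+ 2) ->
  (\sum_g rmass g * (S g)%:R) * (\sum_g rmass g * (B g)%:R) <= expR (1 - d / 4).
Proof.
move=> SB.
have t1 := @tau_le_pweight R _ (@gw R r) (fun i j => (@gpt R _ i - @gpt R _ j) ^+ 2 / 4)
  (expR r%:R^-1) n (expR_gt0 _) (@gw_ge0 R r) (@tau_grid R r r0).
have t2 := @tau_le_pweight R _ (@pweight R _ (@gw R r) n)
  (fun x y : {ffun 'I_n -> _} => \sum_i (@gpt R _ (x i) - @gpt R _ (y i)) ^+ 2 / 4)
  (expR r%:R^-1 ^+ n) k (exprn_gt0 _ (expR_gt0 _))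
  (fun x => pweight_ge0 x (@gw_ge0 R r)) t1.
have := t2 (fun g => (S g)%:R) (fun g => expR (d / 4) * (B g)%:R).
have -> : (expR r%:R^-1 ^+ n) ^+ k = expR 1 :> R.
  rewrite -exprM -expRM_natl mulnC; congr expR; rewrite mulfV// pnatr_eq0.
  by rewrite -lt0n.
move=> /(_ _ _ _)/wrap[].
- by move=> g; rewrite ler0n.
- by move=> g; rewrite mulr_ge0 ?expR_ge0 ?ler0n.
- move=> g g'; case: (boolP (S g)) => Sg; last by rewrite mul0r expR_ge0.
  case: (boolP (B g')) => Bg; last by rewrite !mulr0 expR_ge0.
  rewrite mul1r mulr1 ler_expR; under eq_bigr do rewrite -mulr_suml.
  by rewrite -mulr_suml ler_pM2r// SB.
under [X in _ * X]eq_bigr do rewrite mulrCA.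
rewrite -[X in _ * X]mulr_sumr mulrCA -ler_pdivlMl ?expR_gt0// -expRN -expRD.
by rewrite addrC.
Qed.

Variable v : 'I_n -> R.

Definition mrow (g : rmat) j : R := \sum_i entry g j i * v i.

Lemma rmat_small_ball (s : 'I_k -> bool) (c : R) : 0 < c -> c ^+ 2 <= \sum_i v i ^+ 2 ->
  1000^-1 ^+ k <= \sum_g rmass g * [forall j, c / 100 <= @sg R (s j) * mrow g j]%:R.
Proof.
move=> c0 cv; pose U := Num.sqrt (\sum_i v i ^+ 2).
have s0 : 0 <= \sum_i v i ^+ 2 by apply: sumr_ge0 => i _; exact: sqr_ge0.
have cU : c <= U by rewrite -(@ler_pXn2r _ 2) ?nnegrE ?sqrtr_ge0 ?(ltW c0)// sqr_sqrtr.
have U0 : 0 < U by exact: lt_le_trans cU.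
pose u b i := @sg R b * v i / U.
have u1 b : \sum_i u b i ^+ 2 = 1.
  rewrite /u; under eq_bigr => i _.
    rewrite (_ : _ ^+ 2 = v i ^+ 2 / U ^+ 2); last by rewrite /sg; case: b; field; rewrite gt_eqF.
    over.
  by rewrite -mulr_suml /U sqr_sqrtr// divff// gt_eqF// -sqrtr_gt0.
have rowE b (g : {ffun 'I_n -> 'I_(r.*2.+1)}) :
    @sg R b * \sum_i @gpt R _ (g i) * v i = U * rowS g (u b).
  rewrite /rowS !mulr_sumr; apply: eq_bigr => i _; rewrite /u.
  by field; rewrite gt_eqF.
apply: (@le_trans _ _ (\sum_g rmass g * \prod_j ((100^-1 <= rowS (g j) (u (s j)))%R%:R : R))).
  rewrite (sum_pweight_prod _ (fun j x => (100^-1 <= rowS x (u (s j)))%R%:R)).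
  rewrite -[k in X in X <= _]card_ord -prodr_const; apply: ler_prod => j _.
  by rewrite invr_ge0 ler0n/=; exact: (row_small_ball r0 (u1 (s j))).
apply: ler_sum => g _; rewrite ler_wpM2l ?rmass_ge0//.
case: (boolP [forall j, _]) => [_|].
  by apply: prodr_ile1 => j; rewrite ler0n/= lern1 leq_b1.
rewrite negb_forall => /existsP[j]; rewrite -ltNge rowE => h.
rewrite (bigD1 j)//= (_ : (100^-1 <= _) = false) ?mul0r//.
apply/negbTE; rewrite -ltNge -(ltr_pM2l U0); apply: lt_le_trans h _.
by rewrite ler_pM2r// invr_gt0.
Qed.

Lemma rmat_small_ball_expR (s : 'I_k -> bool) (c : R) : 0 < c -> c ^+ 2 <= \sum_i v i ^+ 2 ->
  expR (- 10) ^+ k <= \sum_g rmass g * [forall j, c / 100 <= @sg R (s j) * mrow g j]%:R.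
Proof.
move=> c0 cv; apply: le_trans (rmat_small_ball s c0 cv).
apply: lerXn2r; rewrite ?nnegrE ?expR_ge0 ?invr_ge0 ?ler0n//.
rewrite expRN lef_pV2 ?posrE ?expR_gt0 ?ltr0n//.
(* 1000 <= 1024 = 2^10 <= e^10. *)
apply: (@le_trans _ _ (2 ^+ 10)); first by rewrite -natrX ler_nat.
have -> : expR 10 = expR 1 ^+ 10 :> R by rewrite -expRM_natl; congr expR; lra.
by apply: lerXn2r; rewrite ?nnegrE ?expR_ge0 ?ler0n// expR1_ge2.
Qed.

Lemma rmat_second_moment : \sum_g rmass g * \sum_j mrow g j ^+ 2 <= k%:R * \sum_i v i ^+ 2.
Proof.
under eq_bigr do rewrite mulr_sumr.
rewrite exchange_big/=.
apply: (@le_trans _ _ (\sum_(j < k) \sum_i v i ^+ 2)); last first.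
  by rewrite sumr_const card_ord mulr_natl.
apply: ler_sum => j _.
rewrite (sum_pweight_marginal (fun x => rowS x v ^+ 2)); last by apply: sum_pweight; exact: gw_sum.
have := @rowS_var R (k * n)%N n v; rewrite /Egrid => ->.
by rewrite ler_piMl ?gvar_le1// sumr_ge0// => i _; exact: sqr_ge0.
Qed.

End random_matrix.

(** * The deviation estimate *)

Section paouris.
Context {R : realType} {n : nat}.
Variable Q : probability (Rn R n) R.
Hypothesis lcQ : lc_measure Q.

(** Half the side of the lattice cube, in units of N; being above e^55 it contradicts
    [lattice_spread]. *)
Variable LS : nat.
Hypothesis lattice_scale_gt : expR 55 < LS%:R :> R.

Variables (J : {set 'I_n}) (k : nat) (a s : R).
Local Notation m := #|J|.
Hypotheses (m0 : (0 < m)%N) (k0 : (0 < k)%N) (s0 : 0 <= s) (a0 : 600 * LS%:R <= a).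

Let sumJ (x : Rn R n) := \sum_(i in J) tnth x i ^+ 2.

Hypothesis typical : pr Q [set x | 16 * m%:R <= sumJ x] <= 16^-1.
Hypothesis weak_tail : forall u : 'I_n -> R, \sum_i u i ^+ 2 <= 1 ->
  pr Q [set x | s <= `|lin u x|] <= expR (- 14) ^+ k.
Hypothesis large : expR (- 1) ^+ k <= pr Q [set x | a ^+ 2 * m%:R <= sumJ x].

Let n0 : (0 < n)%N.
Proof. by apply: leq_trans m0 _; rewrite -[n in (_ <= n)%N]card_ord; exact: max_card. Qed.

Variables sm N : R.
Hypotheses (sm0 : 0 < sm) (sm2 : sm ^+ 2 = m%:R).
(* N is the unit of length of the lattice: the coordinates of the random image
   of X reach a sm / 100 = N * LS with not too small a probability. *)
Hypothesis NLS : 100 * (N * LS%:R) = a * sm.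

Let LS0 : 0 < LS%:R :> R. Proof. exact: lt_trans (expR_gt0 _) lattice_scale_gt. Qed.
Let ap : 0 < a.
Proof. by apply: lt_le_trans a0; rewrite (pmulr_rgt0 _ (ltr0Sn R 599)). Qed.

Let xJ (x : Rn R n) i : R := (i \in J)%:R * tnth x i.
Let sum_xJ x : \sum_i xJ x i ^+ 2 = sumJ x.
Proof.
rewrite /sumJ [RHS]big_mkcond; apply: eq_bigr => i _; rewrite /xJ.
by case: (i \in J); rewrite ?mul1r// mul0r expr0n.
Qed.

Let yrow (g : rmat n k) j i : R := (i \in J)%:R * @entry R n k g j i.
Let lin_yrow g j x : lin (yrow g j) x = mrow (xJ x) g j.
Proof. by apply: eq_bigr => i _; rewrite /yrow /xJ; ring. Qed.

Let NLSE : N * LS%:R = a * sm / 100.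
Proof. by rewrite -NLS [RHS]mulrC mulKf// pnatr_eq0. Qed.
Let N0 : 0 < N.
Proof.
rewrite -(pmulr_lgt0 _ LS0) -(pmulr_rgt0 _ (ltr0Sn R 99)) NLS.
exact: mulr_gt0.
Qed.
Let N6 : 36 * m%:R <= N ^+ 2.
Proof.
have h : 6 * sm <= N.
  rewrite -(ler_pM2r LS0) -(ler_pM2l (ltr0Sn R 99)) NLS.
  have -> : 100 * (6 * sm * LS%:R) = (600 * LS%:R) * sm by ring.
  by rewrite ler_pM2r.
have -> : 36 * m%:R = (6 * sm) ^+ 2 :> R by rewrite -sm2; ring.
by rewrite ler_pXn2r// nnegrE ?(ltW N0)// mulr_ge0// ltW.
Qed.

Let yv (g : rmat n k) j i : R := N^-1 * yrow g j i.
Let lin_yv g j x : lin (yv g j) x = N^-1 * lin (yrow g j) x.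
Proof. exact: linZ. Qed.

(** [Ev] puts every coordinate of the image beyond N LS in the orthant b. [Near] tolerates a total
    defect k in units of N, which makes it stable under a small change of g. *)
Let Ev (g : rmat n k) (b : 'I_k -> bool) : set (Rn R n) :=
  [set x | forall j, a * sm / 100 <= @sg R (b j) * lin (yrow g j) x].
Let Near (g : rmat n k) (b : 'I_k -> bool) : set (Rn R n) :=
  [set x | \sum_j Num.max (LS%:R - @sg R (b j) * lin (yv g j) x) 0 <= k%:R].
Let Bad (g : rmat n k) : set (Rn R n) := [set x | 9 * k%:R <= \sum_j lin (yv g j) x ^+ 2].

Let mEv g b : measurable (Ev g b).
Proof.
apply: measurable_forall => j; apply: measurable_ge_fun.
by apply: measurable_funM => //; exact: measurable_lin.
Qed.

Let mNear g b : measurable (Near g b).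
Proof.
apply: measurable_le_fun; apply: measurable_sum => j; apply: measurable_maxr => //.
by apply: measurable_funB => //; apply: measurable_funM => //; exact: measurable_lin.
Qed.

Let mBad g : measurable (Bad g).
Proof.
apply: measurable_ge_fun; apply: measurable_sum => j.
by apply: measurable_funX; exact: measurable_lin.
Qed.

Let msumJ : measurable_fun setT sumJ.
Proof.
rewrite (_ : sumJ = fun x => \sum_i xJ x i ^+ 2); last by apply/funext => x; rewrite sum_xJ.
apply: measurable_sum => i; apply: measurable_funX; apply: measurable_funM => //.
exact: measurable_coord.
Qed.

Let e (c : R) := expR c ^+ k.
Let e0 c : 0 < e c. Proof. by rewrite exprn_gt0 ?expR_gt0. Qed.
Let eM c c' : e c * e c' = e (c + c'). Proof. by rewrite /e expRD exprMn. Qed.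
Let eE c : e c = expR (k%:R * c). Proof. by rewrite /e expRM_natl. Qed.

Let us (g : unit -> R) : \sum_u g u = g tt.
Proof. by rewrite (bigD1 tt)//= big1 ?addr0// => -[]. Qed.

(** For each x with |X_J| large the matrix reaches the orthant with probability e^(-10 k); averaging
    over x costs the further factor e^-k. *)
Let mean_Ev b : e (- 11) <= \sum_g @rmass R n k g * pr Q (Ev g b).
Proof.
have mE : measurable [set x | a ^+ 2 * m%:R <= sumJ x] by exact: measurable_ge_fun.
apply: (@le_trans _ _ (e (- 10) * pr Q [set x | a ^+ 2 * m%:R <= sumJ x])).
  have -> : e (- 11) = e (- 10) * e (- 1) by rewrite eM; congr e; lra.
  by rewrite ler_pM2l.
have := @pr_sum_le R n Q unit _ (fun=> e (- 10)) (fun g => @rmass R n k g)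
  (fun=> [set x | a ^+ 2 * m%:R <= sumJ x]) (fun g => Ev g b).
rewrite us; apply => //.
- by move=> _; exact: ltW.
- by move=> g; exact: rmass_ge0.
move=> x; rewrite us indicE; case: (boolP (x \in _)) => [|_]; last first.
  by rewrite mulr0 sumr_ge0// => g _; rewrite mulr_ge0 ?rmass_ge0.
rewrite inE => ax; rewrite mulr1.
have asm0 : 0 < a * sm by rewrite mulr_gt0.
apply: (le_trans (rmat_small_ball_expR n0 k0 (v := xJ x) b asm0 _)).
  by rewrite sum_xJ exprMn sm2.
apply: ler_sum => g _; rewrite ler_wpM2l ?rmass_ge0//.
case: (boolP [forall j, _]) => [/forallP h|_]; last by rewrite ler0n.
by rewrite indicE mem_set// => j; rewrite lin_yrow.
Qed.

Let SS b (g : rmat n k) := e (- 11) / 2 <= pr Q (Ev g b).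
Let BB b (g : rmat n k) := pr Q (Near g b) < e (- 11) / 4.

Let mass_SS b : e (- 11) / 2 <= \sum_g @rmass R n k g * (SS b g)%:R.
Proof.
have h : \sum_g @rmass R n k g * pr Q (Ev g b) <=
    \sum_g @rmass R n k g * (SS b g)%:R + e (- 11) / 2.
  have w (c : R) : c = \sum_g @rmass R n k g * c by rewrite -mulr_suml sum_rmass mul1r.
  rewrite [X in _ <= _ + X]w -big_split/=.
  apply: ler_sum => g _; rewrite -mulrDr ler_wpM2l ?rmass_ge0//.
  rewrite /SS; case: (leP (e (- 11) / 2) (pr Q (Ev g b))) => [_|h]; last by rewrite /= add0r ltW.
  by apply: (le_trans (pr_le1 _ _)) => //; rewrite lerDl divr_ge0// ltW.
by have := mean_Ev b; lra.
Qed.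

Hypothesis contra : 800 * LS%:R * s <= a * sm.

Let Ns : 8 * s <= N.
Proof.
rewrite -(ler_pM2r LS0) -(ler_pM2l (ltr0Sn R 99)) NLS; apply: le_trans contra.
by rewrite le_eqVlt; apply/orP; left; apply/eqP; ring.
Qed.

(** Suppose g' is closer to g, and take x in [Ev g b] whose marginals along the k normalized row
    differences stay below s. Passing to g' moves the coordinates by at most 8 k s <= k N in total,
    so x is in [Near g' b]. The exceptional x have mass at most k e^(-14 k) <= e^(-11 k) / 4. *)
Let SS_BB_dist b g g' : SS b g -> BB b g' ->
  64 * k%:R <= \sum_j \sum_i (@entry R n k g j i - @entry R n k g' j i) ^+ 2.
Proof.
rewrite /SS /BB => Sg Bg; rewrite leNgt; apply/negP => D.
pose del j i : R := (i \in J)%:R * (@entry R n k g j i - @entry R n k g' j i).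
pose dj j : R := Num.sqrt (\sum_i del j i ^+ 2).
have del0 j : 0 <= \sum_i del j i ^+ 2 by apply: sumr_ge0 => i _; exact: sqr_ge0.
have dj2 j : dj j ^+ 2 = \sum_i del j i ^+ 2 by rewrite sqr_sqrtr.
have dj0 j : 0 <= dj j by exact: sqrtr_ge0.
have sumd : \sum_j dj j <= 8 * k%:R.
  apply: (@le_trans _ _ (\sum_j (dj j ^+ 2 / 16 + 4))).
    by apply: ler_sum => j _; have := sqr_ge0 (dj j - 8); rewrite sqrrB; lra.
  rewrite big_split/= sumr_const card_ord -mulr_suml -[4 *+ _]mulr_natr.
  have : \sum_j dj j ^+ 2 <= \sum_j \sum_i (@entry R n k g j i - @entry R n k g' j i) ^+ 2.
    apply: ler_sum => j _; rewrite dj2; apply: ler_sum => i _; rewrite /del.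
    by case: (i \in J); rewrite ?mul1r// mul0r expr0n sqr_ge0.
  by lra.
(* If [dj j] = 0 the inverse is 0 and u j vanishes; [lin_del] survives because [del j] then vanishes
   too. *)
pose u j i := (dj j)^-1 * del j i.
have u1 j : \sum_i u j i ^+ 2 <= 1.
  under eq_bigr do rewrite exprMn.
  rewrite -mulr_sumr -dj2 exprVn; have [->|dn] := eqVneq (dj j) 0.
    by rewrite expr0n/= mulr0.
  by rewrite mulVf// expf_neq0.
have lin_del j x : lin (del j) x = dj j * lin (u j) x.
  rewrite linZ; have [d00|dn] := eqVneq (dj j) 0; last by rewrite mulrA divff// mul1r.
  rewrite d00 mul0r /lin big1// => i _.
  have /psumr_eq0P : \sum_i del j i ^+ 2 = 0 by rewrite -dj2 d00 expr0n.
  move=> /(_ (fun i _ => sqr_ge0 (del j i)) i isT)/eqP; rewrite sqrf_eq0 => /eqP ->.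
  by rewrite mul0r.
have mT j : measurable [set x | s <= `|lin (u j) x|].
  apply: measurable_ge_fun; apply: measurableT_comp => //; exact: measurable_lin.
have := @pr_cover R n Q 'I_k (Ev g b) (Near g' b) (fun j => [set x | s <= `|lin (u j) x|])
  (mEv g b) (mNear g' b) mT.
move=> /(_ _)/wrap[].
  move=> x Ex; have [ex|nex] := pselect (exists j, s <= `|lin (u j) x|); first by right.
  left; rewrite /Near/=.
  apply: (@le_trans _ _ (\sum_j (s / N) * dj j)); last first.
    rewrite -mulr_sumr; apply: (@le_trans _ _ (s / N * (8 * k%:R))).
      by rewrite ler_wpM2l// divr_ge0// ltW.
    rewrite mulrA ler_piMl// mulrAC ler_pdivrMr// mul1r mulrC//.
  apply: ler_sum => j _; rewrite ge_max; apply/andP; split; last first.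
    by apply: mulr_ge0 => //; apply: divr_ge0 => //; exact: ltW.
  have us' : `|lin (u j) x| <= s.
    by rewrite leNgt; apply/negP => h; apply: nex; exists j; exact: ltW.
  have -> : lin (yv g' j) x = N^-1 * (lin (yrow g j) x - dj j * lin (u j) x).
    rewrite lin_yv -lin_del -linB; congr (_ * _); apply: eq_bigr => i _.
    by rewrite /yrow /del; ring.
  rewrite -(ler_pM2l N0) mulrBr NLSE.
  have -> : N * (@sg R (b j) * (N^-1 * (lin (yrow g j) x - dj j * lin (u j) x))) =
    @sg R (b j) * lin (yrow g j) x - dj j * (@sg R (b j) * lin (u j) x).
    by field; rewrite gt_eqF.
  have -> : N * (s / N * dj j) = dj j * s by field; rewrite gt_eqF.
  have h2 : @sg R (b j) * lin (u j) x <= s.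
    apply: le_trans us'; rewrite /sg; case: (b j); rewrite ?mul1r ?mulN1r ?ler_norm//.
    by rewrite -normrN ler_norm.
  have := ler_wpM2l (dj0 j) h2; have := Ex j; lra.
move=> h.
have h2 : \sum_j pr Q [set x | s <= `|lin (u j) x|] <= k%:R * e (- 14).
  apply: (@le_trans _ _ (\sum_(j < k) e (- 14))); last first.
    by rewrite sumr_const card_ord mulr_natl.
  by apply: ler_sum => j _; exact: weak_tail.
have h3 : k%:R * e (- 14) <= e (- 11) / 4.
  have k1 : 1 <= k%:R :> R by rewrite ler1n.
  have kk : k%:R <= e 1.
    by rewrite eE mulr1; have := expR_ge1Dx (k%:R : R); lra.
  have e2 : e (- 2) <= 4^-1.
    apply: (@le_trans _ _ (expR (- 2))).
      by rewrite eE ler_expR; lra.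
    have -> : expR (- 2) = expR (- 1) ^+ 2 :> R by rewrite -expRM_natl; congr expR; lra.
    have -> : 4^-1 = 2^-1 ^+ 2 :> R by lra.
    rewrite lerXn2r ?nnegrE ?expR_ge0// expRN lef_pV2 ?posrE ?expR_gt0//.
    exact: expR1_ge2.
  apply: (@le_trans _ _ (e 1 * e (- 14))); first by rewrite ler_pM2r.
  rewrite eM; have -> : e (1 + - 14) = e (- 11) * e (- 2) by rewrite eM; congr e; lra.
  by rewrite ler_pM2l.
by move: h h2 h3 Sg Bg; lra.
Qed.

(** The squared distance 64 k yields e^(1 - 16 k), and dividing by the mass e^(-11 k) / 2 of [SS]
    leaves e^(-5 k): still small after a sum over 2^k orthants. *)
Let mass_BB b : \sum_g @rmass R n k g * (BB b g)%:R <= 2 * expR 1 * e (- 5).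
Proof.
have := rmass_concentration n0 k0 (@SS_BB_dist b).
have -> : expR (1 - 64 * k%:R / 4) = expR 1 * e (- 16) :> R.
  by rewrite eE -expRD; congr expR; field.
set q := \sum_g @rmass R n k g * (BB b g)%:R => h.
have q0 : 0 <= q by apply: sumr_ge0 => g _; rewrite mulr_ge0 ?rmass_ge0 ?ler0n.
have := le_trans (ler_wpM2r q0 (mass_SS b)) h.
have -> : e (- 16) = e (- 11) * e (- 5) by rewrite eM; congr e; lra.
have -> : e (- 11) / 2 * q = e (- 11) * (q / 2) by ring.
have -> : expR 1 * (e (- 11) * e (- 5)) = e (- 11) * (expR 1 * e (- 5)) by ring.
by rewrite ler_pM2l//; lra.
Qed.

Let mass_all_BB : \sum_(b : {ffun 'I_k -> bool}) \sum_g @rmass R n k g * (BB b g)%:R <= 4^-1.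
Proof.
apply: (@le_trans _ _ (\sum_(b : {ffun 'I_k -> bool}) 2 * expR 1 * e (- 5))).
  by apply: ler_sum => b _; exact: mass_BB.
rewrite sumr_const card_ffun card_bool card_ord -[leLHS]mulr_natl natrX.
have E2 := @expR1_ge2 R.
have k1 : 1 <= k%:R :> R by rewrite ler1n.
apply: (@le_trans _ _ (e 1 * (2 * expR 1 * e (- 5)))).
  rewrite ler_wpM2r//; first by rewrite !mulr_ge0 ?expR_ge0// ltW.
  by rewrite /e lerXn2r ?nnegrE ?expR_ge0.
have -> : e 1 * (2 * expR 1 * e (- 5)) = 2 * expR 1 * e (- 4).
  by rewrite mulrCA eM; congr (_ * e _); lra.
have e4 : e (- 4) <= expR (- 4) by rewrite eE ler_expR; lra.
apply: (@le_trans _ _ (2 * expR 1 * expR (- 4))).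
  by rewrite ler_wpM2l// mulr_ge0// expR_ge0.
rewrite -mulrA -expRD; have -> : expR (1 + - 4) = (expR 1 ^- 3) :> R.
  by rewrite -expRM_natl -expRN; congr expR; lra.
have -> : 4^-1 = 2 * 2^-1 ^+ 3 :> R by lra.
rewrite ler_pM2l// exprVn lef_pV2 ?posrE ?exprn_gt0 ?expR_gt0//.
by rewrite lerXn2r ?nnegrE ?expR_ge0.
Qed.

(** Markov's inequality at 9 k. Where |X_J|^2 < 16 m, the mean squared norm of the rescaled image is
    at most 16 k m / N^2 <= 4 k / 9 by [N6]. This part and the atypical part contribute at most 1/16
    each. *)
Let mean_Bad : \sum_g @rmass R n k g * pr Q (Bad g) <= 8^-1.
Proof.
pose c (b : bool) : R := if b then 1 else 16^-1.
pose E (b : bool) : set (Rn R n) := if b then [set x | 16 * m%:R <= sumJ x] else setT.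
have mE b : measurable (E b).
  by rewrite /E; case: b; [exact: (measurable_ge_fun _ msumJ)|exact: measurableT].
have := @pr_sum_le R n Q _ _ (fun g => @rmass R n k g) c Bad E (@rmass_ge0 R n k).
rewrite big_bool/= mul1r prT mulr1 => /(_ _ mBad mE _)/wrap[].
- by case => //=.
- move=> x; rewrite big_bool/= mul1r indicT mulr1.
  have [hx|hx] := leP (16 * m%:R) (sumJ x).
    rewrite indicE mem_set//=; apply: (@le_trans _ _ 1); last by rewrite lerDl.
    rewrite -(@sum_rmass R n k); apply: ler_sum => g _.
    by rewrite ler_piMr ?rmass_ge0// indicE lern1 leq_b1.
  apply: (@le_trans _ _ (16^-1)); last by rewrite lerDr.
  have kp : 0 < 9 * k%:R :> R by rewrite mulr_gt0// ltr0n.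
  rewrite -(ler_pM2l kp) mulr_sumr.
  apply: (@le_trans _ _ (\sum_g @rmass R n k g * (N^-2 * \sum_j mrow (xJ x) g j ^+ 2))).
    apply: ler_sum => g _; rewrite mulrCA ler_wpM2l ?rmass_ge0//.
    have -> : N^-2 * \sum_j mrow (xJ x) g j ^+ 2 = \sum_j lin (yv g j) x ^+ 2.
      by rewrite mulr_sumr; apply: eq_bigr => j _; rewrite lin_yv lin_yrow exprMn exprVn.
    rewrite indicE; case: (boolP (x \in _)) => [|_]; first by rewrite inE mulr1.
    by rewrite mulr0 sumr_ge0// => j _; exact: sqr_ge0.
  under eq_bigr do rewrite mulrCA.
  rewrite -mulr_sumr mulrC ler_pdivrMr ?exprn_gt0//.
  apply: (le_trans (rmat_second_moment n0 k0 (xJ x))).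
  rewrite sum_xJ.
  have m1 : 0 < m%:R :> R by rewrite ltr0n.
  have : 9 * k%:R / 16 * (36 * m%:R) <= 9 * k%:R / 16 * N ^+ 2.
    by rewrite ler_wpM2l// divr_ge0// ltW.
  apply: le_trans.
  have : k%:R * sumJ x <= k%:R * (16 * m%:R) by rewrite ler_wpM2l// ltW.
  move=> /le_trans; apply.
  have : 0 <= k%:R * m%:R :> R by rewrite mulr_ge0.
  by lra.
by move=> /le_trans; apply; move: typical; lra.
Qed.

(** The matrices with a bad typical size and those bad for some orthant have mass at most 1/4 each,
    so some g avoids both and satisfies the hypotheses of [lattice_spread] at A = LS. *)
Lemma paouris_contradiction : False.
Proof.
pose TT (g : rmat n k) := 2^-1 < pr Q (Bad g).
have mTT : \sum_g @rmass R n k g * (TT g)%:R <= 4^-1.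
  rewrite -(ler_pM2l (_ : 0 < 2^-1)) ?invr_gt0//.
  apply: (le_trans _ (le_trans mean_Bad _)); last by lra.
  rewrite mulr_sumr; apply: ler_sum => g _; rewrite mulrCA ler_wpM2l ?rmass_ge0//.
  by rewrite /TT; case: ltP => h; rewrite ?mulr1 ?mulr0 ?pr_ge0// ltW.
have [g [gT gB]] : exists g, ~~ TT g /\ forall b : {ffun 'I_k -> bool}, ~~ BB b g.
  apply: contrapT => nex.
  suff : 1 <= \sum_g @rmass R n k g * (TT g)%:R +
      \sum_(b : {ffun 'I_k -> bool}) \sum_g @rmass R n k g * (BB b g)%:R.
    by apply/negP; rewrite -ltNge; have := mass_all_BB; lra.
  rewrite exchange_big -big_split/= -[X in X <= _](@sum_rmass R n k); apply: ler_sum => g _.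
  rewrite -mulr_sumr -mulrDr ler_peMr ?rmass_ge0//.
  case: (boolP (TT g)) => [_|nT].
    by apply: ler_wpDr => //; apply: sumr_ge0 => ? _; exact: ler0n.
  have [b Bb] : exists b : {ffun 'I_k -> bool}, BB b g.
    apply: contrapT => nb; apply: nex; exists g; split=> // b; apply/negP => Bb.
    by apply: nb; exists b.
  by rewrite add0r (bigD1 b)//= Bb; apply: ler_wpDr => //; apply: sumr_ge0 => ? _; exact: ler0n.
have := @lattice_spread R n Q k (yv g) lcQ k0 LS.
move=> /(_ _ _)/wrap[].
- have : 2^-1 <= pr Q (~` Bad g) by rewrite prC//; move: gT; rewrite /TT -leNgt; lra.
  move=> /le_trans; apply; apply: le_pr.
  + exact: measurableC.
  + apply: measurable_le_fun; apply: measurable_sum => j; apply: measurableT_comp => //.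
    exact: measurable_lin.
  move=> x; rewrite /Bad/= => /negP; rewrite -ltNge => h.
  (* From (|y| - 3)^2 >= 0; with a sum of squares below 9 k it gives 9 k / 6 + 3 k / 2 = 3 k. *)
  apply: (@le_trans _ _ (\sum_j (lin (yv g j) x ^+ 2 / 6 + 3 / 2))).
    apply: ler_sum => j _; rewrite -[lin (yv g j) x ^+ 2]real_normK ?num_real//.
    by have := sqr_ge0 (`|lin (yv g j) x| - 3); rewrite sqrrB; lra.
  by rewrite big_split/= sumr_const card_ord -mulr_suml -[(3 / 2) *+ _]mulr_natr; lra.
- move=> b; have := gB [ffun j => b j].
  rewrite (_ : ([ffun j => b j] : 'I_k -> bool) = b); last by apply/funext => j; rewrite ffunE.
  by rewrite /BB -leNgt.
apply/negP; rewrite -ltNge; apply: (lt_trans lattice_scale_gt).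
have h : (LS < LS.*2.+1)%N by rewrite ltnS -addnn leq_addr.
by move: h; rewrite -(ltr_nat R).
Qed.

End paouris.

(** * Counting half-spaces *)

Section tree.
Context {R : realType} {n : nat} {I : finType}.
Variable Q : probability (Rn R n) R.
Variable H : I -> set (Rn R n).
Implicit Types (B : set (Rn R n)).

Definition cvx_set B := forall (a : R) x y, 0 < a < 1 -> B x -> B y -> B (combRn a x y).

Hypotheses (mH : forall h, measurable (H h)) (cH : forall h, cvx_set (H h)).

Fixpoint tree_sum (r : nat) B : R :=
  if r is r'.+1 then \sum_h tree_sum r' (B `&` H h) else pr Q B.

Lemma tree_sum0 r B : measurable B -> pr Q B = 0 -> tree_sum r B = 0.
Proof.
elim: r B => [//|r IHr] B mB B0 /=; rewrite big1// => h _.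
have mBH : measurable (B `&` H h) by exact: measurableI.
apply: IHr => //; apply/eqP; rewrite eq_le pr_ge0 andbT -B0.
by apply: le_pr => // x [].
Qed.

Definition hits x : R := \sum_h \1_(H h) x.

(** [tree_sum r B] is the r-th moment of [hits] on B, and this is Markov's inequality for it; in the
    induction each point with l hits has l children. *)
Lemma tree_sum_ge r B (l : R) : measurable B -> 0 <= l ->
  l ^+ r * pr Q (B `&` [set x | l <= hits x]) <= tree_sum r B.
Proof.
move=> mB l0; have mhits : measurable [set x | l <= hits x].
  by apply: measurable_ge_fun; apply: measurable_sum => h; exact: measurable_indic.
elim: r B mB => [|r IHr] B mB /=.
  by rewrite expr0 mul1r; apply: le_pr => //; exact: measurableI.
apply: (@le_trans _ _ (\sum_h l ^+ r * pr Q ((B `&` H h) `&` [set x | l <= hits x]))); last first.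
  by apply: ler_sum => h _; apply: IHr; exact: measurableI.
rewrite exprSr -mulrA -mulr_sumr ler_wpM2l ?exprn_ge0//.
have us (g : unit -> R) : \sum_u g u = g tt by rewrite (bigD1 tt)//= big1 ?addr0// => -[].
have := @pr_sum_le R n Q unit I (fun=> l) (fun=> 1) (fun=> B `&` [set x | l <= hits x])
  (fun h => B `&` H h `&` [set x | l <= hits x]).
have e1 : \sum_h 1 * pr Q (B `&` H h `&` [set x | l <= hits x]) =
    \sum_h pr Q (B `&` H h `&` [set x | l <= hits x]).
  by apply: eq_bigr => h _; rewrite mul1r.
rewrite us e1; apply => //.
- by move=> _; exact: measurableI.
- by move=> h; apply: measurableI => //; exact: measurableI.
move=> x; rewrite us indicE; case: (boolP (x \in _)) => [|_]; last first.
  by rewrite mulr0; apply: sumr_ge0 => h _; rewrite mul1r.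
rewrite inE => -[Bx lx]; rewrite mulr1; apply: (le_trans lx).
apply: ler_sum => h _; rewrite mul1r !indicE.
case: (boolP (x \in H h)) => [|_]; last by rewrite ler0n.
by rewrite inE => Hx; rewrite mem_set.
Qed.

Variables (np : nat) (K : R).
Hypotheses (np0 : (0 < np)%N) (K0 : 0 < K).
Hypothesis count : forall B (v u : nat), measurable B -> cvx_set B ->
  expR (- v%:R) <= pr Q B -> (0 < u)%N ->
  #|[pred h | expR (- u%:R) * pr Q B <= pr Q (B `&` H h)]|%:R
    <= K * expR (u%:R / 2) * (1 + v%:R / np%:R) ^+ 2.

(** 320 = 64 * 5: 64 from (1 + x)^2 <= 64 e^(x/4), 5 from the geometric series of e^(-u/4). The
    factor e is for rounding the logarithm of a proportion. *)
Definition tree_const : R := 320 * expR 1.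

Lemma sum_expRN4 U : \sum_(u < U) expR (- (u%:R / 4)) <= 5 :> R.
Proof.
have q1 : expR (- 4^-1) <= 4 / 5 :> R.
  rewrite expRN -[4 / 5]invrK lef_pV2 ?posrE ?expR_gt0 ?invr_gt0//.
  by have := expR_ge1Dx (4^-1 : R); rewrite invf_div; lra.
set q : R := expR (- 4^-1) in q1.
have q0 : 0 < q by exact: expR_gt0.
suff : \sum_(u < U) expR (- (u%:R / 4)) <= 5 - 5 * q ^+ U.
  by move=> /le_trans; apply; rewrite lerBlDr lerDl mulr_ge0// exprn_ge0// ltW.
elim: U => [|U IHU]; first by rewrite big_ord0 expr0; lra.
rewrite big_ord_recr/=; have -> : expR (- (U%:R / 4)) = q ^+ U :> R.
  by rewrite -expRM_natl; congr expR; lra.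
have : 0 <= q ^+ U by rewrite exprn_ge0// ltW.
rewrite exprS; move: IHU; set Y := q ^+ U; set S := \sum_(_ < _) _ => h Y0.
have : 0 <= Y * (4 / 5 - q) by rewrite mulr_ge0// subr_ge0.
lra.
Qed.

(** A child of proportion about e^-u satisfies the induction hypothesis with v + u, which costs
    e^(u/4) because r <= np. With at most e^(u/2) such children, up to constants, the sum over u is
    that of e^(-u/4); the factor (1 + v / np)^2 becomes the additional e^(v/(4 np)) of depth r +
    1. *)
Lemma tree_sum_le r B (v : nat) : (r <= np)%N -> measurable B -> cvx_set B ->
  expR (- v%:R) <= pr Q B ->
  tree_sum r B <= pr Q B * (tree_const * K) ^+ r * expR (r%:R * v%:R / (4 * np%:R)).
Proof.
have D0 : 0 < tree_const * K.
  exact: mulr_gt0 (mulr_gt0 (ltr0Sn R 319) (expR_gt0 1)) K0.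
have npR : 0 < np%:R :> R by rewrite ltr0n.
elim: r B v => [|r IHr] B v rn mB cB Bv /=.
  by rewrite expr0 mul0r mul0r expR0 !mulr1.
have B0 : 0 < pr Q B by exact: lt_le_trans (expR_gt0 _) Bv.
pose rat h := pr Q (B `&` H h) / pr Q B.
have mBH h : measurable (B `&` H h) by exact: measurableI.
have rat0 h : 0 <= rat h by rewrite divr_ge0 ?pr_ge0.
have rat1 h : rat h <= 1.
  by rewrite ler_pdivrMr// mul1r; apply: le_pr => // x [].
(* The successor makes u positive, as [count] demands. Children of proportion 0 are removed by the
   factor [(0 < rat h)], so the default value of [ln] there is harmless. *)
pose uu h := (Num.truncn (- ln (rat h))).+1.
have uuP h : 0 < rat h -> expR (- (uu h)%:R) <= rat h <= expR (1 - (uu h)%:R).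
  move=> rh; have l0 : 0 <= - ln (rat h) by rewrite oppr_ge0 ln_le0.
  have /andP[t1 t2] := truncn_itv l0.
  rewrite -[X in _ <= X <= _](lnK (_ : rat h \in Num.pos)) ?posrE// !ler_expR /uu.
  by apply/andP; split; [lra|rewrite -natr1; lra].
(* The product of the proportion e^(1-u) and the cost e^(u/4). *)
pose g (u : nat) := expR (1 - 3 / 4 * u%:R) : R.
pose cst := (tree_const * K) ^+ r * expR (r%:R * v%:R / (4 * np%:R)).
have cst0 : 0 < cst by rewrite mulr_gt0 ?exprn_gt0 ?expR_gt0.
have term h : tree_sum r (B `&` H h) <= pr Q B * cst * ((0 < rat h)%R%:R * g (uu h)).
  have [rh|rh] := ltP 0 (rat h); last first.
    rewrite mul0r mulr0 tree_sum0//.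
    have /eqP : rat h = 0 by apply/eqP; rewrite eq_le rh rat0.
    by rewrite mulf_eq0 invr_eq0 (gt_eqF B0) orbF => /eqP.
  have /andP[u1 u2] := uuP h rh.
  have prE' : pr Q (B `&` H h) = pr Q B * rat h by rewrite /rat mulrC divfK// gt_eqF.
  have Bh : expR (- (v + uu h)%:R) <= pr Q (B `&` H h).
    rewrite prE' natrD opprD expRD; apply: ler_pM; rewrite ?expR_ge0//.
  have cBH : cvx_set (B `&` H h).
    by move=> a x y a01 [Bx Hx] [By Hy]; split; [exact: cB|exact: cH].
  apply: (le_trans (IHr _ _ (ltnW rn) (mBH h) cBH Bh)).
  rewrite mul1r prE' /cst; set P := (tree_const * K) ^+ r.
  have P0 : 0 <= P by rewrite exprn_ge0// ltW.
  rewrite -[leLHS]mulrA -[leLHS]mulrA -[leRHS]mulrA; apply: ler_wpM2l; first exact: ltW.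
  rewrite -[leRHS]mulrA [leLHS]mulrCA; apply: ler_wpM2l => //.
  have -> : expR (r%:R * v%:R / (4 * np%:R)) * g (uu h) =
     expR (1 - (uu h)%:R) * expR (r%:R * v%:R / (4 * np%:R) + (uu h)%:R / 4).
    by rewrite /g -!expRD; congr expR; field; rewrite gt_eqF.
  apply: ler_pM; rewrite ?expR_ge0// ler_expR natrD mulrDr mulrDl lerD2l.
  have -> : r%:R * (uu h)%:R / (4 * np%:R) = (r%:R / np%:R) * ((uu h)%:R / 4) :> R.
    by field; rewrite gt_eqF.
  by rewrite ler_piMl ?divr_ge0// ler_pdivrMr// mul1r ler_nat ltnW.
apply: (@le_trans _ _ (pr Q B * cst * \sum_h ((0 < rat h)%R%:R * g (uu h)))).
  by rewrite mulr_sumr; apply: ler_sum => h _; exact: term.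
have grp : \sum_h ((0 < rat h)%R%:R * g (uu h)) <=
    K * (1 + v%:R / np%:R) ^+ 2 * expR 1 * 5.
  pose U := (\max_h uu h).+1.
  have uU h : (uu h < U)%N by rewrite ltnS; exact: leq_bigmax.
  have -> : \sum_h ((0 < rat h)%R%:R * g (uu h)) =
      \sum_(u < U) g u * \sum_h ((0 < rat h)%R && (uu h == u))%:R.
    under [RHS]eq_bigr do rewrite mulr_sumr.
    rewrite exchange_big/=; apply: eq_bigr => h _.
    rewrite (bigD1 (Ordinal (uU h)))//= eqxx andbT big1 ?addr0 1?mulrC// => j ju.
    rewrite (_ : (uu h == j) = false) ?andbF ?mulr0//.
    by apply: contra_neqF ju => /eqP ju; apply/val_inj.
  apply: (@le_trans _ _ (
      \sum_(u < U) (K * (1 + v%:R / np%:R) ^+ 2 * expR 1) * expR (- (u%:R / 4)))); last first.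
    rewrite -mulr_sumr ler_wpM2l ?sum_expRN4//.
    by rewrite !mulr_ge0 ?(ltW K0) ?expR_ge0// exprn_ge0// addr_ge0// divr_ge0.
  apply: ler_sum => u _.
  have [u0|u0] := posnP u.
    rewrite big1 ?mulr0; last by move=> h _; rewrite u0 andbF.
    by rewrite !mulr_ge0 ?(ltW K0) ?expR_ge0// exprn_ge0// addr_ge0// divr_ge0.
  have c1 : \sum_h ((0 < rat h)%R && (uu h == u))%:R <=
      K * expR (u%:R / 2) * (1 + v%:R / np%:R) ^+ 2.
    apply: le_trans (count mB cB Bv u0).
    rewrite -sum1_card natr_sum [leRHS]big_mkcond/=; apply: ler_sum => h _.
    case: (boolP (_ && _)) => [/andP[rh /eqP uh]|_]; last by case: ifP.
    have /andP[u1 _] := uuP h rh.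
    by rewrite inE -ler_pdivlMr// -uh u1.
  apply: (le_trans (ler_wpM2l (expR_ge0 _) c1)).
  rewrite le_eqVlt; apply/orP; left; apply/eqP.
  have -> : expR (1 - 3 / 4 * u%:R) = expR 1 * expR (- (u%:R / 4)) * expR (- (u%:R / 2)) :> R.
    by rewrite -!expRD; congr expR; field.
  have x1 : expR (- (u%:R / 2)) * expR (u%:R / 2) = 1 :> R by rewrite -expRD addNr expR0.
  have -> : expR 1 * expR (- (u%:R / 4)) * expR (- (u%:R / 2)) *
      (K * expR (u%:R / 2) * (1 + v%:R / np%:R) ^+ 2)
    = (K * (1 + v%:R / np%:R) ^+ 2 * expR 1 * expR (- (u%:R / 4))) *
      (expR (- (u%:R / 2)) * expR (u%:R / 2)) by ring.
  by rewrite x1 mulr1.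
have V64 : (1 + v%:R / np%:R) ^+ 2 <= 64 * expR (v%:R / (4 * np%:R)) :> R.
  have V0 : 0 <= v%:R / np%:R :> R by rewrite divr_ge0.
  have h : 1 + v%:R / np%:R <= 8 * expR (v%:R / np%:R / 8) :> R.
    by have := expR_ge1Dx (v%:R / np%:R / 8 : R); lra.
  have -> : 64 * expR (v%:R / (4 * np%:R)) = (8 * expR (v%:R / np%:R / 8)) ^+ 2 :> R.
    rewrite exprMn -expRM_natl; congr (_ * expR _); first by ring.
    by field; rewrite gt_eqF.
  by apply: lerXn2r; rewrite ?nnegrE ?mulr_ge0 ?expR_ge0// addr_ge0.
apply: (@le_trans _ _ (pr Q B * cst * (tree_const * K * expR (v%:R / (4 * np%:R))))).
  apply: ler_wpM2l; first by rewrite mulr_ge0 ?pr_ge0 ?(ltW cst0).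
  apply: (le_trans grp).
  have -> : K * (1 + v%:R / np%:R) ^+ 2 * expR 1 * 5 =
      (K * expR 1 * 5) * (1 + v%:R / np%:R) ^+ 2 by ring.
  have -> : tree_const * K * expR (v%:R / (4 * np%:R)) =
      (K * expR 1 * 5) * (64 * expR (v%:R / (4 * np%:R))).
    by rewrite /tree_const; ring.
  by apply: ler_wpM2l => //; rewrite !mulr_ge0 ?expR_ge0 ?(ltW K0).
rewrite le_eqVlt; apply/orP; left; apply/eqP; rewrite /cst exprS.
have -> : expR (r.+1%:R * v%:R / (4 * np%:R)) =
    expR (r%:R * v%:R / (4 * np%:R)) * expR (v%:R / (4 * np%:R)) :> R.
  by rewrite -expRD -natr1; congr expR; field; rewrite gt_eqF.
by ring.
Qed.

End tree.

(** * How many half-spaces take a given proportion of a convex set *)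

Section halfspace_count.
Context {R : realType} {n : nat}.
Variable Q : probability (Rn R n) R.
Hypothesis lcQ : lc_measure Q.
Variable LS : nat.
Hypothesis LS_gt : expR 55 < LS%:R :> R.
Hypothesis typical : forall J : {set 'I_n}, (0 < #|J|)%N ->
  pr Q [set x | 16 * #|J|%:R <= \sum_(i in J) tnth x i ^+ 2] <= 16^-1.
Variables (p s0 t : R) (np : nat).
Hypotheses (p1 : 1 <= p) (pnp : p <= np%:R) (np2 : np%:R <= 2 * p).
Hypotheses (s00 : 0 < s0) (t0 : 0 < t).
Hypothesis weak : forall u : 'I_n -> R, \sum_i u i ^+ 2 <= 1 ->
  pr Q [set x | s0 <= `|lin u x|] <= expR (- (2 * p)).

Definition halfspace (h : 'I_n * bool) : set (Rn R n) :=
  [set x | t <= @sg R h.2 * tnth x h.1].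

Lemma measurable_halfspace h : measurable (halfspace h).
Proof.
apply: measurable_ge_fun; apply: measurable_funM => //.
exact: measurable_coord.
Qed.

Lemma cvx_halfspace h : cvx_set (halfspace h).
Proof.
move=> a x y /andP[a0 a1]; rewrite /halfspace/= tnth_mktuple => hx hy.
have b0 : 0 <= 1 - a by rewrite subr_ge0 ltW.
have := ler_wpM2l (ltW a0) hx; have := ler_wpM2l b0 hy.
have -> : @sg R h.2 * (a * tnth x h.1 + (1 - a) * tnth y h.1) =
  a * (@sg R h.2 * tnth x h.1) + (1 - a) * (@sg R h.2 * tnth y h.1) by ring.
lra.
Qed.

Let mcoord_ge (c : R) i : measurable [set x : Rn R n | c <= `|tnth x i : R|].
Proof.
apply: measurable_ge_fun; apply: measurableT_comp => //; exact: measurable_coord.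
Qed.

(* Borell's lemma for the law of X conditioned on B. *)
Lemma conditional_spread B (u : nat) i b : measurable B -> cvx_set B -> 0 < pr Q B ->
  (0 < u)%N -> expR (- u%:R) * pr Q B <= pr Q (B `&` halfspace (i, b)) ->
  pr Q B / 4 <= pr Q (B `&` [set x | t / (4 * u%:R) <= `|tnth x i : R|]).
Proof.
move=> mB cB B0 u0 hA; set c := t / (4 * u%:R).
pose A := B `&` halfspace (i, b).
pose D := B `&` [set x | c <= `|tnth x i : R|].
pose G := B `&` ~` [set x | c <= `|tnth x i : R|].
have mA : measurable A by apply: measurableI => //; exact: measurable_halfspace.
have mD : measurable D by exact: measurableI.
have mG : measurable G by apply: measurableI => //; exact: measurableC.
rewrite -/D leNgt; apply/negP => hD.
have hG : 3 / 4 * pr Q B <= pr Q G.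
  have : pr Q B <= pr Q (D `|` G).
    apply: le_pr => //; first exact: measurableU.
    by move=> x Bx; have [h|h] := pselect (c <= `|tnth x i : R|); [left|right].
  by move=> /le_trans /(_ (pr_setU_le Q mD mG)); lra.
have uR : 1 <= u%:R :> R by rewrite ler1n.
have r0 : 0 < 4 * u%:R + 1 :> R by lra.
(* This a solves a t - (1 - a) c = c and has a u <= 1/2. So e^(-u a) (3/4)^(1-a) >= 1/2 * 3/4, which
   exceeds 1/4. *)
pose a : R := 2 / (4 * u%:R + 1).
have a01 : 0 < a < 1 by rewrite divr_gt0//= ltr_pdivrMr// mul1r; lra.
have /andP[a0 a1] := a01; have b0 : 0 < 1 - a by rewrite subr_gt0.
have := lcQ a01 mA mG mD.
move=> /(_ _)/wrap[].
  move=> x y [Bx hx] [By /negP]; rewrite /= -ltNge => hy; split; first exact: cB.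
  rewrite /= tnth_mktuple.
  have h1 : a * t <= a * `|tnth x i : R|.
    rewrite ler_pM2l//; apply: (le_trans hx); rewrite /sg /=; case: (b).
      by rewrite mul1r ler_norm.
    by rewrite mulN1r -normrN ler_norm.
  have h2 : (1 - a) * `|tnth y i : R| <= (1 - a) * c by rewrite ler_pM2l// ltW.
  have e : a * t - (1 - a) * c = c.
    by rewrite /a /c; field; rewrite !gt_eqF//; lra.
  have : a * `|tnth x i : R| - (1 - a) * `|tnth y i : R| <= `|a * tnth x i + (1 - a) * tnth y i|.
    apply: le_trans (lerB_normD _ _).
    by rewrite (normrM a) (normrM (1 - a)) (gtr0_norm a0) (gtr0_norm b0).
  by apply: le_trans; lra.
apply/negP; rewrite -ltNge; apply: (lt_le_trans hD).
apply: (@le_trans _ _ ((expR (- u%:R) * pr Q B) `^ a * (3 / 4 * pr Q B) `^ (1 - a))); last first.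
  apply: ler_pM; rewrite ?powR_ge0//; apply: ge0_ler_powR;
    rewrite ?nnegrE ?pr_ge0 ?(ltW a0) ?(ltW b0)//.
    by rewrite mulr_ge0 ?expR_ge0 ?pr_ge0.
  by rewrite mulr_ge0 ?pr_ge0// divr_ge0.
rewrite (powRM _ (expR_ge0 _) (pr_ge0 _ _)) powRM ?pr_ge0 ?divr_ge0// mulrACA -powRD; last first.
  by rewrite (gt_eqF B0) implybT.
rewrite [a + _]addrC subrK powRr1 ?pr_ge0// mulrC ler_wpM2r ?pr_ge0// -expRM.
have h34 : 3 / 4 <= (3 / 4 : R) `^ (1 - a).
  rewrite -[leLHS](@powRr1 _ (3 / 4)) ?divr_ge0//.
  apply: ger_powR; last by rewrite gerBl ltW.
  by apply/andP; split; lra.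
have hu : 2^-1 <= expR (- u%:R * a) :> R.
  apply: le_trans (expR_ge1Dx _).
  have : u%:R * a <= 2^-1.
    rewrite /a mulrA ler_pdivrMr//; lra.
  lra.
have : 2^-1 * (3 / 4) <= expR (- u%:R * a) * (3 / 4) `^ (1 - a).
  by apply: ler_pM => //; lra.
lra.
Qed.

(** The factor 2 is for the two signs of a coordinate. The square appears because the deviation
    estimate bounds sqrt #|J|, by 12 u * 800 LS * r s0 / t with r = 28 k / p. *)
Lemma halfspace_count B (v u : nat) : measurable B -> cvx_set B ->
  expR (- v%:R) <= pr Q B -> (0 < u)%N -> 12 * (600 * LS%:R) * u%:R <= t ->
  #|[pred h | expR (- u%:R) * pr Q B <= pr Q (B `&` halfspace h)]|%:R <=
  2 * ((12 * u%:R * (800 * LS%:R) * (28 * (8 * (1 + v%:R / np%:R)))) * (s0 / t)) ^+ 2.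
Proof.
move=> mB cB Bv u0 tu.
have p1' := p1; have pnp' := pnp; have np2' := np2.
have B0 : 0 < pr Q B by exact: lt_le_trans (expR_gt0 _) Bv.
set P := [pred h | _].
pose J : {set 'I_n} := finset (fun i => [exists b, P (i, b)]).
have cardPJ : (#|P| <= #|J| * 2)%N.
  have -> : (#|J| * 2 = #|finset.setX J (finset.setTfor bool)|)%N.
    by rewrite cardsX cardsT card_bool.
  apply: subset_leq_card.
  apply/fintype.subsetP => -[i b] Pib; rewrite finset.in_setX finset.in_setT andbT finset.inE /=.
  by apply/existsP; exists b.
apply: (@le_trans _ _ (2 * #|J|%:R)).
  by rewrite -natrM ler_nat mulnC.
rewrite ler_pM2l//.
have [J0|J0] := posnP #|J|; first by rewrite J0 exprn_even_ge0.
have uR : 0 < u%:R :> R by rewrite ltr0n.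
have npR : 1 <= np%:R :> R by exact: le_trans pnp.
have LS0 : 0 < LS%:R :> R by exact: lt_trans (expR_gt0 _) LS_gt.
pose c := t / (4 * u%:R).
have c0 : 0 < c by rewrite divr_gt0// mulr_gt0.
have mR : 0 < #|J|%:R :> R by rewrite ltr0n.
pose Z i := [set x : Rn R n | c <= `|tnth x i : R|].
have mZ i : measurable (Z i) by exact: mcoord_ge.
pose cnt x : R := \sum_(i in J) \1_(Z i) x.
pose E := B `&` [set x | #|J|%:R / 8 <= cnt x].
have mE : measurable E.
  apply: measurableI => //; apply: measurable_ge_fun.
  rewrite (_ : cnt = (fun x => \sum_i (i \in J)%:R * \1_(Z i) x)); last first.
    apply/funext => x; rewrite /cnt big_mkcond; apply: eq_bigr => i _.
    by case: (i \in J); rewrite ?mul1r ?mul0r.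
  by apply: measurable_sum => i; apply: measurable_funM => //; exact: measurable_indic.
(* On B the number of large coordinates has mean at least #|J| / 4 and never exceeds #|J|, so it is
   at least #|J| / 8 on an eighth of B. *)
have EB : pr Q B / 8 <= pr Q E.
  have h1 : #|J|%:R * (pr Q B / 4) <= \sum_i (i \in J)%:R * pr Q (B `&` Z i).
    rewrite mulr_natl -sumr_const big_mkcond; apply: ler_sum => i _.
    case: (boolP (i \in J)) => [|_]; last by rewrite mul0r.
    by rewrite inE => /existsP[b Pib]; rewrite mul1r; exact: (conditional_spread mB cB B0 u0 Pib).
  pose w (b : bool) : R := if b then #|J|%:R / 8 else #|J|%:R.
  pose F (b : bool) := if b then B else E.
  have := @pr_sum_le R n Q _ _ (fun i : 'I_n => (i \in J)%:R : R) w
    (fun i => B `&` Z i) F.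
  move=> /(_ _ _ _ _ _)/wrap[].
  - by move=> i; rewrite ler0n.
  - by case; rewrite /w// divr_ge0.
  - by move=> i; exact: measurableI.
  - by case.
  - move=> x; rewrite big_bool/= /w /F/= [X in X <= _](_ : _ =
        \sum_(i in J) (\1_(B `&` Z i) x : R)); last first.
      rewrite [RHS]big_mkcond; apply: eq_bigr => i _.
      by case: (i \in J); rewrite ?mul1r ?mul0r.
    have le1 : \sum_(i in J) \1_(B `&` Z i) x <= cnt x.
      apply: ler_sum => i _; rewrite !indicE ler_nat.
      case: (boolP (x \in B `&` Z i)) => //; rewrite inE => -[_ h].
      by rewrite mem_set.
    have [Bx|nBx] := pselect (B x); last first.
      rewrite big1; last by move=> i _; rewrite indicE memNset// => -[].
      by rewrite addr_ge0// mulr_ge0// divr_ge0.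
    have [Ex|nEx] := pselect (E x).
      have -> : \1_E x = 1 :> R by rewrite indicE mem_set.
      rewrite mulr1; apply: (@le_trans _ _ #|J|%:R).
        rewrite -sum1_card natr_sum; apply: ler_sum => i _.
        by rewrite indicE ler_nat leq_b1.
      by rewrite lerDr mulr_ge0// divr_ge0.
    have -> : \1_B x = 1 :> R by rewrite indicE mem_set.
    have -> : \1_E x = 0 :> R by rewrite indicE memNset.
    rewrite mulr0 addr0 mulr1.
    apply: (le_trans le1); rewrite leNgt; apply/negP => h; apply: nEx.
    by split => //=; exact: ltW.
  rewrite big_bool/= /w /F/= => h2; rewrite -(ler_pM2l mR).
  have := le_trans h1 h2; lra.
(* The 3 pays for the factor 1/8, and np ensures r >= 1, which [tail_growth] needs. *)
pose k := (v + np + 3)%N.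
have k0 : (0 < k)%N by rewrite /k addn3.
have kE : k%:R = v%:R + np%:R + 3 :> R by rewrite /k !natrD.
(* [tail_growth] from the exponent 2 p gives 2 p r / 4 = 14 k. *)
pose r := 28 * k%:R / p.
have pp : 0 < p by exact: lt_le_trans p1.
have vR : 0 <= v%:R :> R by exact: ler0n.
have r1 : 1 <= r.
  rewrite /r ler_pdivlMr// mul1r kE; lra.
have rV : r <= 28 * (8 * (1 + v%:R / np%:R)).
  rewrite /r -mulrA; apply: ler_wpM2l; first exact: ler0n.
  rewrite ler_pdivrMr// kE.
  have -> : 8 * (1 + v%:R / np%:R) * p = 8 * ((np%:R + v%:R) * (p / np%:R)).
    by field; lra.
  have h2 : 2^-1 <= p / np%:R by rewrite ler_pdivlMr; lra.
  have : (np%:R + v%:R) * 2^-1 <= (np%:R + v%:R) * (p / np%:R).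
    by rewrite ler_wpM2l//; lra.
  by lra.
(* That is c / 3: an eighth of the coordinates of size c gives c^2 #|J| / 8 >= (c / 3)^2 #|J|. *)
pose a := t / (12 * u%:R).
have a0 : 600 * LS%:R <= a.
  rewrite /a ler_pdivlMr; last by rewrite mulr_gt0.
  by apply: le_trans tu; rewrite le_eqVlt; apply/orP; left; apply/eqP; ring.
have weak' (w : 'I_n -> R) : \sum_i w i ^+ 2 <= 1 ->
    pr Q [set x | r * s0 <= `|lin w x|] <= expR (- 14) ^+ k.
  move=> w1; have p2 : 2 <= 2 * p by lra.
  apply: (le_trans (tail_growth lcQ s00 p2 r1 (weak w1))).
  rewrite -expRM_natl ler_expR /r le_eqVlt; apply/orP; left; apply/eqP.
  by field; rewrite gt_eqF.
have large : expR (- 1) ^+ k <= pr Q [set x | a ^+ 2 * #|J|%:R <= \sum_(i in J) tnth x i ^+ 2].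
  apply: (@le_trans _ _ (pr Q E)).
    apply: (@le_trans _ _ (expR (- v%:R) / 8)); last first.
      by apply: le_trans EB; rewrite ler_pM2r// invr_gt0.
    have -> : expR (- 1) ^+ k = expR (- np%:R) * (expR (- v%:R) * expR (- 1) ^+ 3) :> R.
      by rewrite -(expRM_natl k) -(expRM_natl 3) -!expRD kE; congr expR; ring.
    apply: (@le_trans _ _ (1 * (expR (- v%:R) / 8))); last by rewrite mul1r.
    apply: ler_pM; rewrite ?mulr_ge0 ?exprn_ge0 ?expR_ge0//.
    rewrite ler_pM2l ?expR_gt0//.
    have -> : 8^-1 = 2^-1 ^+ 3 :> R by lra.
    apply: lerXn2r; rewrite ?nnegrE ?expR_ge0//.
    by rewrite expRN lef_pV2 ?posrE ?expR_gt0// expR1_ge2.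
  apply: le_pr => //.
    apply: measurable_ge_fun.
    rewrite (_ : (fun x => _) = (fun x : Rn R n => \sum_i (i \in J)%:R * (tnth x i : R) ^+ 2)).
      apply: measurable_sum => i; apply: measurable_funM => //.
      by apply: measurable_funX; exact: measurable_coord.
    apply/funext => x; rewrite big_mkcond; apply: eq_bigr => i _.
    by case: (i \in J); rewrite ?mul1r ?mul0r.
  move=> x [_ /= hx].
  apply: (@le_trans _ _ (c ^+ 2 * (#|J|%:R / 8))).
    have -> : a = c / 3 by rewrite /a /c; field; rewrite gt_eqF.
    have aux (z y : R) : 0 <= y -> (z / 3) ^+ 2 * y <= z ^+ 2 * (y / 8).
      move=> y0; have zy : 0 <= z ^+ 2 * y by rewrite mulr_ge0 ?sqr_ge0.
      have -> : (z / 3) ^+ 2 * y = z ^+ 2 * y / 9 by field.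
      have -> : z ^+ 2 * (y / 8) = z ^+ 2 * y / 8 by field.
      lra.
    exact: aux (ltW mR).
  apply: (@le_trans _ _ (c ^+ 2 * cnt x)).
    by rewrite ler_wpM2l ?sqr_ge0.
  rewrite /cnt mulr_sumr; apply: ler_sum => i _; rewrite indicE.
  case: (boolP (x \in _)) => [|_]; last by rewrite mulr0 sqr_ge0.
  rewrite inE/= mulr1 => h; rewrite -[leRHS]real_normK ?num_real//.
  by apply: lerXn2r => //; rewrite nnegrE ltW.
have [sm [sm0 sm2]] : exists sm : R, 0 < sm /\ sm ^+ 2 = #|J|%:R.
  by exists (Num.sqrt #|J|%:R); rewrite sqrtr_gt0 sqr_sqrtr ?ltW.
have h : a * sm < 800 * LS%:R * (r * s0).
  rewrite ltNge; apply/negP => contra.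
  have rs0 : 0 <= r * s0 by apply: mulr_ge0; [lra|exact: ltW].
  apply: (@paouris_contradiction R n Q lcQ LS LS_gt J k a (r * s0) J0 k0 rs0 a0
    (typical J0) weak' large sm (a * sm / (100 * LS%:R)) sm0 sm2 _ contra).
  by field; rewrite gt_eqF.
have X0 : 0 <= 12 * u%:R * (800 * LS%:R) :> R.
  exact: mulr_ge0 (mulr_ge0 (ler0n R 12) (ltW uR)) (mulr_ge0 (ler0n R 800) (ltW LS0)).
have y0 : 0 <= s0 / t by exact: divr_ge0 (ltW s00) (ltW t0).
have r0 : 0 <= r by exact: le_trans ler01 r1.
have V0 := le_trans r0 rV.
have sX : sm <= 12 * u%:R * (800 * LS%:R) * (28 * (8 * (1 + v%:R / np%:R))) * (s0 / t).
  apply: (le_trans _ (ler_wpM2r y0 (ler_wpM2l X0 rV))).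
  have u12 : 0 < 12 * u%:R :> R by exact: mulr_gt0 (ltr0Sn R 11) uR.
  have -> : 12 * u%:R * (800 * LS%:R) * r * (s0 / t) = (800 * LS%:R * (r * s0)) / a.
    by rewrite /a invf_div; ring.
  have ap : 0 < a by exact: divr_gt0 t0 u12.
  by rewrite (ler_pdivlMr _ _ ap) mulrC; exact: ltW.
have z0 := mulr_ge0 (mulr_ge0 X0 V0) y0.
move: sX z0; rewrite -sm2; move: (_ * (s0 / t)) => z sz z0.
by apply: lerXn2r; rewrite ?nnegrE ?z0 ?sz ?(ltW sm0).
Qed.

End halfspace_count.

(** * The tail of the order statistic *)

Section order_statistics.
Context {R : realType} {n : nat}.
Variable Q : probability (Rn R n) R.
Hypothesis lcQ : lc_measure Q.
Variable LS : nat.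
Hypothesis LS_gt : expR 55 < LS%:R :> R.
Hypothesis typical : forall J : {set 'I_n}, (0 < #|J|)%N ->
  pr Q [set x | 16 * #|J|%:R <= \sum_(i in J) tnth x i ^+ 2] <= 16^-1.
Variables (p t C M W : R) (l : nat).
(** Chosen so that [tree_const * (kap * l)] = l / e, the factor gained at each level of the tree. *)
Local Notation kap := ((@tree_const R * expR 1)^-1).
Hypotheses (p1 : 1 <= p) (l0 : (0 < l)%N) (ln : (l <= n)%N).
Hypotheses (M_E : 12 * (600 * LS%:R) = M) (W_E : 12 * (800 * LS%:R) * (28 * 8) = W).
Hypotheses (C1 : 1 <= C) (CM : 8 * M <= C) (CMk : 6 * M / kap <= C)
  (CWk : 16 * W ^+ 2 * expR 4 / kap <= C).
Hypothesis tC : C * exp.ln (expR 1 * n%:R / l%:R) <= t.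
Let s0 : R := expR 2 * (C^-1 * t * Num.sqrt l%:R).
Hypothesis weak : forall u : 'I_n -> R, \sum_i u i ^+ 2 <= 1 ->
  pr Q [set x | s0 <= `|lin u x|] <= expR (- (2 * p)).

Let lR : 0 < l%:R :> R. Proof. by rewrite ltr0n. Qed.
Let LS0 : 0 < LS%:R :> R. Proof. exact: lt_trans (expR_gt0 _) LS_gt. Qed.
Let M0 : 0 < M.
Proof. rewrite -M_E; exact: mulr_gt0 (ltr0Sn R 11) (mulr_gt0 (ltr0Sn R 599) LS0). Qed.
Let C0 : 0 < C. Proof. exact: lt_le_trans ltr01 C1. Qed.
Let k0 : 0 < kap.
Proof. rewrite invr_gt0; exact: mulr_gt0 (mulr_gt0 (ltr0Sn R 319) (expR_gt0 1)) (expR_gt0 1). Qed.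

Let ratio_ge : expR 1 <= expR 1 * n%:R / l%:R :> R.
Proof.
by rewrite ler_pdivlMr// ler_wpM2l ?expR_ge0// ler_nat.
Qed.

Let tCge : C <= t.
Proof.
apply: le_trans tC; rewrite ler_peMr ?(ltW C0)//.
by rewrite -[leLHS](expRK 1) ler_ln ?posrE ?expR_gt0// (lt_le_trans (expR_gt0 1)).
Qed.

Let t0 : 0 < t. Proof. exact: lt_le_trans C0 tCge. Qed.

Let n_le : n%:R <= l%:R * expR (t / C).
Proof.
have h : expR 1 * n%:R / l%:R <= expR (t / C).
  rewrite -[leLHS]lnK ?posrE ?(lt_le_trans (expR_gt0 1))// ler_expR.
  by rewrite ler_pdivlMr// mulrC.
have n0 : 0 <= n%:R / l%:R :> R by rewrite divr_ge0.
have : n%:R / l%:R <= expR (t / C).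
  apply: le_trans h; rewrite -mulrA ler_peMl//.
  by have := @expR1_ge2 R; lra.
by rewrite ler_pdivrMr// mulrC.
Qed.

Let np := (Num.truncn p).+1.
Let pnp : p <= np%:R. Proof. exact/ltW/truncnS_gt. Qed.
Let np2 : np%:R <= 2 * p.
Proof.
have p0 : 0 <= p by exact: le_trans ler01 p1.
have /andP[tp _] := truncn_itv p0; rewrite /np -natr1.
have p1' := p1; lra.
Qed.

Let s00 : 0 < s0.
Proof. by rewrite /s0 mulr_gt0 ?expR_gt0// mulr_gt0 ?sqrtr_gt0// mulr_gt0 ?invr_gt0. Qed.

Local Notation H := (@halfspace R n t).

(** If M u <= t, [halfspace_count] applies: u^2 <= 8 e^(u/2), and the factor 1 / C^2 hidden in (s0 /
    t)^2 brings the constant below kap by [CWk]. For larger u all 2 n half-spaces may be counted: t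
    >= C ln(e n / l) gives n <= l e^(t/C) <= l e^(u/8) by [CM], and [CMk] makes u so large that 2
    e^(u/8) <= kap e^(u/2). *)
Let count B (v u : nat) : measurable B -> cvx_set B ->
  expR (- v%:R) <= pr Q B -> (0 < u)%N ->
  #|[pred h | expR (- u%:R) * pr Q B <= pr Q (B `&` H h)]|%:R
    <= (kap * l%:R) * expR (u%:R / 2) * (1 + v%:R / np%:R) ^+ 2.
Proof.
move=> mB cB Bv u0.
set V : R := 1 + v%:R / np%:R.
have V1 : 1 <= V by rewrite /V lerDl divr_ge0.
have uR : 0 < u%:R :> R by rewrite ltr0n.
have [tu|tu] := leP (M * u%:R) t.
  have := @halfspace_count R n Q lcQ LS LS_gt typical p s0 t np p1 pnp np2 s00 t0 weak B v u
    mB cB Bv u0; rewrite M_E => /(_ tu) /le_trans; apply.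
  have -> : 12 * u%:R * (800 * LS%:R) * (28 * (8 * V)) * (s0 / t) =
      W * (u%:R * V) * (expR 2 * Num.sqrt l%:R / C).
    by rewrite -W_E /s0; field; rewrite !gt_eqF.
  have sq : Num.sqrt l%:R ^+ 2 = l%:R :> R by rewrite sqr_sqrtr// ltW.
  have e4 : expR 2 ^+ 2 = expR 4 :> R by rewrite -expRM_natl; congr expR; lra.
  have -> : 2 * (W * (u%:R * V) * (expR 2 * Num.sqrt l%:R / C)) ^+ 2 =
      (2 * W ^+ 2 * expR 4 / C ^+ 2) * l%:R * u%:R ^+ 2 * V ^+ 2.
    have alg (a b x y z c : R) : c != 0 -> 2 * (a * (b * x) * (y * z / c)) ^+ 2 =
        2 * a ^+ 2 * y ^+ 2 / c ^+ 2 * z ^+ 2 * b ^+ 2 * x ^+ 2 by move=> ?; field.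
    by rewrite alg ?gt_eqF// sq e4.
  apply: ler_wpM2r; first exact: sqr_ge0.
  have u8 : u%:R ^+ 2 <= 8 * expR (u%:R / 2) :> R.
    have := @expR_ge1Dxn R (u%:R / 2) 1 (divr_ge0 (ltW uR) (ler0n R 2)).
    rewrite factE/= => h.
    have e : (u%:R / 2) ^+ 2 / 2 = u%:R ^+ 2 / 8 :> R by field.
    by move: h; rewrite e; lra.
  have c3 : 16 * W ^+ 2 * expR 4 / C ^+ 2 <= kap.
    rewrite ler_pdivrMr ?exprn_gt0//.
    move: CWk; rewrite ler_pdivrMr// => /le_trans; apply.
    rewrite mulrC; apply: ler_wpM2l; first exact: ltW.
    by rewrite expr2 ler_peMl// ltW.
  have q0 : 0 <= W ^+ 2 * expR 4 / C ^+ 2 * l%:R.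
    by rewrite mulr_ge0// divr_ge0 ?sqr_ge0// mulr_ge0 ?sqr_ge0 ?expR_ge0.
  apply: (@le_trans _ _ ((2 * W ^+ 2 * expR 4 / C ^+ 2 * l%:R) * (8 * expR (u%:R / 2)))).
    apply: ler_wpM2l => //.
    have -> : 2 * W ^+ 2 * expR 4 / C ^+ 2 * l%:R = 2 * (W ^+ 2 * expR 4 / C ^+ 2 * l%:R) by ring.
    exact: mulr_ge0.
  have -> : 2 * W ^+ 2 * expR 4 / C ^+ 2 * l%:R * (8 * expR (u%:R / 2)) =
      (16 * W ^+ 2 * expR 4 / C ^+ 2) * l%:R * expR (u%:R / 2) by ring.
  apply: ler_wpM2r; first exact: expR_ge0.
  by rewrite ler_pM2r.
apply: (@le_trans _ _ (2 * n%:R)).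
  rewrite -natrM ler_nat (leq_trans (max_card _))// card_prod card_ord card_bool.
  by rewrite mulnC.
have V2 : 1 <= V ^+ 2 by rewrite exprn_ege1.
have tc : t / C <= u%:R / 8.
  rewrite ler_pdivrMr// mulrAC ler_pdivlMr//.
  have := ler_wpM2l (ltW uR) CM; move: tu; lra.
have ub : 16 / 3 <= u%:R * kap.
  have h : C < M * u%:R by exact: le_lt_trans tCge tu.
  have : 6 * M / kap < M * u%:R by exact: le_lt_trans CMk h.
  rewrite ltr_pdivrMr// => h2.
  have : M * 6 < M * (u%:R * kap) by move: h2; rewrite mulrA mulrC.
  by rewrite ltr_pM2l//; lra.
have big : 2 * expR (u%:R / 8) <= kap * expR (u%:R / 2).
  have -> : expR (u%:R / 2) = expR (3 * u%:R / 8) * expR (u%:R / 8) :> R.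
    by rewrite -expRD; congr expR; field.
  rewrite mulrA; apply: ler_wpM2r; first exact: expR_ge0.
  have h := expR_ge1Dx (3 * u%:R / 8 : R).
  apply: (@le_trans _ _ (kap * (3 * u%:R / 8))).
    by move: ub; lra.
  apply: ler_wpM2l; first exact: ltW.
  by move: h; lra.
apply: (@le_trans _ _ (2 * (l%:R * expR (u%:R / 8)))).
  apply: ler_wpM2l => //; apply: (le_trans n_le).
  by apply: ler_wpM2l; rewrite ?ler_expR// ltW.
have -> : 2 * (l%:R * expR (u%:R / 8)) = l%:R * (2 * expR (u%:R / 8)) :> R by ring.
apply: (@le_trans _ _ (l%:R * (kap * expR (u%:R / 2)))); first by rewrite ler_pM2l.
have -> : l%:R * (kap * expR (u%:R / 2)) = kap * l%:R * expR (u%:R / 2) by ring.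
rewrite ler_peMr//; exact: mulr_ge0 (mulr_ge0 (ltW k0) (ltW lR)) (expR_ge0 _).
Qed.

Lemma order_statistics : pr Q [set x | l%:R <= hits H x] <= expR (- p).
Proof.
have mH h : measurable (H h) by exact: measurable_halfspace.
have cH h : cvx_set (H h) by exact: cvx_halfspace.
have K0 : 0 < kap * l%:R by exact: mulr_gt0.
have cT : @cvx_set R n setT by [].
have T1 : expR (- 0%:R) <= pr Q setT by rewrite oppr0 expR0 prT.
have up := @tree_sum_le R n _ Q H mH cH np (kap * l%:R) (isT : (0 < np)%N) K0 count np setT 0%N
  (leqnn _) measurableT cT T1.
have lo := @tree_sum_ge R n _ Q H mH np setT l%:R measurableT (ltW lR).
rewrite setTI in lo; have {lo up} := le_trans lo up.
rewrite mulr0 mul0r expR0 mulr1 prT mul1r.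
have -> : tree_const * (kap * l%:R) = expR (- 1) * l%:R :> R.
  rewrite expRN; field; rewrite gt_eqF ?expR_gt0//=.
  by rewrite gt_eqF//; exact: mulr_gt0 (ltr0Sn R 319) (expR_gt0 1).
rewrite exprMn mulrC ler_pM2r ?exprn_gt0// => /le_trans; apply.
by rewrite -expRM_natl ler_expR mulrN1 lerN2.
Qed.

End order_statistics.

(** * Isotropic log-concave vectors *)

Section rearrangement.
Context {R : realType}.

Lemma sorted_nth_count (s : seq R) (t : R) (k : nat) :
  sorted (fun a b : R => b <= a) s -> (k < size s)%N ->
  (t <= nth 0 s k) = (k < count (fun a : R => (t <= a)%R) s)%N.
Proof.
elim: s k => [//|a s IHs] k /= ps ks.
have ge_trans : transitive (fun a b : R => b <= a).
  by move=> y x z /= xy yz; exact: le_trans yz xy.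
have sa : all (fun b => b <= a) s by exact: order_path_min ge_trans ps.
have [ta|at_] := leP t a.
  by case: k ks => [|k] ks //=; rewrite ltnS IHs// (path_sorted ps).
have c0 : count (fun a : R => t <= a) s = 0%N.
  apply/eqP; rewrite -leqn0 leqNgt -has_count -all_predC.
  by apply: sub_all sa => b ba /=; rewrite -ltNge (le_lt_trans ba).
rewrite c0 ltn0 /=; apply/negbTE; rewrite -ltNge.
case: k ks => [|k] //=; rewrite ltnS => ks.
by apply: le_lt_trans at_; exact: (allP sa _ (mem_nth 0 ks)).
Qed.

(** As t > 0, the half-spaces of the two signs of a coordinate are disjoint, so [hits] counts each
    coordinate of absolute value at least t once. *)
Lemma rearr_hits n (x : Rn R n) (t : R) (l : nat) : 0 < t -> (0 < l <= n)%N ->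
  (t <= rearr x l) = (l%:R <= hits (@halfspace R n t) x).
Proof.
move=> t0 /andP[l0 ln].
rewrite /rearr sorted_nth_count; first last.
- by rewrite size_sort size_map size_tuple prednK.
- by apply: sort_sorted => a b; rewrite orbC le_total.
rewrite prednK// (permP (permEl (perm_sort _ _))) count_map.
suff -> : hits (@halfspace R n t) x = (count (preim (fun a : R => `|a|) (fun a => t <= a)) x)%:R.
  by rewrite ler_nat.
rewrite /hits -(pair_bigA _ (fun i b => \1_(@halfspace R n t (i, b)) x : R))/=.
rewrite -sum1_count natr_sum [RHS]big_mkcond [RHS]big_tuple; apply: eq_bigr => i _.
rewrite big_bool/= !indicE.
have hE b : (x \in @halfspace R n t (i, b)) = (t <= @sg R b * tnth x i).
  by apply/idP/idP; rewrite inE.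
rewrite !hE /sg mul1r mulN1r.
have [x0|x0] := leP 0 (tnth x i : R).
  rewrite ger0_norm//; have -> : (t <= - (tnth x i : R)) = false.
    by apply/negbTE; rewrite -ltNge; apply: le_lt_trans t0; rewrite oppr_le0.
  by rewrite addr0; case: ifP.
rewrite ltr0_norm//; have -> : (t <= (tnth x i : R)) = false.
  by apply/negbTE; rewrite -ltNge; apply: lt_trans t0.
by rewrite add0r; case: ifP.
Qed.

End rearrangement.

(** * Consequences of isotropy and of a bound on sigma_X *)

Section moments.
Context {R : realType} {n : nat} {d : measure_display} {T : measurableType d}
  {P : probability T R}.
Variable X : {RV P >-> Rn R n}.
Local Notation Q := (distribution P X).

Lemma markov_pr (f : Rn R n -> R) (c b : R) : measurable_fun setT f -> (forall x, 0 <= f x) ->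
  0 < c -> (\int[P]_w (f (X w))%:E <= b%:E)%E -> pr Q [set x | c <= f x] <= b / c.
Proof.
move=> mf f0 c0 fb; have mA : measurable [set x | c <= f x] by exact: measurable_ge_fun.
rewrite ler_pdivlMr// mulrC -lee_fin EFinM prE//; apply: le_trans fb.
have -> : (\int[P]_w (f (X w))%:E = \int[Q]_x (f x)%:E)%E.
  by rewrite ge0_integral_distribution//; exact/measurable_EFinP.
apply: (@le_trans _ _ (\int[Q]_x (c * \1_[set x | c <= f x] x)%:E)%E).
  under eq_integral do rewrite EFinM.
  rewrite ge0_integralZl//; first by rewrite integral_indic// setIT.
  - by apply/measurable_EFinP; exact: measurable_indic.
  - by rewrite lee_fin ltW.
apply: ge0_le_integral => //.
- by move=> x _; rewrite lee_fin mulr_ge0// ltW.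
- by apply/measurable_EFinP; apply: measurable_funM => //; exact: measurable_indic.
- exact/measurable_EFinP.
move=> x _; rewrite lee_fin indicE; case: (boolP (x \in _)) => [|_]; last by rewrite mulr0.
by rewrite inE mulr1.
Qed.

Hypothesis ilc : isotropic_log_concave X.

Lemma isotropic_lc_measure : lc_measure Q.
Proof. by have [_ _ [f [mf lcf Qf]]] := ilc; exact: density_lc_measure mf lcf Qf. Qed.

Lemma isotropic_second_moment i : (\int[P]_w (tnth (X w) i ^+ 2)%:E = 1)%E.
Proof.
have [EX cov _] := ilc; have := cov i i.
rewrite eqxx unlock EX /= unlock => <-; apply: eq_integral => w _; congr EFin.
by rewrite -[RHS]/((coordRV X i w - 0) * (coordRV X i w - 0)) subr0 expr2.
Qed.

Lemma isotropic_typical (J : {set 'I_n}) : (0 < #|J|)%N ->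
  pr Q [set x | 16 * #|J|%:R <= \sum_(i in J) tnth x i ^+ 2] <= 16^-1.
Proof.
move=> J0; have mR : 0 < #|J|%:R :> R by rewrite ltr0n.
pose f (x : Rn R n) : R := \sum_i (i \in J)%:R * (tnth x i : R) ^+ 2.
have fE x : f x = \sum_(i in J) tnth x i ^+ 2.
  rewrite [RHS]big_mkcond; apply: eq_bigr => i _.
  by case: (i \in J); rewrite ?mul1r ?mul0r.
have mterm i : measurable_fun setT (fun x : Rn R n => (i \in J)%:R * (tnth x i : R) ^+ 2).
  by apply: measurable_funM => //; apply: measurable_funX; exact: measurable_coord.
have mf : measurable_fun setT f by exact: measurable_sum.
have f0 x : 0 <= f x by apply: sumr_ge0 => i _; rewrite mulr_ge0 ?sqr_ge0.
have mX : measurable_fun setT X by exact: measurable_funPT.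
have int : (\int[P]_w (f (X w))%:E <= (#|J|%:R)%:E)%E.
  under eq_integral do rewrite /f -sumEFin.
  rewrite ge0_integral_sum//; last 2 first.
  - by move=> i; apply/measurable_EFinP; exact: measurableT_comp (mterm i) mX.
  - by move=> i w _; rewrite lee_fin mulr_ge0 ?sqr_ge0.
  rewrite -sum1_card natr_sum -sumEFin [leRHS]big_mkcond; apply: lee_sum => i _.
  case: (boolP (i \in J)) => _; last first.
    by under eq_integral do rewrite mul0r; rewrite integral0.
  by under eq_integral do rewrite mul1r; rewrite isotropic_second_moment.
have c0 : 0 < 16 * #|J|%:R :> R by exact: mulr_gt0 (ltr0Sn R 15) mR.
have := markov_pr mf f0 c0 int.
have -> : #|J|%:R / (16 * #|J|%:R) = 16^-1 :> R.
  by rewrite invfM mulrCA divff ?mulr1// gt_eqF.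
apply: le_trans; apply: le_pr; [|exact: measurable_ge_fun|by move=> x /=; rewrite fE].
rewrite (_ : mkset _ = [set x | 16 * #|J|%:R <= f x]); first exact: measurable_ge_fun.
by apply: eq_set => x; rewrite fE.
Qed.

(** Markov's inequality for the p-th moment along the normalized u, with u = 0 apart. The factor e^2
    yields the exponent 2 p >= 2 that [tail_growth] asks for. *)
Lemma sigmaRV_weak_tail (p s : R) (u : 'I_n -> R) : 1 <= p -> 0 < s ->
  (sigmaRV X p <= s%:E)%E -> \sum_i u i ^+ 2 <= 1 ->
  pr Q [set x | expR 2 * s <= `|lin u x|] <= expR (- (2 * p)).
Proof.
move=> p1 s0 sp u1; have p0 : 0 < p by exact: lt_le_trans p1.
have es : 0 < expR 2 * s by rewrite mulr_gt0 ?expR_gt0.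
pose U := Num.sqrt (\sum_i u i ^+ 2).
have uu0 : 0 <= \sum_i u i ^+ 2 by apply: sumr_ge0 => i _; exact: sqr_ge0.
have U2 : U ^+ 2 = \sum_i u i ^+ 2 by rewrite sqr_sqrtr.
have [U0|Un] := eqVneq U 0.
  rewrite (_ : [set x | _] = set0); first by rewrite /pr measure0 expR_ge0.
  apply/seteqP; split => x //=; rewrite /lin big1 ?normr0; first by rewrite leNgt es.
  move=> i _; move: U2; rewrite U0 expr0n/= => /esym/psumr_eq0P.
  move=> /(_ (fun i _ => sqr_ge0 (u i)) i isT)/eqP; rewrite sqrf_eq0 => /eqP ->.
  by rewrite mul0r.
have Up : 0 < U by rewrite lt_neqAle eq_sym Un sqrtr_ge0.
have Ule : U <= 1 by rewrite -(@ler_pXn2r _ 2) ?nnegrE ?(ltW Up)// U2 expr1n.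
pose v i := U^-1 * u i.
have vsph : sphereRn [tuple v i | i < n].
  rewrite /sphereRn/=.
  have -> : dotRn [tuple v i | i < n] [tuple v i | i < n] = \sum_i U^-1 ^+ 2 * u i ^+ 2 :> R.
    by apply: eq_bigr => i _; rewrite tnth_mktuple -exprMn expr2.
  by rewrite -mulr_sumr -U2 -exprMn mulVf// expr1n.
have linv w : dotRn [tuple v i | i < n] (X w) = lin v (X w).
  by apply: eq_bigr => i _; rewrite tnth_mktuple.
have Nv : ('N[P]_p%:E[(fun w => (lin v (X w))%:E)] <= s%:E)%E.
  apply: le_trans sp; apply: ereal_sup_ubound; exists [tuple v i | i < n] => //.
  by apply: eq_Lnorm => w; rewrite linv.
have mlin : measurable_fun setT (fun x => `|lin v x| `^ p).
  apply: (measurableT_comp (measurable_powR p)).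
  by apply: measurableT_comp => //; exact: measurable_lin.
have int : (\int[P]_w (`|lin v (X w)| `^ p)%:E <= (s `^ p)%:E)%E.
  have -> : (\int[P]_w (`|lin v (X w)| `^ p)%:E = 'N[P]_p%:E[(fun w => (lin v (X w))%:E)] `^ p)%E.
    by rewrite poweR_Lnorm ?gt_eqF.
  rewrite -poweR_EFin; apply: gt0_ler_poweR; rewrite ?(ltW p0)//.
    by rewrite in_itv/= Lnorm_ge0 leey.
  by rewrite in_itv/= lee_fin ltW// leey.
have := markov_pr mlin (fun x => powR_ge0 _ _) (powR_gt0 p es) int.
have -> : s `^ p / (expR 2 * s) `^ p = expR (- (2 * p)).
  rewrite powRM ?expR_ge0 ?(ltW s0)// -expRM invfM mulrCA divff ?mulr1 ?expRN//.
  by rewrite gt_eqF// powR_gt0.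
apply: le_trans; apply: le_pr.
- apply: measurable_ge_fun; apply: measurableT_comp => //; exact: measurable_lin.
- exact: measurable_ge_fun.
move=> x /= h; apply: ge0_ler_powR; rewrite ?nnegrE ?(ltW p0) ?(ltW es)//.
apply: (le_trans h); rewrite /v linZ normrM ger0_norm ?invr_ge0 ?(ltW Up)//.
by rewrite ler_peMl// invf_ge1.
Qed.

End moments.

(** When A has positive mass, its negative logarithm is an upper bound of the set whose supremum is
    [sigmaRV_inv]. An empty set, with supremum -oo, is covered, and a supremum +oo forces mass 0. *)
Lemma prob_le_expeR_sigmaRV_inv {R : realType} {n : nat} {d : measure_display}
  {T : measurableType d} {P : probability T R} (X : {RV P >-> Rn R n}) (A : set (Rn R n)) (s : R) :
  measurable A ->
  (forall p, 1 <= p -> (sigmaRV X p <= s%:E)%E -> pr (distribution P X) A <= expR (- p)) ->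
  (distribution P X A <= expeR (- sigmaRV_inv X s))%E.
Proof.
move=> mA Ap; rewrite -(prE (distribution P X) mA).
have [A0|A0] := leP (pr (distribution P X) A) 0.
  by apply: le_trans (expeR_ge0 _); rewrite lee_fin.
rewrite -(@lnK _ (pr (distribution P X) A)) ?posrE//.
rewrite -[leLHS]/(expeR (exp.ln (pr (distribution P X) A))%:E) lee_expeR.
rewrite leeNr; apply: ge_ereal_sup => _ [p [p1 sp] <-].
rewrite -EFinN lee_fin lerNr -(@ler_expR R) lnK ?posrE//; exact: Ap.
Qed.

Theorem theorem5 (R : realType) :
  exists C : R, 0 < C /\
    forall (N : nat) (d : measure_display) (T : measurableType d)
      (P : probability T R) (X : {RV P >-> Rn R N}) (l : nat) (t : R),
      (1 <= N)%N ->
      isotropic_log_concave X ->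
      (1 <= l <= N)%N ->
      C * ln (expR 1 * N%:R / l%:R) <= t ->
      (P [set w | (t <= rearr (X w) l)%R]
        <= expeR (- sigmaRV_inv X (C^-1 * t * Num.sqrt l%:R)%R))%E.
Proof.
have [LS LSgt] : exists LS, expR 55 < LS%:R :> R.
  by exists (Num.truncn (expR 55 : R)).+1; exact: truncnS_gt.
have [M ME] : exists M : R, 12 * (600 * LS%:R) = M by exists (12 * (600 * LS%:R)).
have [W WE] : exists W : R, 12 * (800 * LS%:R) * (28 * 8) = W.
  by exists (12 * (800 * LS%:R) * (28 * 8)).
have LS0 : 0 <= LS%:R :> R by exact: ler0n.
have M0 : 0 <= M by rewrite -ME; exact: mulr_ge0 (ler0n R 12) (mulr_ge0 (ler0n R 600) LS0).
have [k ke] : exists k : R, (tree_const * expR 1)^-1 = k by exists (tree_const * expR 1)^-1.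
have k0 : 0 <= k.
  rewrite -ke invr_ge0; exact: mulr_ge0 (mulr_ge0 (ler0n R 320) (expR_ge0 1)) (expR_ge0 1).
(* [C1] and [C2] serve the values of u at which all half-spaces are counted, [C3] those at which the
   deviation estimate is used. *)
pose C1 := 8 * M; pose C2 := 6 * M / k; pose C3 := 16 * W ^+ 2 * expR 4 / k.
have C1_ge0 : 0 <= C1 by exact: mulr_ge0 (ler0n R 8) M0.
have C2_ge0 : 0 <= C2 by exact: divr_ge0 (mulr_ge0 (ler0n R 6) M0) k0.
have C3_ge0 : 0 <= C3.
  exact: divr_ge0 (mulr_ge0 (mulr_ge0 (ler0n R 16) (sqr_ge0 W)) (expR_ge0 4)) k0.
have [C CE] : exists C, C = 1 + C1 + C2 + C3 by exists (1 + C1 + C2 + C3).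
have CC : [/\ 1 <= C, C1 <= C, C2 <= C & C3 <= C].
  have le_sum (a b c : R) : 0 <= a -> 0 <= b -> 0 <= c ->
      [/\ 1 <= 1 + a + b + c, a <= 1 + a + b + c, b <= 1 + a + b + c & c <= 1 + a + b + c].
    by move=> *; split; lra.
  by rewrite CE; exact: le_sum.
have {CC} [C_ge1 CM CMk CWk] := CC.
have C0 : 0 < C by exact: lt_le_trans ltr01 C_ge1.
exists C; split=> // N d T P X l t N1 ilc /andP[l0 lN] tC.
have lR : 0 < l%:R :> R by rewrite ltr0n.
have t0 : 0 < t.
  apply: lt_le_trans tC; rewrite mulr_gt0// ln_gt0//.
  apply: (@lt_le_trans _ _ (expR 1)); first by rewrite expR_gt1.
  by rewrite ler_pdivlMr// ler_wpM2l ?expR_ge0// ler_nat.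
have EE : [set w | t <= rearr (X w) l] =
    X @^-1` [set x | l%:R <= hits (@halfspace R N t) x].
  by apply/seteqP; split => w /=; rewrite rearr_hits// l0.
have mE : measurable [set x : Rn R N | l%:R <= hits (@halfspace R N t) x].
  apply: measurable_ge_fun; apply: measurable_sum => h.
  by apply: measurable_indic; exact: measurable_halfspace.
rewrite EE; apply: (@prob_le_expeR_sigmaRV_inv _ _ _ _ _ X) => // p p1 sp.
have s0 : 0 < C^-1 * t * Num.sqrt l%:R.
  by apply: mulr_gt0; [apply: mulr_gt0; rewrite ?invr_gt0|rewrite sqrtr_gt0].
apply: (order_statistics (isotropic_lc_measure ilc) LSgt (isotropic_typical ilc) p1 l0 lN ME WE
  C_ge1 CM _ _ tC).
- by rewrite ke.
- by rewrite ke.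
- by move=> u; exact: sigmaRV_weak_tail.
Qed.
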